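(* Let $d\in\mathbb{N}$. If $k\in\{0,d\}$, then \[ \lim_{\substack{\mathcal{M}\in\widetilde{B}(k,d)\\ \mathcal{M}\to\infty}}\frac{\log|\widetilde{A}(k,d,\mathcal{M})|}{\log\mathcal{M}}=d\quad\text{and}\quad\lim_{\mathcal{M}\to\infty}\frac{\log|\widetilde{B}(k,d,\mathcal{M})|}{\log\mathcal{M}}=1. \] If $k\in\{1,\dots,d-1\}$, then \[ \liminf_{\substack{\mathcal{M}\in\widetilde{B}(k,d)\\ \mathcal{M}\to\infty}}\frac{\log|\widetilde{A}(k,d,\mathcal{M})|}{\log\mathcal{M}}=0,\qquad \limsup_{\substack{\mathcal{M}\in\widetilde{B}(k,d)\\ \mathcal{M}\to\infty}}\frac{\log|\widetilde{A}(k,d,\mathcal{M})|}{\log\mathcal{M}}=\max\{k,d-k\}, \] and \[ \lim_{\mathcal{M}\to\infty}\frac{\log|\widetilde{B}(k,d,\mathcal{M})|}{\log\mathcal{M}}=d+1. \]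
   Context: For a nonzero polynomial $A=a_0\prod_{i=1}^{d}(t-z_i)\in\mathbb{Z}[t]$ with $a_0\neq0$ and complex zeroes $z_i$ (listed with multiplicity), its Mahler measure is $M(A)=|a_0|\prod_{i=1}^d\max\{1,|z_i|\}$. For $d\in\mathbb{N}$, $k\in\{0,\dots,d\}$, $\mathcal{M}\in[1,\infty)$: $\widetilde{A}(k,d,\mathcal{M})$ is the set of $A\in\mathbb{Z}[t]$ with $\deg A=d$, $M(A)=\mathcal{M}$, and precisely $k$ complex zeroes (counted with multiplicities) inside the open unit disk; $\widetilde{B}(k,d)=\bigcup_{\mathcal{M}\ge1}\{M(A):A\in\widetilde{A}(k,d,\mathcal{M})\}$; $\widetilde{B}(k,d,\mathcal{M})=\widetilde{B}(k,d)\cap[1,\mathcal{M}]$. *)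

(* Defs.v *)
From HB Require Import structures.
From mathcomp Require Import all_boot all_order all_algebra.
From mathcomp Require Import all_classical all_reals all_analysis.
From mathcomp Require Import complex.
From mathcomp Require Import finmap.



Unset Printing Implicit Defensive.

Import Order.TTheory GRing.Theory Num.Theory.
Import numFieldNormedType.Exports.
Local Open Scope classical_set_scope.
Local Open Scope ring_scope.

(* The complex zeroes of A (viewed in C = R[i]), listed with multiplicity:
   the sequence r with  A = lead_coef A * prod_(z <- r) (X - z). *)
Definition czeros (R : realType) (A : {poly int}) : seq R[i] :=
  sval (closed_field_poly_normal (map_poly (fun c : int => c%:~R : R[i]) A)).

Definition cabs (R : realType) (z : R[i]) : R := Normc.normc z.

Definition mahler (R : realType) (A : {poly int}) : R :=
  `|lead_coef A|%:~R * \prod_(z <- czeros R A) Num.max 1 (cabs R z).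

Definition nzeros_in_disk (R : realType) (A : {poly int}) : nat :=
  count (fun z : R[i] => cabs R z < 1) (czeros R A).

Definition Atilde (R : realType) (k d : nat) (M : R) : set {poly int} :=
  [set A : {poly int} | (size A = d.+1)%N /\ mahler R A = M /\ nzeros_in_disk R A = k].

Definition Btilde (R : realType) (k d : nat) : set R :=
  [set m | 1 <= m /\ exists A : {poly int}, A \in Atilde R k d m].

Definition BtildeM (R : realType) (k d : nat) (M : R) : set R :=
  Btilde R k d `&` [set x | 1 <= x <= M].

(* cardinality of a (finite) set; these sets are finite *)
Definition card_set (T : choiceType) (S : set T) : nat := #|` fset_set S|%fset.

Definition liminf_along (R : realType) (S : set R) (f : R -> R) : \bar R :=
  ereal_sup [set ereal_inf [set (f x)%:E | x in S `&` [set x | M0 <= x]]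
            | M0 in [set: R]].
Definition limsup_along (R : realType) (S : set R) (f : R -> R) : \bar R :=
  ereal_inf [set ereal_sup [set (f x)%:E | x in S `&` [set x | M0 <= x]]
            | M0 in [set: R]].

Definition lim_along (R : realType) (S : set R) (f : R -> R) (L : R) : Prop :=
  (forall M0 : R, exists2 x, S x & M0 <= x) /\
  (f @ within S (pinfty_nbhs R) --> L).

Definition lim_pinfty (R : realType) (f : R -> R) (L : R) : Prop :=
  f @ pinfty_nbhs R --> L.

Definition ratioA (R : realType) (k d : nat) (M : R) : R :=
  ln (card_set _ (Atilde R k d M))%:R / ln M.
Definition ratioB (R : realType) (k d : nat) (M : R) : R :=
  ln (card_set _ (BtildeM R k d M))%:R / ln M.

(* Main.v *)
Require Import Defs.
From HB Require Import structures.
From mathcomp Require Import all_boot all_order all_algebra all_fingroup all_field.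
From mathcomp Require Import all_classical all_reals all_analysis.
From mathcomp Require Import complex ring lra zify.
From mathcomp Require polyrcf.

Set Implicit Arguments.
Unset Strict Implicit.
Unset Printing Implicit Defensive.

Import Order.TTheory GRing.Theory Num.Theory.
Local Open Scope ring_scope.

(* For 0 < k < d the proof rests on the factorization pattern of A under the Galois
   group G of a splitting field. Call a root b of an irreducible factor f of A outer
   at s in G when |s b| >= 1; grouping the roots of f by the set of s at which they
   are outer splits f into conjugate blocks. The product of the j-th coefficients of
   these blocks, times the leading coefficient, is an integer bounded
   by a constant times M(f), and by a divisor argument these integers determine f up
   to M^eps possibilities. Each block lies on one side of the unit circle, so it has
   degree at most max(k, d - k); moreover +M or -M is the product of the outer roots
   and the leading coefficient, hence its norm is divisible by the leading or the
   constant coefficient of f. This leaves max(k, d - k) integers of size M, whence the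
   upper bound M^(max(k, d - k) + eps). Equality occurs for integers M, through
   t^k A2 and A1 (t - 1)^(d-k).

   A positive proportion of all polynomials, defined by congruences modulo 36, has
   blocks of degree 1. For these both the leading and constant coefficients divide a
   norm of M, so each M is attained by at most M^eps of them: the number of Mahler
   measures up to M is M^(d+1-eps), and on average they are attained M^eps times.

   For k = 0 or k = d the Mahler measure is the absolute value of the constant or the
   leading coefficient, and polynomials with one dominant coefficient suffice. *)

(** * Number fields and valuation rings *)

(** Recovering [f] from the integers attached to its blocks uses neither ideals nor units of number
    rings. One valuation ring of the splitting field is fixed above every prime p. One is enough,
    because integrality is only concluded for rational numbers, and a rational number lying in all
    these rings is an integer. The D!-th power of an algebraic number of degree at most D has
    integral valuation, so a positive integer g with x^(D!) / g a unit at every p stands for the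
    ideal of x; it divides a known integer and hence takes few values. If two families of conjugate
    block coefficients have the same g and the same dyadic sizes, their quotients are algebraic
    integers with all conjugates at most 2 in absolute value, and there are boundedly many of these.
    Reducible polynomials are the obstacle to the exponent max(k, d - k): coding each factor
    separately would cost a power of M per factor. The coefficients of equal index of all factors
    are therefore multiplied into one integer of size M and recovered from it as divisors. A bound N
    <= M^(a + eps) always appears as N^r <= C X^(a r + 1) with r arbitrary, which keeps the counting
    within the natural numbers. *)

Section NumberFields.

Variable C : numClosedFieldType.
Local Notation toC := (@ratr C).
Local Notation "p ^q" := (map_poly toC p) (at level 2, format "p ^q").

Lemma ratr_pchar0 : [pchar rat] =i pred0.
Proof. exact: pchar_num. Qed.

(** One number is adjoined at a time. The generator is kept as a combination of [s] with natural
    coefficients because this shows later that [s] generates the whole field. *)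
Lemma primitive_element (s : seq C) :
  (forall y, y \in s -> exists2 r : {poly rat}, r != 0 & root r^q y) ->
  exists z, (exists2 r : {poly rat}, r != 0 & root r^q z) /\
   ((exists a : nat -> nat, z = \sum_(i < size s) s`_i *+ a i)
     /\ exists ps : seq {poly rat}, s = [seq p^q.[z] | p <- ps]).
Proof.
have algB : forall n (x z : C), (exists2 r : {poly rat}, r != 0 & root r^q x) ->
    (exists2 r : {poly rat}, r != 0 & root r^q z) ->
    (exists2 r : {poly rat}, r != 0 & root r^q (x *+ n + z)).
  move=> n x z hx hz.
  have /integral_algebraic ax : algebraicOver toC x.
    by case: hx => r r0 rr; exists r.
  have /integral_algebraic az : algebraicOver toC z.
    by case: hz => r r0 rr; exists r.
  have : integralOver toC (x *+ n + z).
    apply: integral_add => //; rewrite -mulr_natr; apply: integral_mul => //.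
    exact: integral_nat.
  by move/integral_algebraic => [r r0 rr]; exists r.
elim: s => [|x s IH] hs.
  exists 0; split; first by exists 'X; rewrite ?polyX_eq0 // map_polyX rootX.
  by split; [exists (fun=> 0%N); rewrite big_ord0 | exists nil].
have [|z [az [[a Dz] [ps Ds]]]] := IH; first by move=> y ys; apply: hs; rewrite inE ys orbT.
have ax := hs x (mem_head _ _).
suff [n [px [pz [Dpx Dpz]]]]: exists n px pz, x = px^q.[x *+ n + z] /\ z = pz^q.[x *+ n + z].
  exists (x *+ n + z); split; first exact: algB.
  split.
    exists (fun i => if i is i'.+1 then a i' else n).
    by rewrite /= big_ord_recl /= Dz.
  exists (px :: [seq p \Po pz | p <- ps]); rewrite /= -Dpx; congr (_ :: _).
  rewrite -map_comp Ds; apply: eq_map => p /=.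
  by rewrite map_comp_poly horner_comp -Dpz.
have [rx nz_rx rx0] := ax.
have [rz nz_rz rz0] := az.
(* [pchar0_PET] yields a generator of the form [x *+ n - y]. It is applied with [y = - z], a root of
   [rz \Po - 'X], so that the generator becomes [x *+ n + z]. *)
have nz' : (rz \Po - 'X) != 0.
  rewrite -size_poly_eq0 size_comp_poly2 ?size_poly_eq0 //.
  by rewrite size_polyN size_polyX.
have rz' : root (rz \Po - 'X)^q (- z).
  rewrite map_comp_poly rootE horner_comp rmorphN /= map_polyX hornerN hornerX opprK.
  exact: rz0.
have [n [[pz Dpz] [px Dpx]]] := pchar0_PET nz' rz' nz_rx rx0 ratr_pchar0.
exists n, px, (- pz); rewrite opprK in Dpx Dpz.
by split; rewrite ?Dpx // rmorphN hornerN /= Dpz opprK.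
Qed.

Lemma minimal_irreducible (z : C) :
  (exists2 r : {poly rat}, r != 0 & root r^q z) ->
  exists2 r : {poly rat}, r != 0 & root r^q z /\ irreducible_poly r.
Proof.
move=> [r0 nz0 rt0].
have ex : exists n, `[< exists r : {poly rat}, [/\ r != 0, root r^q z & size r = n] >].
  by exists (size r0); apply/asboolP; exists r0.
case: (ex_minnP ex) => n /asboolP [r [nzr rtr sr]] min.
exists r => //; split => //; apply/(subfx_irreducibleP rtr nzr) => q rq nzq.
by rewrite sr; apply: min; apply/asboolP; exists q.
Qed.

(** The field is the quotient of [{poly rat}] by the minimal polynomial of a primitive element. The
    generation clause is what the splitting field structure asks for. *)
Lemma number_field_exists (s : seq C) :
  (forall y, y \in s -> exists2 r : {poly rat}, r != 0 & root r^q y) ->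
  exists (Qs : fieldExtType rat) (f : {rmorphism Qs -> C}) (s1 : seq Qs),
   map f s1 = s /\ <<1 & s1>>%VS = fullv.
Proof.
move=> hs; have [z [az [[a Dz] [ps Ds]]]] := primitive_element hs.
have [r nz_r [rz0 irr_r]] := minimal_irreducible az.
have [Qs [f [z1 [z1C z1gen]]]] : exists (Qs : fieldExtType rat) (f : {rmorphism Qs ->
  C}) (z1 : Qs),
    f z1 = z /\ forall x : Qs, exists p, fieldExt_horner z1 p = x.
  exists (SubFieldExtType rz0 irr_r), (@subfx_inj _ _ toC z r), (subfx_root toC z r).
  split; first exact: subfx_inj_root.
  by move=> x; have [p ->] := subfxEroot rz0 nz_r x; exists p.
pose inQs := fieldExt_horner z1; pose s1 := map inQs ps.
have inQsK p: f (inQs p) = (map_poly toC p).[z].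
  rewrite /inQs /fieldExt_horner /= -horner_map z1C -map_poly_comp; congr _.[z].
  by apply: eq_map_poly => b /=; rewrite alg_num_field fmorph_rat.
exists Qs, f, s1; split; first by rewrite -map_comp Ds (eq_map inQsK).
have sz_ps: size ps = size s by rewrite Ds size_map.
apply/vspaceP=> x; rewrite memvf; have [p {x}<-] := z1gen x.
elim/poly_ind: p => [|p b ApQs]; first by rewrite rmorph0 mem0v.
rewrite rmorphD rmorphM /= fieldExt_hornerX fieldExt_hornerC /=.
move: (fieldExt_horner z1 p) ApQs => u ApQs.
suffices ->: z1 = \sum_(i < size s) s1`_i *+ a i.
  rewrite memvD ?memvZ ?mem1v ?memvM ?memv_suml // => i _.
  by rewrite rpredMn ?seqv_sub_adjoin ?mem_nth // size_map sz_ps.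
apply: (fmorph_inj f); rewrite z1C Dz rmorph_sum; apply: eq_bigr => i _.
by rewrite rmorphMn {1}Ds !(nth_map 0) ?sz_ps //= inQsK.
Qed.

Lemma splitting_field_exists (A : {poly rat}) : A != 0 ->
  exists (L : splittingFieldType rat) (f : {rmorphism L -> C}) (rs : seq L),
    map_poly (in_alg L) A = (lead_coef A)%:A *: \prod_(z <- rs) ('X - z%:P).
Proof.
move=> nzA; have [s Ds] := closed_field_poly_normal (map_poly toC A).
have nzAC : map_poly toC A != 0 by rewrite map_poly_eq0.
have [Qs [f [s1 [Ds1 gen]]]] : exists (Qs : fieldExtType rat) (f : {rmorphism Qs ->
  C}) (s1 : seq Qs),
   map f s1 = s /\ <<1 & s1>>%VS = fullv.
  apply: number_field_exists => y ys; exists A => //.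
  rewrite Ds rootZ ?lead_coef_eq0 //.
  by rewrite root_prod_XsubC.
pose B := map_poly (in_alg Qs) A.
have fB : map_poly f B = map_poly toC A.
  rewrite -map_poly_comp; apply: eq_map_poly => b /=.
  by rewrite alg_num_field fmorph_rat.
have DB : B = (lead_coef A)%:A *: \prod_(z <- s1) ('X - z%:P).
  apply: (map_poly_inj f); rewrite fB Ds map_polyZ rmorph_prod /= lead_coef_map.
  rewrite alg_num_field fmorph_rat -Ds1 big_map; congr (_ *: _); apply: eq_bigr => i _.
  by rewrite rmorphB /= map_polyX map_polyC.
have nzl : (lead_coef A)%:A != 0 :> Qs by rewrite scaler_eq0 oner_eq0 orbF lead_coef_eq0.
have ax : FieldExt_isSplittingField _ Qs.
  constructor; exists B; first by apply/polyOver1P; exists A.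
  by exists s1; [rewrite DB; apply: eqp_scale | exact: gen].
by exists (HB.pack_for (splittingFieldType rat) Qs ax), f, s1.
Qed.

End NumberFields.

Lemma galois_char0 (L : splittingFieldType rat) : galois 1 {:L}.
Proof.
apply/and3P; split; first exact: sub1v.
  apply/separableP => y _; apply: pcharf0_separable => p.
  by rewrite pchar_lalg pchar_num.
by apply: normalFieldf.
Qed.

(** * Valuation rings above a prime, by Zorn's lemma *)

Section ValuationRings.

Variable L : fieldType.
Implicit Types (p : nat) (V : L -> Prop).

Record subring_pred V : Prop := SubringPred {
  sr1 : V 1;
  srB : forall x y, V x -> V y -> V (x - y);
  srM : forall x y, V x -> V y -> V (x * y) }.

(* The last field says that p belongs to the maximal ideal. *)
Record valuation_ring p V : Prop := ValuationRing {
  vr_sub :> subring_pred V;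
  vr_total : forall x, V x \/ V x^-1;
  vr_p : ~ V p%:R^-1 }.

Definition over_pred V (h : {poly L}) := forall i, V h`_i.

Section Subring.

Variable V : L -> Prop.
Hypothesis hV : subring_pred V.

Lemma sr0 : V 0.
Proof. by rewrite -(subrr 1); apply: srB (sr1 hV) (sr1 hV). Qed.

Lemma srN x : V x -> V (- x).
Proof. by move=> Vx; rewrite -sub0r; apply: srB sr0 Vx. Qed.

Lemma srD x y : V x -> V y -> V (x + y).
Proof. by move=> Vx Vy; rewrite -[y]opprK; apply: srB Vx (srN Vy). Qed.

Lemma sr_nat n : V n%:R.
Proof. by elim: n => [|n IH]; [apply: sr0 | rewrite -natr1; apply: srD IH (sr1 hV)]. Qed.

Lemma sr_int (n : int) : V n%:~R.
Proof. by case: n => n; [apply: sr_nat | rewrite NegzE rmorphN; apply/srN/sr_nat]. Qed.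

Lemma srX x n : V x -> V (x ^+ n).
Proof.
by move=> Vx; elim: n => [|n IH]; [apply: sr1 | rewrite exprS; apply: srM].
Qed.

Lemma sr_sum (I : Type) (r : seq I) (P : pred I) (F : I -> L) :
  (forall i, P i -> V (F i)) -> V (\sum_(i <- r | P i) F i).
Proof. by move=> VF; apply: big_ind => //; [exact: sr0 | exact: srD]. Qed.

Lemma sr_prod (I : Type) (r : seq I) (P : pred I) (F : I -> L) :
  (forall i, P i -> V (F i)) -> V (\prod_(i <- r | P i) F i).
Proof. by move=> VF; apply: big_ind => //; [exact: (sr1 hV) | exact: srM]. Qed.

Lemma over_horner h x : over_pred V h -> V x -> V h.[x].
Proof.
move=> Vh Vx; rewrite horner_coef; apply: sr_sum => i _.
by apply: srM => //; apply: srX.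
Qed.

Lemma overD h k : over_pred V h -> over_pred V k -> over_pred V (h + k).
Proof. by move=> Vh Vk i; rewrite coefD; apply: srD. Qed.

Lemma overN h : over_pred V h -> over_pred V (- h).
Proof. by move=> Vh i; rewrite coefN; apply: srN. Qed.

Lemma overM h k : over_pred V h -> over_pred V k -> over_pred V (h * k).
Proof. by move=> Vh Vk i; rewrite coefM; apply: sr_sum => j _; apply: srM. Qed.

Lemma overZ c h : V c -> over_pred V h -> over_pred V (c *: h).
Proof. by move=> Vc Vh i; rewrite coefZ; apply: srM. Qed.

Lemma overC c : V c -> over_pred V c%:P.
Proof. by move=> Vc i; rewrite coefC; case: ifP => // _; apply: sr0. Qed.

Lemma overX : over_pred V 'X.
Proof. by move=> i; rewrite coefX; apply: sr_nat. Qed.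

Lemma over_prod (I : Type) (r : seq I) (P : pred I) (F : I -> {poly L}) :
  (forall i, P i -> over_pred V (F i)) -> over_pred V (\prod_(i <- r | P i) F i).
Proof.
by move=> VF; apply: big_ind => //; [exact: (overC (sr1 hV)) | exact: overM].
Qed.

Lemma over_sum (I : Type) (r : seq I) (P : pred I) (F : I -> {poly L}) :
  (forall i, P i -> over_pred V (F i)) -> over_pred V (\sum_(i <- r | P i) F i).
Proof.
by move=> VF; apply: big_ind => //; [exact: (overC sr0) | exact: overD].
Qed.

Lemma over_poly n F : (forall i, (i < n)%N -> V (F i)) -> over_pred V (\poly_(i < n) F i).
Proof. by move=> VF i; rewrite coef_poly; case: ifP => [/VF //|_]; apply: sr0. Qed.

Lemma adjoin_subring x :
  subring_pred (fun y => exists2 h, over_pred V h & y = h.[x]).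
Proof.
split=> [|_ _ [h Vh ->] [k Vk ->]|_ _ [h Vh ->] [k Vk ->]].
- by exists 1%:P; [apply: overC (sr1 hV) | rewrite hornerC].
- exists (h - k); last by rewrite hornerD hornerN.
  by apply: overD => //; apply: overN.
- by exists (h * k); [apply: overM | rewrite hornerM].
Qed.

End Subring.

Section Existence.

Variable p : nat.
Hypotheses (p_pr : prime p) (pchar0 : [pchar L] =i pred0).
Local Notation pL := (p%:R : L).

Let p0 : pL != 0.
Proof.
move: pchar0 => /pcharf0P ->; by rewrite -lt0n prime_gt0.
Qed.

Section Maximal.

Variable V : L -> Prop.
Hypothesis hV : subring_pred V.
Hypothesis Vp : ~ V pL^-1.
Hypothesis Vmax : forall W, subring_pred W -> (forall x, V x -> W x) ->
  ~ W pL^-1 -> forall x, W x -> V x.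

(** Otherwise the ring V[x] would be a larger subring avoiding 1/p. *)
Lemma maximal_adjoin x : ~ V x -> exists2 h, over_pred V h & pL^-1 = h.[x].
Proof.
move=> nVx; apply: contrapT => nW; apply: nVx.
apply: (Vmax (adjoin_subring hV x)) => //.
- by move=> y Vy; exists y%:P; [apply: overC | rewrite hornerC].
- by exists 'X; [apply: overX | rewrite hornerX].
Qed.

(** If the inverse of u = 1 - p a were missing, 1/p would be a polynomial in 1/u over V. Multiplying
    by a power u^n = 1 - p c clears the denominators and puts 1/p into V. *)
Lemma maximal_unit a : V a -> 1 - pL * a != 0 /\ V (1 - pL * a)^-1.
Proof.
move=> Va; set u := 1 - pL * a.
have u0 : u != 0.
  apply/eqP => /eqP; rewrite subr_eq0 => /eqP pa; apply: Vp.
  by rewrite (_ : pL^-1 = a) //; apply: (mulfI p0); rewrite mulfV.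
split=> //; apply: contrapT => /maximal_adjoin [h Vh].
rewrite horner_coef => e.
have Vu : V u by apply: srB (sr1 hV) _ => //; apply: srM => //; apply: sr_nat.
have [c Vc Dc] : exists2 c, V c & u ^+ (size h) = 1 - pL * c.
  elim: (size h) => [|n [c Vc Dc]].
    by exists 0; [apply: sr0 | rewrite expr0 mulr0 subr0].
  exists (a * (1 - pL * c) + c); last by rewrite exprS Dc /u; ring.
  apply: srD => //; apply: srM => //; apply: srB => //; first exact: sr1.
  by apply: srM => //; apply: sr_nat.
apply: Vp.
have Vs : V (u ^+ size h * pL^-1).
  rewrite e mulr_sumr; apply: sr_sum => // i _; rewrite mulrCA; apply: srM => //.
  rewrite exprVn -expfB //; exact: srX.
have -> : pL^-1 = u ^+ size h * pL^-1 + c.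
  by rewrite Dc mulrBl mul1r mulrAC mulfV // mul1r subrK.
exact: srD.
Qed.

(** If both x and 1/x are missing, 1/p is a polynomial h in x and a polynomial k in 1/x. As long as
    h is not shorter than k, the relation for k lowers the degree of h, and symmetrically; the
    descent ends with 1 = 0. *)
Lemma maximal_total x : V x \/ V x^-1.
Proof.
have [->|x0] := eqVneq x 0; first by left; apply: sr0.
apply: contrapT => /not_orP [/maximal_adjoin [h Vh Dh] /maximal_adjoin [k Vk Dk]].
have {Dh} Dh : pL * h.[x] = 1 by rewrite -Dh mulfV.
have {Dk} Dk : pL * k.[x^-1] = 1 by rewrite -Dk mulfV.
have [N leN] := ubnP (size h + size k)%N.
elim: N => // N IH in x h k x0 Vh Vk Dh Dk leN *.
wlog le_kh : x h k x0 Vh Vk Dh Dk leN / (size k <= size h)%N.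
  move=> W; case: (leqP (size k) (size h)) => [le|/ltnW le]; first exact: (W x h k).
  by apply: (W x^-1 k h); rewrite ?invr_eq0 ?invrK // addnC.
case Dn: (size h) => [|n].
  move/eqP: Dn; rewrite size_poly_eq0 => /eqP h0; move: Dh.
  by rewrite h0 horner0 mulr0 => /esym/eqP; rewrite oner_eq0.
(* Multiplied by x^n, the relation p k(1/x) = 1 expresses u x^n, with u = 1 - p k_0 a unit, through
   lower powers of x. This removes the top term of h. *)
have [u0 Vu] := maximal_unit (Vk 0%N).
set u := 1 - _ in u0 Vu.
pose K := \poly_(i < n) (if (n - i < size k)%N then k`_(n - i) else 0).
have VK : over_pred V K.
  by apply: over_poly => // i _; case: ifP => // _; apply: sr0.
have EK : u * x ^+ n = pL * K.[x].
  have -> : u * x ^+ n = (pL * k.[x^-1] - pL * k`_0) * x ^+ n by rewrite Dk.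
  rewrite -mulrBr -mulrA; congr (_ * _).
  rewrite Dn in le_kh; rewrite (horner_coef_wide _ le_kh) big_ord_recl expr0 mulr1.
  rewrite addrC addKr mulr_suml horner_poly (reindex_inj rev_ord_inj) /=.
  apply: eq_bigr => i _; rewrite /bump /= add1n.
  have li := ltn_ord i.
  have -> : (n - i.+1).+1 = (n - i)%N by lia.
  have -> : k`_(n - i) * x^-1 ^+ (n - i) * x ^+ n = k`_(n - i) * x ^+ i.
    rewrite -mulrA exprVn; congr (_ * _).
    apply: (mulfI (expf_neq0 (n - i) x0)); rewrite mulrA mulfV ?expf_neq0 // mul1r.
    by rewrite -exprD; congr (_ ^+ _); lia.
  by case: ltnP => // le; rewrite nth_default.
have xn : x ^+ n = u^-1 * (pL * K.[x]) by rewrite -EK mulKf.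
pose h' := \poly_(i < n) h`_i + (h`_n * (pL * u^-1)) *: K.
have Vh' : over_pred V h'.
  apply: overD => //; first exact: over_poly.
  apply: overZ => //; apply: srM => //; apply: srM => //; exact: sr_nat.
have Dh' : pL * h'.[x] = 1.
  apply: etrans Dh; congr (_ * _); rewrite /h' hornerD hornerZ horner_poly [h.[x]]horner_coef Dn.
  by rewrite big_ord_recr /= xn; congr (_ + _); ring.
have sh' : (size h' <= n)%N.
  apply: leq_trans (size_polyD _ _) _; rewrite geq_max size_poly.
  exact: leq_trans (size_scale_leq _ _) (size_poly _ _).
apply: (IH x h' k) => //; move: leN; rewrite Dn; lia.
Qed.

End Maximal.

(** A subring that is maximal among those avoiding 1/p is a valuation ring by [maximal_total]. *)
Lemma valuation_ring_exists : exists V, valuation_ring p V.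
Proof.
pose P := fun A : set L => A = set0 \/ (subring_pred A /\ ~ A pL^-1).
have [|A [PA Amax]] := @Zorn_bigcup L P.
  move=> F FP Ftot.
  have [[B FB [y By]]|ne] := pselect (exists2 B, F B & exists y, B y); last first.
    left; apply/seteqP; split => // y [B FB By].
    by case: ne; exists B => //; exists y.
  have ne C : F C -> (exists y, C y) -> subring_pred C /\ ~ C pL^-1.
    by move=> /FP [->|//] [z []].
  right; split; last by move=> [C FC Cp]; case: (ne C FC) => //; exists pL^-1.
  have two x z : (\bigcup_(X in F) X)%classic x -> (\bigcup_(X in F) X)%classic z ->
      exists C, [/\ F C, subring_pred C, C x & C z].
    move=> [C FC Cx] [D FD Dz]; case: (Ftot C D FC FD) => CD.
      by exists D; split => //; [apply: (ne D FD _).1; exists z | apply: CD].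
    by exists C; split => //; [apply: (ne C FC _).1; exists x | apply: CD].
  split.
  - by exists B => //; apply: sr1; apply: (ne B FB _).1; exists y.
  - by move=> x z hx hz; have [C [FC sC Cx Cz]] := two x z hx hz; exists C => //; apply: srB.
  - by move=> x z hx hz; have [C [FC sC Cx Cz]] := two x z hx hz; exists C => //; apply: srM.
have Zsub : subring_pred (fun x : L => exists n : int, x = n%:~R).
  split; first by exists 1.
    by move=> _ _ [m ->] [n ->]; exists (m - n); rewrite rmorphB.
  by move=> _ _ [m ->] [n ->]; exists (m * n); rewrite rmorphM.
have ZA : ~ (exists n : int, pL^-1 = n%:~R).
  move=> [n e].
  have : (n * p%:Z)%:~R = 1 :> L by rewrite rmorphM /= -e mulVf.
  rewrite -[1]/((1 : int)%:~R) => /eqP; rewrite -subr_eq0 -rmorphB /=.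
  have inj0 (m : int) : (m%:~R == 0 :> L) = (m == 0).
    case: m => m; first by rewrite (pcharf0P L).1.
    by rewrite NegzE rmorphN oppr_eq0 /= ((pcharf0P L).1 pchar0 m.+1).
  rewrite inj0 subr_eq0 => /eqP e1; move: p_pr.
  have : absz (n * p%:Z) = 1%N by rewrite e1.
  rewrite abszM absz_nat => /eqP; rewrite muln_eq1 => /andP [_ /eqP ->] //.
case: PA => [A0|[sA nAp]].
  exfalso; apply: (Amax (fun x : L => exists n : int, x = n%:~R)); last by right.
  by rewrite A0; split => // /(_ 1); apply; exists 1.
exists A; split => // x; apply: maximal_total => // W sW AW nWp y Wy.
apply: contrapT => nAy; apply: (Amax W); last by right.
by split => // /(_ y Wy).
Qed.

End Existence.

End ValuationRings.

Lemma pchar0_fieldExt (L : fieldExtType rat) : [pchar L] =i pred0.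
Proof. by move=> p; rewrite pchar_lalg pchar_num. Qed.

(** * Units, Gauss's lemma for linear factors, valuations of algebraic elements *)

Section ValuationTheory.

Variables (L : fieldExtType rat) (p : nat) (V : L -> Prop).
Hypotheses (p_pr : prime p) (hV : valuation_ring p V).
Local Notation pL := (p%:R : L).

Definition vunit x := [/\ x != 0, V x & V x^-1].

Lemma pchar0_natf_neq0 n : (n%:R == 0 :> L) = (n == 0%N).
Proof. by have /pcharf0P -> := pchar0_fieldExt L. Qed.

Lemma pchar0_intf_neq0 (n : int) : (n%:~R == 0 :> L) = (n == 0).
Proof.
case: n => n; first by rewrite pchar0_natf_neq0.
by rewrite NegzE rmorphN oppr_eq0 /= pchar0_natf_neq0.
Qed.

Lemma vr_p_neq0 : pL != 0.
Proof. by rewrite pchar0_natf_neq0 -lt0n prime_gt0. Qed.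

Lemma vunitM x y : vunit x -> vunit y -> vunit (x * y).
Proof.
move=> [x0 Vx Vx'] [y0 Vy Vy']; split; first by rewrite mulf_neq0.
  exact: (srM hV).
by rewrite invfM; apply: (srM hV).
Qed.

Lemma vunitV x : vunit x -> vunit x^-1.
Proof. by move=> [x0 Vx Vx']; split; rewrite ?invr_eq0 ?invrK. Qed.

Lemma vunit1 : vunit 1.
Proof. by split; rewrite ?invr1 ?oner_eq0 //; apply: (sr1 hV). Qed.

Lemma vunitX x n : vunit x -> vunit (x ^+ n).
Proof.
by move=> ux; elim: n => [|n IH]; [exact: vunit1 | rewrite exprS; apply: vunitM].
Qed.

(** From u p + w n = 1 one gets 1/n = u (p/n) + w and 1/p = u + w (n/p). One of p/n and n/p lies in
    V, and the second case would put 1/p into V. *)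
Lemma vunit_coprime (n : int) : ~~ (p%:Z %| n)%Z -> vunit n%:~R.
Proof.
move=> pn; have n0 : n != 0 by apply: contraNneq pn => ->; rewrite dvdz0.
have nL0 : n%:~R != 0 :> L by rewrite pchar0_intf_neq0.
split=> //; first exact: (sr_int hV).
have cp : coprimez p n by rewrite coprimezE absz_nat prime_coprime.
have /coprimezP [[u w] /= e] := cp.
have {}e : u%:~R * pL + w%:~R * n%:~R = 1 :> L.
  by rewrite -[RHS]/((1 : int)%:~R) -e rmorphD !rmorphM.
apply: contrapT => nVn.
have [Vpn|Vnp] := vr_total hV (pL / n%:~R).
  apply: nVn; have -> : n%:~R^-1 = u%:~R * (pL / n%:~R) + w%:~R :> L.
    by apply: (mulIf nL0); rewrite mulVf // mulrDl -mulrA divfK // e.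
  by apply: (srD hV); [apply: (srM hV) => //|]; apply: (sr_int hV).
apply: (vr_p hV); have -> : pL^-1 = u%:~R + w%:~R * (pL / n%:~R)^-1.
  rewrite invf_div; apply: (mulIf vr_p_neq0); rewrite mulVf ?vr_p_neq0 //.
  by rewrite mulrDl -mulrA divfK ?vr_p_neq0 // e.
by apply: (srD hV); [|apply: (srM hV) => //]; apply: (sr_int hV).
Qed.

Lemma vr_ratr (q : rat) : V (ratr q) -> ~~ (p%:Z %| denq q)%Z.
Proof.
move=> Vq; apply/negP => pd.
have pn : ~~ (p%:Z %| numq q)%Z.
  apply/negP => pn; have := coprime_num_den q; rewrite /coprime => /eqP g1.
  have : (p %| gcdn `|numq q| `|denq q|)%N by rewrite dvdn_gcd; apply/andP; split.
  by rewrite g1 dvdn1 => /eqP p1; move: p_pr; rewrite p1.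
have [n0 _ Vn] := vunit_coprime pn.
have d0 : (denq q)%:~R != 0 :> L by rewrite pchar0_intf_neq0 denq_neq0.
have /dvdzP [m Dm] := pd.
apply: (vr_p hV); have -> : pL^-1 = m%:~R * (ratr q * (numq q)%:~R^-1).
  rewrite /ratr; have -> : (numq q)%:~R / (denq q)%:~R / (numq q)%:~R = (denq q)%:~R^-1 :> L.
    by field; rewrite d0.
  move: d0; rewrite Dm rmorphM mulf_eq0 negb_or => /andP[m0 _]; field.
  by rewrite m0 vr_p_neq0.
by apply: (srM hV); [apply: (sr_int hV) | apply: (srM hV)].
Qed.

Lemma vr_X x n : V (x ^+ n.+1) -> V x.
Proof.
move=> Vx; have [//|Vx'] := vr_total hV x.
have [->|x0] := eqVneq x 0; first exact: (sr0 hV).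
have -> : x = x ^+ n.+1 * x^-1 ^+ n by rewrite exprVn exprS mulfK ?expf_neq0.
by apply: (srM hV) => //; apply: (srX hV).
Qed.

Lemma vunit_root x y K c : (0 < K)%N -> c != 0 -> y != 0 ->
  vunit (x ^+ K / c) -> vunit (y ^+ K / c) -> V (x / y).
Proof.
case: K => // K _ c0 y0 ux uy; apply: (vr_X (n := K)).
have [_ V1 _] := vunitM ux (vunitV uy); rewrite expr_div_n.
by rewrite invf_div mulrA divfK in V1.
Qed.

(** Gauss's lemma for a linear factor. For z in V the coefficients of Q are obtained from the top
    downwards, as in synthetic division. For 1/z in V those of z Q are obtained from the bottom
    upwards. *)
Lemma over_root_factor z (Q : {poly L}) :
  over_pred V (('X - z%:P) * Q) -> over_pred V Q /\ over_pred V (z *: Q).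
Proof.
move=> h; have hc i : V (Q`_i - z * Q`_i.+1).
  by have := h i.+1; rewrite mulrBl mul_polyC coefB coefXM coefZ.
have [Vz|Vz] := vr_total hV z.
  have VQ : over_pred V Q.
    move=> i; have [n] := ubnP (size Q - i); elim: n i => // n IH i le.
    have [lt|ge] := ltnP i (size Q); last by rewrite nth_default //; apply: (sr0 hV).
    have -> : Q`_i = (Q`_i - z * Q`_i.+1) + z * Q`_i.+1 by rewrite subrK.
    by apply: (srD hV) => //; apply: (srM hV) => //; apply: IH; lia.
  by split => //; apply: (overZ hV).
have [z0|z0] := eqVneq z 0.
  by rewrite z0 scale0r; split; [move=> i; move: (hc i); rewrite z0 mul0r subr0
     | move=> i; rewrite coef0; exact: (sr0 hV)].
have VzQ : over_pred V (z *: Q).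
  elim=> [|i IH]; rewrite coefZ.
    have := h 0%N; rewrite mulrBl mul_polyC coefB coefXM coefZ sub0r => /(srN hV).
    by rewrite opprK.
  have -> : z * Q`_i.+1 = z^-1 * (z *: Q)`_i - (Q`_i - z * Q`_i.+1).
    by rewrite coefZ mulKf //; ring.
  by apply: (srB hV) => //; apply: (srM hV).
split=> // i; rewrite -[Q`_i](mulKf z0); apply: (srM hV) => //.
by have := VzQ i; rewrite coefZ.
Qed.

(** Every selected factor X - z is replaced by the scalar z, by [over_root_factor]. *)
Lemma over_factors (rs : seq L) (P : pred L) (Q : {poly L}) :
  over_pred V (Q * \prod_(z <- rs) ('X - z%:P)) ->
  over_pred V ((\prod_(z <- rs | P z) z) *: (Q * \prod_(z <- rs | ~~ P z) ('X - z%:P))).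
Proof.
elim: rs Q => [|z rs IH] Q; first by rewrite !big_nil scale1r.
rewrite !big_cons => h; case Pz: (P z) => /=.
  have /over_root_factor [_] : over_pred V (('X - z%:P) * (Q * \prod_(j <- rs) ('X - j%:P))).
    by rewrite mulrCA.
  by rewrite scalerAl => /IH; rewrite -scalerAl scalerA mulrC.
by rewrite mulrA; apply: IH; rewrite -mulrA.
Qed.

(** The element in question is, for any choice of roots, the leading coefficient of the polynomial
    produced by [over_factors]. *)
Lemma over_lead_prod (rs : seq L) (P : pred L) l :
  over_pred V (l *: \prod_(z <- rs) ('X - z%:P)) -> V (l * \prod_(z <- rs | P z) z).
Proof.
rewrite -mul_polyC => /over_factors - /(_ P); set Q := \prod_(z <- rs | ~~ _) _ => h.
have := h (size Q).-1; rewrite mul_polyC !coefZ.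
have : Q \is monic by apply: monic_prod => z _; apply: monicXsubC.
by move/monicP; rewrite /lead_coef => ->; rewrite mulr1 mulrC.
Qed.

(** A factor X - z with z outside V becomes a polynomial over V after division by z. *)
Lemma coef_prod_XsubC_factor (rs : seq L) i :
  exists2 c, V c & (\prod_(z <- rs) ('X - z%:P))`_i =
     (\prod_(z <- rs | ~~ `[< V z >]) z) * c.
Proof.
have [Q VQ ->] : exists2 Q, over_pred V Q & \prod_(z <- rs) ('X - z%:P) =
     (\prod_(z <- rs | ~~ `[< V z >]) z) *: Q.
  elim: rs => [|z rs [Q VQ IH]].
    by exists 1; rewrite ?big_nil ?scale1r //; apply: (overC hV (sr1 hV)).
  rewrite !big_cons IH; case: asboolP => /= Vz.
    exists (('X - z%:P) * Q); last by rewrite scalerAr.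
    apply: (overM hV) => //; apply: (overD hV); first exact: (overX hV).
    exact/(overN hV)/(overC hV).
  have z0 : z != 0 by apply/eqP => z0; apply: Vz; rewrite z0; apply: (sr0 hV).
  have [//|Vz'] := vr_total hV z.
  exists ((z^-1 *: 'X - 1%:P) * Q); last first.
    rewrite -scalerAr [z * _]mulrC -scalerA; congr (_ *: _).
    by rewrite scalerAl scalerBr scalerA mulfV // scale1r -mul_polyC mulr1.
  apply: (overM hV) => //; apply: (overD hV); first exact/(overZ hV)/(overX hV).
  exact/(overN hV)/(overC hV)/(sr1 hV).
by exists Q`_i => //; rewrite coefZ.
Qed.

Lemma vunit_rat (c : rat) : c != 0 -> exists e : int, vunit (ratr c / pL ^ e).
Proof.
move=> c0.
have zcase (n : int) : n != 0 -> exists e : nat, vunit (n%:~R / pL ^+ e).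
  move=> n0; exists (logn p `|n|).
  have [m Dm] : exists m : int, n = m * p%:Z ^+ logn p `|n|.
    have /dvdzP [m Dm] : (p%:Z ^+ logn p `|n| %| n)%Z.
      by rewrite dvdzE abszX absz_nat pfactor_dvdnn.
    by exists m.
  have pe0 : pL ^+ logn p `|n| != 0 by rewrite expf_neq0 ?vr_p_neq0.
  rewrite {1}Dm rmorphM rmorphXn /= mulfK //; apply: vunit_coprime.
  apply/negP => pm; have : (p ^ (logn p `|n|).+1 %| `|n|)%N.
    rewrite {2}Dm abszM abszX absz_nat expnS dvdn_mul //.
  rewrite pfactor_dvdn ?ltnn //; by rewrite absz_gt0.
have nc0 : numq c != 0 by rewrite numq_eq0.
have [a Ha] := zcase _ nc0; have [b Hb] := zcase (denq c) (denq_neq0 c).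
exists (a%:Z - b%:Z); rewrite expfzDr ?vr_p_neq0 // -invr_expz /ratr.
have := vunitM Ha (vunitV Hb); congr vunit; rewrite -!exprnP; field.
by rewrite pchar0_intf_neq0 denq_neq0 !expf_neq0 ?vr_p_neq0.
Qed.

(* A vanishing sum with a unique term of least valuation is impossible, so two
   terms c_i x^i and c_j x^j of the equation of x have the same valuation. *)
Lemma vunit_algebraic (r : {poly rat}) x D : r != 0 -> x != 0 ->
  root (map_poly (in_alg L) r) x -> (size r <= D.+1)%N ->
  exists e : int, vunit (x ^+ D`! / pL ^ e).
Proof.
move=> r0 x0 rx sr.
have [d Hd] : exists d : nat, exists2 e : int, (0 < d <= D)%N & vunit (x ^+ d / pL ^ e).
  pose t (i : 'I_(size r)) : L := ratr r`_i * x ^+ i.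
  have st : \sum_i t i = 0.
    move: rx; rewrite rootE horner_coef size_map_poly => /eqP; apply: etrans.
    by apply: eq_bigr => i _; rewrite coef_map /= alg_num_field.
  have hi0 : ((size r).-1 < size r)%N by rewrite prednK // lt0n size_poly_eq0.
  pose P (i : 'I_(size r)) := r`_i != 0.
  have P0 : P (Ordinal hi0) by rewrite /P /= -lead_coefE lead_coef_eq0.
  have rat0 (c : rat) : (ratr c == 0 :> L) = (c == 0).
    rewrite /ratr mulf_eq0 invr_eq0 !pchar0_intf_neq0 numq_eq0.
    by rewrite (negPf (denq_neq0 c)) orbF.
  have t0 i : P i -> t i != 0 by move=> Pi; rewrite mulf_neq0 ?expf_neq0 // rat0.
  have [i Pi imin] : exists2 i, P i & forall j, P j -> V (t j / t i).
    have [s] : exists s : seq 'I_(size r), forall j, P j -> j \in s.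
      by exists (enum 'I_(size r)) => j; rewrite mem_enum.
    have : exists2 i, P i & forall j, P j -> j \in [::] -> V (t j / t i) by exists (Ordinal hi0).
    move=> _ hs.
    suff [i Pi imin] : exists2 i, P i & forall j, P j -> j \in s -> V (t j / t i).
      by exists i => // j Pj; apply: imin => //; apply: hs.
    elim: s {hs} => [|k s [i Pi IH]]; first by exists (Ordinal hi0).
    have [Pk|nPk] := boolP (P k); last first.
      by exists i => // j Pj; rewrite inE => /predU1P [jk|]; [rewrite -jk Pj in nPk | apply: IH].
    have [Vki|Vik] := vr_total hV (t k / t i).
      by exists i => // j Pj; rewrite inE => /predU1P [->//|]; apply: IH.
    exists k => // j Pj; rewrite inE => /predU1P [->|js].
      by rewrite mulfV ?t0 //; apply: (sr1 hV).
    have -> : t j / t k = (t j / t i) * (t k / t i)^-1.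
      by rewrite invf_div; field; rewrite !t0.
    by apply: (srM hV) => //; apply: IH.
  have [j Pj [ji uj]] : exists2 j, P j & j != i /\ vunit (t j / t i).
    apply: contrapT => no.
    have ti := t0 i Pi.
    have nV j : P j -> j != i -> ~ V (t i / t j).
      move=> Pj ji Vij; apply: no; exists j => //; split=> //.
      by split; [rewrite mulf_neq0 ?invr_eq0 ?t0 | exact: (imin j Pj) | rewrite invf_div].
    have e1 : 1 = - \sum_(j | j != i) t j / t i.
      apply: (mulfI ti); rewrite mulr1 mulrN mulr_sumr.
      apply/eqP; rewrite -addr_eq0; apply/eqP; rewrite -[RHS]st [RHS](bigD1 i) //=.
      by congr (_ + _); apply: eq_bigr => j _; rewrite mulrC divfK.
    have mD x1 y1 : x1 = 0 \/ (V x1 /\ ~ V x1^-1) -> y1 = 0 \/ (V y1 /\ ~ V y1^-1) ->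
        x1 + y1 = 0 \/ (V (x1 + y1) /\ ~ V (x1 + y1)^-1).
      move=> [->|[Vx nVx]]; first by rewrite add0r.
      move=> [->|[Vy nVy]]; first by rewrite addr0; right.
      have [xy0|xy0] := eqVneq (x1 + y1) 0; [by left | right].
      split; first exact: (srD hV).
      have x10 : x1 != 0 by apply/eqP => e; apply: nVx; rewrite e invr0; apply: (sr0 hV).
      have y10 : y1 != 0 by apply/eqP => e; apply: nVy; rewrite e invr0; apply: (sr0 hV).
      move=> Vs; have [Vxy|Vyx] := vr_total hV (x1 / y1).
        apply: nVy; have -> : y1^-1 = (x1 + y1)^-1 * (x1 / y1 + 1) by field; rewrite xy0 y10.
        by apply: (srM hV) => //; apply: (srD hV) => //; apply: (sr1 hV).
      apply: nVx; have -> : x1^-1 = (x1 + y1)^-1 * ((x1 / y1)^-1 + 1).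
        by field; rewrite xy0 x10 y10.
      by apply: (srM hV) => //; apply: (srD hV) => //; apply: (sr1 hV).
    have : \sum_(j | j != i) t j / t i = 0 \/
       (V (\sum_(j | j != i) t j / t i) /\ ~ V (\sum_(j | j != i) t j / t i)^-1).
      apply: (big_ind (fun y => y = 0 \/ (V y /\ ~ V y^-1))) => //; first by left.
      move=> j ji; have [Pj|] := boolP (P j); last first.
        by rewrite /P negbK => /eqP c0; left; rewrite /t c0 /ratr mul0r !mul0r.
      by right; split; [apply: imin | rewrite invf_div; apply: nV].
    have e1' : \sum_(j | j != i) t j / t i = -1 by rewrite e1 opprK.
    rewrite e1' => -[/eqP|[_]]; first by rewrite oppr_eq0 oner_eq0.
    by rewrite invrN invr1; apply; apply/(srN hV)/(sr1 hV).
  have [a ua] := vunit_rat Pi; have [b ub] := vunit_rat Pj.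
  have key : vunit (x ^+ j / x ^+ i * pL ^ (b - a)).
    have := vunitM (vunitM uj ua) (vunitV ub).
    congr vunit; rewrite /t expfzDr ?vr_p_neq0 // -invr_expz.
    have [ci cj] : ratr r`_i != 0 :> L /\ ratr r`_j != 0 :> L by rewrite !rat0.
    by field; rewrite ci cj !expf_neq0 // !expfz_neq0 ?vr_p_neq0.
  have lij (u v : 'I_(size r)) : (u - v <= D)%N by have := ltn_ord u; lia.
  case: (ltngtP i j) => ij; last by rewrite (ord_inj ij) eqxx in ji.
    exists (j - i)%N, (a - b); first by have := lij j i; lia.
    have := key; congr vunit; rewrite invr_expz opprB; congr (_ * _).
    apply: (mulIf (expf_neq0 i x0)); rewrite divfK ?expf_neq0 // -exprD.
    by congr (_ ^+ _); lia.
  exists (i - j)%N, (b - a); first by have := lij i j; lia.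
  have := vunitV key; congr vunit; rewrite invfM invf_div; congr (_ * _).
  apply: (mulIf (expf_neq0 j x0)); rewrite divfK ?expf_neq0 // -exprD.
  by congr (_ ^+ _); lia.
(* The exponent d found so far depends on x. Being at most D it divides D!, which serves all x and
   all p at once. *)
case: Hd => e /andP[d0 dD] ue; exists (e * (D`! %/ d)%:Z).
have dv : (d %| D`!)%N by rewrite dvdn_fact // d0.
have := vunitX (D`! %/ d) ue; congr vunit; rewrite expr_div_n -exprM.
by rewrite mulnC divnK //; congr (_ / _); rewrite exprnP exprz_exp.
Qed.

Lemma vunit_exponent_ge0 x K (e : int) : V x -> vunit (x ^+ K / pL ^ e) -> 0 <= e.
Proof.
case: e => // n Vx; rewrite NegzE -invr_expz invrK => -[u0 _ Vi].
exfalso; apply: (vr_p hV).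
have := u0; rewrite mulf_eq0 negb_or => /andP[xK0 _].
have -> : pL^-1 = (x ^+ K * pL ^+ n.+1)^-1 * x ^+ K * pL ^+ n.
  by rewrite exprS; field; rewrite vr_p_neq0 xK0 expf_neq0 ?vr_p_neq0.
by apply: (srM hV); [apply: (srM hV) => //; apply: (srX hV) | apply/(srX hV)/(sr_nat hV)].
Qed.

Lemma vunit_exponent_le x K (e N : nat) : (0 < N)%N -> V (N%:R / x) ->
  vunit (x ^+ K / pL ^+ e) -> (e <= K * logn p N)%N.
Proof.
move=> N0 VNx ux; rewrite leqNgt; apply/negP => lt; apply: (vr_p hV).
have /dvdnP [m Dm] : (p ^ logn p N %| N)%N by rewrite pfactor_dvdnn.
have pm : ~~ (p%:Z %| m%:Z)%Z.
  rewrite dvdzE !absz_nat; apply/negP => pm.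
  have : (p ^ (logn p N).+1 %| N)%N by rewrite {2}Dm expnS dvdn_mul.
  by rewrite pfactor_dvdn // ltnn.
have um : vunit m%:R by exact: (vunit_coprime pm).
have [m0 _ Vm] := um.
have [u0 Vu _] := ux; have := u0; rewrite mulf_eq0 negb_or => /andP[xK0 _].
have [f De] : exists f, e = (K * logn p N + f.+1)%N by exists (e - (K * logn p N).+1)%N; lia.
have V1 : V ((N%:R / x) ^+ K * (x ^+ K / pL ^+ e) * (m%:R^-1) ^+ K * pL ^+ f).
  apply: (srM hV); last exact/(srX hV)/(sr_nat hV).
  apply: (srM hV); last exact: (srX hV).
  by apply: (srM hV) => //; apply: (srX hV).
move: V1; have -> // : (N%:R / x) ^+ K * (x ^+ K / pL ^+ e) * (m%:R^-1) ^+ K * pL ^+ f = pL^-1.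
rewrite expr_div_n {1}Dm natrM natrX !exprMn -exprM [(logn p N * K)%N]mulnC De.
rewrite exprD exprS !exprVn; move: (x ^+ K) xK0 => X X0.
by field; rewrite !expf_neq0 ?vr_p_neq0 //= X0.
Qed.

End ValuationTheory.

Section GlobalValuations.

Variables (L : fieldExtType rat) (V : nat -> L -> Prop).
Hypothesis hV : forall p, prime p -> valuation_ring p (V p).

Lemma vr_ratr_int (q : rat) : (forall p, prime p -> V p (ratr q)) -> q \is a Num.int.
Proof.
move=> Vq; rewrite Qint_def; apply/eqP.
have dp : 0 < denq q := denq_gt0 q.
have [d Dd] : exists d : nat, denq q = d by exists `|denq q|%N; rewrite gez0_abs // ltW.
have d0 : (0 < d)%N by rewrite -ltz_nat -Dd.
have [d1|d1] := leqP d 1; first by rewrite Dd; congr Posz; lia.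
have pr := pdiv_prime d1; have := vr_ratr pr (hV pr) (Vq _ pr).
by rewrite Dd dvdzE !absz_nat pdiv_dvd.
Qed.

(** The integer g plays the role of the D!-th power of the ideal generated by x, as seen by the
    chosen rings. That g divides N^(D!) is the source of all divisor-function bounds. *)
Lemma divisor_code (r : {poly rat}) x D (N : nat) : r != 0 -> x != 0 ->
  root (map_poly (in_alg L) r) x -> (size r <= D.+1)%N -> (0 < N)%N ->
  (forall p, prime p -> V p x) -> (forall p, prime p -> V p (N%:R / x)) ->
  exists g : nat, [/\ (0 < g)%N, (g %| N ^ D`!)%N &
    forall p, prime p -> vunit (V p) (x ^+ D`! / g%:R)].
Proof.
move=> r0 x0 rx sr N0 Vx VNx.
have [e He] : exists e : nat -> nat, forall p, prime p ->
    vunit (V p) (x ^+ D`! / p%:R ^+ e p) /\ (e p <= D`! * logn p N)%N.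
  have : forall p, exists e : nat, prime p ->
      vunit (V p) (x ^+ D`! / p%:R ^+ e) /\ (e <= D`! * logn p N)%N.
    move=> p; have [pr|npr] := boolP (prime p); last by exists 0%N.
    have [e ue] := vunit_algebraic pr (hV pr) r0 x0 rx sr.
    have := vunit_exponent_ge0 pr (hV pr) (Vx _ pr) ue.
    case: e ue => // e ue _; exists e => _; split => //.
    by have := vunit_exponent_le pr (hV pr) N0 (VNx _ pr); apply.
  by move=> /choice [e He]; exists e.
(* Primes not dividing N need no factor, because [e p] is at most D! times [logn p N]. *)
pose g := \prod_(p <- primes N) (p ^ e p)%N.
have pprime p : p \in primes N -> prime p by rewrite mem_primes => /andP[].
exists g; split.
- rewrite /g big_seq; apply: prodn_cond_gt0 => p /pprime pr.
  by rewrite expn_gt0 prime_gt0.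
- have DN : N = \prod_(p <- primes N) (p ^ logn p N)%N.
    by rewrite [LHS]prod_prime_decomp // prime_decompE big_map.
  rewrite [X in (_ %| X ^ _)%N]DN (big_morph (fun n => (n ^ D`!)%N) (fun a b => expnMn a b _)
    (exp1n _)).
  rewrite /g !big_seq; apply: (big_ind2 (fun a b => a %| b)%N) => // [a b c d|p /pprime pr].
    exact: dvdn_mul.
  by rewrite -expnM dvdn_exp2l // mulnC; apply: (He p pr).2.
move=> q qpr.
have [h Dh uh] : exists2 h : nat, g = (q ^ e q * h)%N & vunit (V q) (h%:R : L).
  exists (\prod_(p <- primes N | p != q) (p ^ e p)%N).
    have [qN|qN] := boolP (q \in primes N).
      by rewrite /g (bigD1_seq q) ?primes_uniq.
    have -> : e q = 0%N.
      have := (He q qpr).2; rewrite (_ : logn q N = 0)%N ?muln0 ?leqn0; first by move/eqP.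
      by apply/eqP; rewrite -leqn0 leqNgt logn_gt0.
    rewrite mul1n /g [LHS]big_seq_cond [RHS]big_seq_cond; apply: eq_bigl => p.
    rewrite andbT; case pN : (p \in primes N) => //=.
    by apply/esym; apply: contraNneq qN => <-.
  rewrite big_seq_cond; apply: (big_ind (fun h : nat => vunit (V q) (h%:R : L))).
  - exact: (vunit1 (hV qpr)).
  - by move=> a b ua ub; rewrite natrM; apply: (vunitM (hV qpr)).
  move=> p /andP[/pprime pr pq]; rewrite natrX; apply: (vunitX (hV qpr)).
  apply: (vunit_coprime qpr (hV qpr) (n := p)).
  by rewrite dvdzE !absz_nat dvdn_prime2 // eq_sym.
rewrite Dh natrM natrX invfM mulrA; apply: (vunitM (hV qpr)); first exact: (He q qpr).1.
exact: (vunitV uh).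
Qed.

End GlobalValuations.

(** * Galois conjugates and blocks of roots *)

Section GaloisBasics.

Variable L : splittingFieldType rat.
Local Notation G := (gal_of {:L}).
Implicit Types (s t : G) (x : L).

Lemma galMf s t x : (s * t)%g x = t (s x).
Proof. by rewrite galM ?memvf. Qed.

Lemma gal1f x : (1%g : G) x = x.
Proof. exact: gal_id. Qed.

Lemma galKVf s x : s ((s^-1)%g x) = x.
Proof. by rewrite -galMf mulVg gal1f. Qed.

Lemma galVKf s x : (s^-1)%g (s x) = x.
Proof. by rewrite -galMf mulgV gal1f. Qed.

Lemma gal_inj s : injective s.
Proof. exact: can_inj (galVKf s). Qed.

Lemma gal_fixed_rat x : (forall s, s x = x) -> exists q, x = ratr q.
Proof.
move=> fx; have /galois_fixedField e := galois_char0 L.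
have : x \in fixedField ('Gal({:L} / 1))%g by apply/fixedFieldP; rewrite ?memvf.
by rewrite e => /vlineP [q ->]; exists q; rewrite alg_num_field.
Qed.

Lemma gal_fixed_poly (P : {poly L}) : (forall s, map_poly s P = P) ->
  exists Q : {poly rat}, P = map_poly (in_alg L) Q.
Proof.
move=> fP.
have /choice [q Dq] : forall i, exists q, P`_i = ratr q.
  by move=> i; apply: gal_fixed_rat => s; rewrite -{2}(fP s) coef_map.
exists (\poly_(i < size P) q i); apply/polyP => i.
rewrite coef_map coef_poly /=; case: ltnP => [_|le]; last by rewrite scale0r nth_default.
by rewrite Dq alg_num_field.
Qed.

(** Translation by s^-1. The product of automorphisms satisfies [(s * t) x = t (s x)], so this is
    how patterns change when s is applied to a root. *)
Definition shift (s : G) (A : {set G}) : {set G} := [set t | (s * t)%g \in A].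

Lemma shiftK s : cancel (shift s) (shift (s^-1)%g).
Proof. by move=> A; apply/setP => t; rewrite !inE mulgA mulgV mul1g. Qed.

Lemma shift_inj s : injective (shift s).
Proof. exact: can_inj (shiftK s). Qed.

Lemma shift_closed_mem (O : {set {set G}}) s A :
  (forall s A, A \in O -> shift s A \in O) -> (shift s A \in O) = (A \in O).
Proof.
move=> cO; apply/idP/idP => [|AO]; last exact: cO.
by move/(cO s^-1%g); rewrite shiftK.
Qed.

Section Equivariant.

Variables (O : {set {set G}}) (h : {set G} -> L).
Hypotheses (cO : forall s A, A \in O -> shift s A \in O)
           (eh : forall s A, A \in O -> s (h A) = h (shift s A)).

Lemma equivariant_prod_poly s :
  map_poly s (\prod_(A in O) ('X - (h A)%:P)) = \prod_(A in O) ('X - (h A)%:P).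
Proof.
rewrite rmorph_prod /= [RHS](reindex_inj (@shift_inj s)) /=.
apply: eq_big => A; first by rewrite shift_closed_mem.
by move=> AO; rewrite rmorphB /= map_polyX map_polyC /= eh.
Qed.

Lemma equivariant_prod s : s (\prod_(A in O) h A) = \prod_(A in O) h A.
Proof.
rewrite rmorph_prod /= [RHS](reindex_inj (@shift_inj s)) /=.
by apply: eq_big => A; [rewrite shift_closed_mem | exact: eh].
Qed.

End Equivariant.

End GaloisBasics.

(** * Absolute values and the coefficient bound through roots *)

Record absolute_value (L : fieldType) (R : realType) (nrm : L -> R) : Prop := AbsoluteValue {
  nrmM : {morph nrm : x y / x * y};
  nrmD : forall x y, nrm (x + y) <= nrm x + nrm y;
  nrm_eq0 : forall x, (nrm x == 0) = (x == 0);
  nrm_int : forall n : int, nrm n%:~R = `|n|%:~R }.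

Section AbsVal.

Variables (L : fieldType) (R : realType) (nrm : L -> R).
Hypothesis hN : absolute_value nrm.

Lemma nrm1 : nrm 1 = 1.
Proof. by rewrite -[1]/((1 : int)%:~R) (nrm_int hN). Qed.

Lemma nrm0 : nrm 0 = 0.
Proof. by apply/eqP; rewrite (nrm_eq0 hN). Qed.

Lemma nrmN x : nrm (- x) = nrm x.
Proof. by rewrite -mulN1r (nrmM hN) -[-1]/((-1 : int)%:~R) (nrm_int hN) mul1r. Qed.

Lemma nrm_ge0 x : 0 <= nrm x.
Proof.
have := nrmD hN x (- x); rewrite subrr nrm0 nrmN -mulr2n pmulrn_lge0 //.
Qed.

Lemma nrm_gt0 x : (0 < nrm x) = (x != 0).
Proof. by rewrite lt_def nrm_ge0 andbT (nrm_eq0 hN). Qed.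

Lemma nrmX x n : nrm (x ^+ n) = nrm x ^+ n.
Proof. by elim: n => [|n IH]; rewrite ?expr0 ?nrm1 // !exprS (nrmM hN) IH. Qed.

Lemma nrmV x : nrm x^-1 = (nrm x)^-1.
Proof.
have [->|x0] := eqVneq x 0; first by rewrite invr0 nrm0 invr0.
have n0 : nrm x != 0 by rewrite (nrm_eq0 hN).
by apply: (mulfI n0); rewrite -(nrmM hN) !mulfV // nrm1.
Qed.

Lemma nrm_prod (I : Type) (r : seq I) (P : pred I) (F : I -> L) :
  nrm (\prod_(i <- r | P i) F i) = \prod_(i <- r | P i) nrm (F i).
Proof. exact: (big_morph nrm (nrmM hN) nrm1). Qed.

Definition max1 (x : L) : R := Num.max 1 (nrm x).

Lemma max1_ge1 x : 1 <= max1 x.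
Proof. by rewrite /max1 le_max lexx. Qed.

Lemma max1_gt0 x : 0 < max1 x.
Proof. exact: lt_le_trans ltr01 (max1_ge1 x). Qed.

Lemma prod_max1_ge1 (I : Type) (r : seq I) (P : pred I) (F : I -> L) :
  1 <= \prod_(i <- r | P i) max1 (F i).
Proof.
apply: (big_ind (fun y : R => 1 <= y)) => // [x y|i _]; last exact: max1_ge1.
by move=> h1 h2; rewrite -[1]mul1r ler_pM.
Qed.

(** Multiplication by X - b enlarges the bound by 1 + |b|, which is at most 2 max(1, |b|). *)
Lemma nrm_coef_prod_XsubC (s : seq L) j :
  nrm (\prod_(b <- s) ('X - b%:P))`_j <= \prod_(b <- s) (2 * max1 b).
Proof.
elim: s j => [|b s IH] j.
  by rewrite !big_nil coefC; case: ifP => _; rewrite ?nrm1 ?nrm0.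
rewrite !big_cons mulrBl mul_polyC coefB coefXM coefZ.
set P := \prod_(b <- s) _ in IH *; set B := \prod_(b <- s) _ in IH *.
apply: le_trans (nrmD hN _ _) _; rewrite nrmN (nrmM hN).
have B0 : 0 <= B by apply: le_trans (IH 0%N); apply: nrm_ge0.
have m1 := max1_ge1 b.
have mb : nrm b <= max1 b by rewrite /max1 le_max lexx orbT.
have -> : 2 * max1 b * B = max1 b * B + max1 b * B by ring.
apply: lerD.
  have : nrm (if j == 0%N then 0 else P`_j.-1) <= B.
    by case: ifP => _; [rewrite nrm0 | exact: IH].
  by move/le_trans; apply; rewrite -{1}[B]mul1r ler_wpM2r.
by apply: ler_pM => //; apply: nrm_ge0.
Qed.

End AbsVal.

Section Conjugates.

Variables (L : splittingFieldType rat).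
Local Notation G := (gal_of {:L}).

Definition conj_seq (z : L) : seq L := undup [seq s z | s : G].

Lemma conj_seq_uniq z : uniq (conj_seq z).
Proof. exact: undup_uniq. Qed.

Lemma conj_seqP z b : reflect (exists s : G, b = s z) (b \in conj_seq z).
Proof.
rewrite mem_undup; apply: (iffP mapP) => [[s _ ->]|[s ->]]; first by exists s.
by exists s; rewrite ?mem_enum.
Qed.

Lemma conj_seq_id z : z \in conj_seq z.
Proof. by apply/conj_seqP; exists 1%g; rewrite gal1f. Qed.

Lemma conj_seq_perm z (s : G) : perm_eq (map s (conj_seq z)) (conj_seq z).
Proof.
apply: uniq_perm; rewrite ?(map_inj_uniq (@gal_inj _ s)) ?conj_seq_uniq // => b.
apply/mapP/conj_seqP => [[x /conj_seqP [t ->] ->]|[t ->]].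
  by exists (t * s)%g; rewrite galMf.
exists ((s^-1)%g (t z)); last by rewrite galKVf.
by apply/conj_seqP; exists (t * s^-1)%g; rewrite galMf.
Qed.

Lemma root_gal (f : {poly int}) z (s : G) :
  root (map_poly intr f) z -> root (map_poly intr f) (s z).
Proof.
rewrite !rootE => /eqP h.
have -> : map_poly intr f = map_poly s (map_poly intr f) :> {poly L}.
  by apply/polyP => i; rewrite !coef_map /= rmorph_int.
by rewrite horner_map h raddf0.
Qed.

(** The product over the orbit of z is Galois invariant, hence rational, and divides f. By Gauss's
    lemma f is irreducible over the rationals too, so the two are associate. *)
Lemma irreducible_conj (f : {poly int}) z : irreducible_poly f ->
  root (map_poly intr f) z ->
  map_poly intr f = (lead_coef f)%:~R *: \prod_(b <- conj_seq z) ('X - b%:P).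
Proof.
move=> irrf rz; set P := \prod_(b <- _) _.
have [Q DQ] : exists Q : {poly rat}, P = map_poly (in_alg L) Q.
  apply: gal_fixed_poly => s; rewrite rmorph_prod /= /P.
  rewrite -[RHS](perm_big _ (conj_seq_perm z s)) big_map /=.
  by apply: eq_bigr => b _; rewrite rmorphB /= map_polyX map_polyC.
have fE : map_poly intr f = map_poly (in_alg L) (map_poly intr f).
  by apply/polyP => i; rewrite !coef_map /= alg_num_field ratr_int.
have Pf : P %| map_poly intr f.
  apply: uniq_roots_dvdp; last by rewrite uniq_rootsE conj_seq_uniq.
  by apply/allP => b /conj_seqP [s ->]; apply: root_gal.
rewrite fE DQ dvdp_map in Pf.
have [_ irr] := (irreducible_rat_int f).2 irrf.
have sP : size P = (size (conj_seq z)).+1 by rewrite /P size_prod_XsubC.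
have sQ : size Q != 1%N.
  rewrite -(size_map_poly (in_alg L)) -DQ sP eqSS.
  by case: conj_seq (conj_seq_id z).
have /eqpP [[a b] /= /andP[a0 b0] e] := irr _ sQ Pf.
have mP : lead_coef P = 1 by apply/eqP; apply: monic_prod => i _; apply: monicXsubC.
have e2 : map_poly intr f = (a / b)%:A *: P :> {poly L}.
  rewrite fE DQ -[_%:A]/(in_alg L (a / b)) -map_polyZ; congr map_poly.
  by rewrite mulrC -scalerA e scalerA mulVf // scale1r.
have lf : lead_coef (map_poly intr f : {poly L}) = (lead_coef f)%:~R.
  rewrite lead_coef_map_eq //; rewrite (pchar0_intf_neq0 L) lead_coef_eq0.
  by case: irrf => s1 _; rewrite -size_poly_gt0; apply: ltn_trans s1.
by rewrite {1}e2; congr (_ *: _); rewrite -lf e2 lead_coefZ mP mulr1.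
Qed.

End Conjugates.

(** * Blocks of roots with equal pattern *)

Section Blocks.

Variables (L : splittingFieldType rat) (R : realType) (nrm : L -> R).
Variables (V : nat -> L -> Prop).
Hypothesis hN : absolute_value nrm.
Hypothesis hV : forall p, prime p -> valuation_ring p (V p).
Local Notation G := (gal_of {:L}).

(* Roots with equal patterns lie on the same side of the unit circle under every
   embedding. *)
Definition pattern (z : L) : {set G} := [set s : G | 1 <= nrm (s z)].

Lemma pattern_gal (s : G) z : pattern (s z) = shift s (pattern z).
Proof. by apply/setP => t; rewrite !inE galMf. Qed.

Definition block (rs : seq L) (A : {set G}) : {poly L} :=
  \prod_(b <- rs | pattern b == A) ('X - b%:P).

Definition patterns (rs : seq L) : {set {set G}} := [set A | A \in map pattern rs].

Lemma mem_patterns rs b : b \in rs -> pattern b \in patterns rs.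
Proof. by move=> brs; rewrite inE; apply: map_f. Qed.

Section OneFactor.

Variables (f : {poly int}) (l : int) (rs : seq L).
Hypotheses (rsP : forall s : G, perm_eq (map s rs) rs)
           (fE : map_poly intr f = l%:~R *: \prod_(b <- rs) ('X - b%:P)).

Lemma patterns_closed (s : G) A : A \in patterns rs -> shift s A \in patterns rs.
Proof.
rewrite !inE => /mapP [b brs ->]; apply/mapP; exists (s b); last by rewrite pattern_gal.
by rewrite -(perm_mem (rsP s)) map_f.
Qed.

Lemma card_patterns : (#|patterns rs| <= size rs)%N.
Proof.
rewrite -(size_map pattern) /patterns; apply: leq_trans (size_undup _).
rewrite -(card_uniqP (undup_uniq _)); apply: subset_leq_card.
by apply/fintype.subsetP => A; rewrite inE mem_undup.
Qed.

Lemma block_gal (s : G) A : map_poly s (block rs A) = block rs (shift s A).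
Proof.
rewrite rmorph_prod /= /block -[RHS](perm_big _ (rsP s)) /= big_map.
apply: eq_big => b; first by rewrite pattern_gal (inj_eq (@shift_inj _ s)).
by move=> _; rewrite rmorphB /= map_polyX map_polyC.
Qed.

Lemma prod_block (T : comNzRingType) (F : L -> T) (P : pred L) :
  \prod_(A in patterns rs) \prod_(b <- rs | P b && (pattern b == A)) F b =
  \prod_(b <- rs | P b) F b.
Proof.
rewrite [RHS]big_seq_cond.
rewrite [RHS](partition_big pattern (fun A => A \in patterns rs)) /=; last first.
  by move=> b /andP[brs _]; apply: mem_patterns.
apply: eq_bigr => A _; rewrite [LHS]big_seq_cond; apply: eq_bigl => b.
by rewrite andbA.
Qed.

Lemma prod_blocks : \prod_(A in patterns rs) block rs A = \prod_(b <- rs) ('X - b%:P).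
Proof. by rewrite -(prod_block _ xpredT). Qed.

(** The factor [l] makes the coefficient of a single block integral at all primes. *)
Definition block_coef A j := l%:~R * (block rs A)`_j.

Lemma block_coef_gal (s : G) A j : s (block_coef A j) = block_coef (shift s A) j.
Proof. by rewrite /block_coef rmorphM rmorph_int -block_gal coef_map. Qed.

Lemma over_f p : prime p -> over_pred (V p) (l%:~R *: \prod_(b <- rs) ('X - b%:P)).
Proof. by move=> pr i; rewrite -fE coef_map; apply: (sr_int (hV pr)). Qed.

Lemma block_coef_integral p A j : prime p -> V p (block_coef A j).
Proof.
move=> pr; have hp := hV pr.
rewrite /block_coef /block -big_filter.
have [c Vc ->] := coef_prod_XsubC_factor hp [seq b <- rs | pattern b == A] j.
rewrite mulrA; apply: (srM hp) => //; rewrite big_filter_cond.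
exact: (over_lead_prod pr hp _ (over_f pr)).
Qed.

(** There is one factor [l] for all blocks together, and not one for each, so that the bound on this
    number stays linear in the Mahler measure. *)
Definition blocks_coef j := l%:~R * \prod_(A in patterns rs) (block rs A)`_j.

(* The valuation of the j-th coefficient of a block is at least that of the
   product of the nonintegral roots in it, and the leading coefficient of f
   clears the product of all nonintegral roots. *)
Lemma blocks_coef_int j : exists n : int, blocks_coef j = n%:~R.
Proof.
have [q Dq] : exists q, blocks_coef j = ratr q.
  apply: gal_fixed_rat => s; rewrite /blocks_coef rmorphM rmorph_int; congr (_ * _).
  apply: (equivariant_prod (h := fun A => (block rs A)`_j)) => [t A|t A _].
    exact: patterns_closed.
  by rewrite -block_gal coef_map.
suff /intrP [n qn] : q \is a Num.int by exists n; rewrite Dq qn [LHS]ratr_int.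
apply: (vr_ratr_int hV) => p pr; rewrite -Dq; have hp := hV pr.
have /choice [c Hc] : forall A, exists c, V p c /\ (block rs A)`_j =
    (\prod_(b <- rs | ~~ `[< V p b >] && (pattern b == A)) b) * c.
  move=> A; rewrite /block -big_filter.
  have [c Vc ->] := coef_prod_XsubC_factor hp [seq b <- rs | pattern b == A] j.
  exists c; split => //; congr (_ * _); rewrite big_filter_cond.
  by apply: eq_bigl => b; rewrite andbC.
rewrite /blocks_coef (eq_bigr (fun A => (\prod_(b <- rs | ~~ `[< V p b >] && (pattern b ==
  A)) b) * c A)).
  rewrite big_split /= (prod_block id) mulrA; apply: (srM hp).
    exact: (over_lead_prod pr hp _ (over_f pr)).
  by apply: (sr_prod hp) => A _; have [] := Hc A.
by move=> A _; have [] := Hc A.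
Qed.

(** The Mahler measure, computed with the roots in L. *)
Definition lead_max1 : R := `|l|%:~R * \prod_(b <- rs) max1 nrm b.

Lemma nrm_blocks_coef j : nrm (blocks_coef j) <= 2 ^+ size rs * lead_max1.
Proof.
rewrite (nrmM hN) (nrm_int hN) (nrm_prod hN) /lead_max1 mulrCA.
apply: ler_wpM2l; first by rewrite ler0z normr_ge0.
have -> : 2 ^+ size rs * \prod_(b <- rs) max1 nrm b = \prod_(b <- rs) (2 * max1 nrm b).
  by rewrite big_split /= big_const_seq count_predT iter_mulr_1.
rewrite -(prod_block _ xpredT); apply: ler_prod => A _; rewrite nrm_ge0 //=.
by rewrite /block -big_filter -[leRHS]big_filter; apply: nrm_coef_prod_XsubC.
Qed.

Lemma nrm_block_coef A j : nrm (block_coef A j) <= 2 ^+ size rs * lead_max1.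
Proof.
rewrite (nrmM hN) (nrm_int hN) /lead_max1 mulrCA.
apply: ler_wpM2l; first by rewrite ler0z normr_ge0.
have -> : 2 ^+ size rs * \prod_(b <- rs) max1 nrm b = \prod_(b <- rs) (2 * max1 nrm b).
  by rewrite big_split /= big_const_seq count_predT iter_mulr_1.
rewrite /block -big_filter; apply: le_trans (nrm_coef_prod_XsubC hN _ _) _.
rewrite big_filter [leRHS](bigID (fun b => pattern b == A)) /=.
have h b : 1 <= 2 * max1 nrm b by have := max1_ge1 nrm b; lra.
rewrite -[leLHS]mulr1; apply: ler_pM => //.
  by apply: prodr_ge0 => b _; apply: le_trans (h b).
apply: (big_ind (fun y : R => 1 <= y)) => // x y h1 h2.
by rewrite -[1]mul1r ler_pM.
Qed.

Lemma prod_block_coef j :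
  \prod_(A in patterns rs) block_coef A j * l%:~R = l%:~R ^+ #|patterns rs| * blocks_coef j.
Proof. by rewrite big_split /= prodr_const -mulrA; congr (_ * _); rewrite mulrC. Qed.

(** By [prod_block_coef] the coefficient times its integral companions from the other blocks and [l]
    equals l^m n, where m <= D is the number of blocks. It thus divides |l|^D |n|, and
    [divisor_code] applies with the polynomial whose roots are the companions. *)
Lemma block_coef_code (D j : nat) (n : int) A : l != 0 -> n != 0 -> blocks_coef j = n%:~R ->
  (size rs <= D)%N -> A \in patterns rs ->
  exists g : nat, [/\ (0 < g)%N, (g %| (`|l| ^ D * `|n|) ^ D`!)%N &
    forall p, prime p -> vunit (V p) (block_coef A j ^+ D`! / g%:R)].
Proof.
move=> l0 n0 Dn sD AO; have [Q DQ] : exists Q : {poly rat},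
    \prod_(B in patterns rs) ('X - (block_coef B j)%:P) = map_poly (in_alg L) Q.
  apply: gal_fixed_poly => s; apply: (equivariant_prod_poly (h := fun B => block_coef B j)).
    exact: patterns_closed.
  by move=> t B _; rewrite block_coef_gal.
have sP : size (\prod_(B in patterns rs) ('X - (block_coef B j)%:P)) = #|patterns rs|.+1.
  by rewrite -big_enum size_prod_XsubC -cardE.
have O1 : (0 < #|patterns rs|)%N by apply/card_gt0P; exists A.
have prodE := prod_block_coef j; rewrite Dn in prodE.
have nzL (m : int) : m != 0 -> m%:~R != 0 :> L by rewrite pchar0_intf_neq0.
have gneq0 : block_coef A j != 0.
  apply: contraTneq (mulf_neq0 (expf_neq0 #|patterns rs| (nzL _ l0)) (nzL _ n0)) => g0.
  by rewrite -prodE (bigD1 A) //= g0 !mul0r eqxx.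
have rQ : root (map_poly (in_alg L) Q) (block_coef A j).
  rewrite -DQ (bigD1 A) //= rootM; apply/orP; left.
  by rewrite root_XsubC.
have Q0 : Q != 0.
  by rewrite -(map_poly_eq0 (in_alg L)) -DQ -size_poly_eq0 sP.
have cD : (#|patterns rs| <= D)%N by apply: leq_trans card_patterns sD.
have sQ : (size Q <= D.+1)%N.
  by rewrite -(size_map_poly (in_alg L)) -DQ sP ltnS.
apply: (divisor_code hV Q0 gneq0 rQ sQ).
- by rewrite muln_gt0 expn_gt0 !absz_gt0 l0 n0.
- by move=> p; apply: block_coef_integral.
move=> p pr; have hp := hV pr.
have habs (m : int) : exists2 e : L, V p e & (`|m|%N)%:R = e * m%:~R.
  case: (ltrP m 0) => m0.
    exists (-1); first exact/(srN hp)/(sr1 hp).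
    by rewrite mulN1r -rmorphN -ltz0_abs.
  by exists 1; [exact: (sr1 hp) | rewrite mul1r -{2}(gez0_abs m0)].
have [e1 V1 D1] := habs l; have [e2 V2 D2] := habs n.
rewrite natrM natrX D1 D2 exprMn.
have -> : e1 ^+ D * l%:~R ^+ D * (e2 * n%:~R) / block_coef A j =
    e1 ^+ D * e2 * l%:~R ^+ (D - #|patterns rs|) * (l%:~R ^+ #|patterns rs| * n%:~R) /
      block_coef A j.
  have -> : l%:~R ^+ D = l%:~R ^+ (D - #|patterns rs|) * l%:~R ^+ #|patterns rs| :> L.
    by rewrite -exprD subnK.
  by congr (_ / _); rewrite mulrACA !mulrA.
rewrite -prodE (bigD1 A) //=.
have -> : e1 ^+ D * e2 * l%:~R ^+ (D - #|patterns rs|) *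
     (block_coef A j * \prod_(B in patterns rs | B != A) block_coef B j * l%:~R) / block_coef A j
  = e1 ^+ D * e2 * l%:~R ^+ (D - #|patterns rs|) *
     (\prod_(B in patterns rs | B != A) block_coef B j) * l%:~R.
  by rewrite mulrC mulrCA -(mulrA (block_coef A j)) mulKf // mulrA.
apply: (srM hp); last exact: (sr_int hp).
apply: (srM hp); last by apply: (sr_prod hp) => B _; apply: block_coef_integral.
apply: (srM hp); last exact/(srX hp)/(sr_int hp).
by apply: (srM hp) => //; apply: (srX hp).
Qed.

End OneFactor.

End Blocks.

(** * Counting *)

Section Counting.

Lemma size_le_code (T : eqType) (S : seq T) (F : finType) (c : T -> F) :
  uniq S -> {in S &, injective c} -> (size S <= #|F|)%N.
Proof.
move=> uS ic; rewrite -(size_map c).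
have /card_uniqP <- : uniq (map c S) by rewrite map_inj_in_uniq.
exact: max_card.
Qed.

Lemma size_le_values (T : eqType) (X : eqType) (S : seq T) (n C : nat)
    (v : T -> 'I_n -> X) : uniq S ->
  (forall j, (size (undup (map (v^~ j) S)) <= C)%N) ->
  {in S &, forall f g, (forall j, v f j = v g j) -> f = g} ->
  (size S <= C ^ n)%N.
Proof.
move=> uS hC inj.
case: S => [//|f0 S'] in uS hC inj *; set S := f0 :: S' in uS hC inj *.
have ltC f j : f \in S -> (index (v f j) (undup (map (v^~ j) S)) < C)%N.
  move=> fS; apply: leq_trans (hC j); rewrite index_mem mem_undup.
  exact: (map_f (v^~ j)).
case: n => [|n] in v hC inj ltC *.
  rewrite expn0; case: S' @S uS inj {hC ltC} => [//|f1 S'] S uS inj; exfalso.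
  move: uS; rewrite /S /= inE negb_or => /andP[/andP[/eqP ne _] _]; apply: ne.
  by apply: inj; rewrite ?inE ?eqxx ?orbT // => -[].
case: C => [|C] in hC ltC *; first by have := ltC f0 ord0 (mem_head _ _); rewrite ltn0.
have -> : (C.+1 ^ n.+1)%N = #|{ffun 'I_n.+1 -> 'I_C.+1}| by rewrite card_ffun !card_ord.
apply: (size_le_code (c := fun f => [ffun j => inord (index (v f j) (undup (map (v^~ j) S)))]))
  => //.
move=> f g fS gS /ffunP e; apply: inj => // j.
have := congr1 (@nat_of_ord _) (e j); rewrite !ffunE !inordK ?ltC // => ei.
have mem x : x \in S -> v x j \in undup (map (v^~ j) S).
  by move=> xS; rewrite mem_undup; apply: (map_f (v^~ j)).
by rewrite -(nth_index (v f0 j) (mem f fS)) ei nth_index ?mem.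
Qed.

Lemma size_le_fibers (T Y : eqType) (S : seq T) (C : nat) (D : T -> Y) :
  (forall x, x \in S -> (size [seq y <- S | D y == D x] <= C)%N) ->
  (size S <= C * size (undup (map D S)))%N.
Proof.
move=> hC.
have -> : size S = \sum_(y <- undup (map D S)) count (fun x => D x == y) S.
  rewrite -count_predT.
  have: {subset map D S <= undup (map D S)} by move=> y; rewrite mem_undup.
  have := undup_uniq (map D S); move: (undup _) => U uU.
  elim: S {hC} => [|x S IH] sub /=; first by rewrite big1.
  rewrite big_split /= -IH; last by move=> y yS; apply: sub; rewrite /= inE yS orbT.
  congr (_ + _)%N; rewrite (bigD1_seq (D x)) ?sub ?mem_head //= eqxx big1 ?addn0 //.
  by move=> y; rewrite eq_sym => /negbTE ->.
rewrite big_seq; apply: leq_trans (_ : \sum_(y <- undup (map D S) | y \in undup (map D S)) C <=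
  _)%N.
  apply: leq_sum => y; rewrite mem_undup => /mapP [x xS ->].
  by rewrite -size_filter; apply: hC.
by rewrite -big_seq big_const_seq count_predT iter_addn_0 mulnC.
Qed.

Lemma size_le_fiber_code (T Y : eqType) (S : seq T) (C : nat) (F : finType) (D : T ->
  Y) (c : T -> F) :
  uniq S ->
  (forall x, x \in S -> (size [seq y <- S | (D y == D x) && (c y == c x)] <= C)%N) ->
  (size S <= C * #|F| * size (undup (map D S)))%N.
Proof.
move=> uS hC; apply: size_le_fibers => x xS.
set S' := [seq y <- S | D y == D x].
apply: leq_trans (_ : C * size (undup (map c S')) <= _)%N.
  apply: size_le_fibers => y; rewrite mem_filter => /andP[/eqP Dy yS].
  apply: leq_trans (hC y yS); rewrite /S' -filter_predI Dy.
  by rewrite leq_eqVlt; apply/orP; left; apply/eqP; congr size; apply: eq_filter => w /=;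
    rewrite andbC.
rewrite leq_mul2l; apply/orP; right.
have /card_uniqP <- := undup_uniq (map c S').
exact: max_card.
Qed.

Definition code_int (B : nat) (n : int) : 'I_(2 * B).+1 := inord (absz (n + B%:Z)).

Lemma code_int_inj B m n : (`|m| <= B%:Z)%R -> (`|n| <= B%:Z)%R ->
  code_int B m = code_int B n -> m = n.
Proof.
move=> hm hn /(congr1 (@nat_of_ord _)); rewrite !inordK; lia.
Qed.

Lemma size_bounded_polys (S : seq {poly int}) (n B : nat) : uniq S ->
  (forall f, f \in S -> (size f <= n)%N /\ forall i, (`|f`_i| <= B%:Z)%R) ->
  (size S <= (2 * B).+1 ^ n)%N.
Proof.
move=> uS hS.
have -> : ((2 * B).+1 ^ n)%N = #|{ffun 'I_n -> 'I_(2 * B).+1}| by rewrite card_ffun !card_ord.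
apply: (size_le_code (c := fun f : {poly int} => [ffun i : 'I_n => code_int B f`_i])) => //.
move=> f g fS gS /ffunP e; have [sf bf] := hS f fS; have [sg bg] := hS g gS.
apply/polyP => i; have [lt|ge] := ltnP i n; last first.
  by rewrite !nth_default //; [apply: leq_trans sg ge | apply: leq_trans sf ge].
by have := e (Ordinal lt); rewrite !ffunE; apply: code_int_inj.
Qed.

Definition bounded_integral (L : fieldType) (n B : nat) (x : L) :=
  exists q : {poly int}, [/\ q \is monic, (size q <= n.+1)%N,
    forall i, (`|q`_i| <= B%:Z)%R & root (map_poly intr q) x].

(** Northcott's argument: there are few such polynomials, and each has at most n roots. *)
Lemma size_bounded_integral (L : fieldType) (S : seq L) (n B : nat) : uniq S ->
  (forall x, x \in S -> bounded_integral n B x) ->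
  (size S <= n * (2 * B).+1 ^ n.+1)%N.
Proof.
move=> uS hS.
have [q Hq] : exists q : L -> {poly int}, forall x, x \in S ->
  [/\ q x \is monic, (size (q x) <= n.+1)%N,
    forall i, (`|(q x)`_i| <= B%:Z)%R & root (map_poly intr (q x)) x].
  have : forall x, exists q : {poly int}, x \in S -> [/\ q \is monic, (size q <= n.+1)%N,
      forall i, (`|q`_i| <= B%:Z)%R & root (map_poly intr q) x].
    move=> x; have [xS|xS] := boolP (x \in S); last by exists 0.
    by have [q Hq] := hS x xS; exists q.
  by move=> /choice [q Hq]; exists q.
apply: leq_trans (size_le_fibers (C := n) (D := q) _) _.
  move=> x xS; have [mq sq _ _] := Hq x xS.
  have q0 : map_poly intr (q x) != 0 :> {poly L}.
    by apply: monic_neq0; apply: monic_map.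
  rewrite -ltnS; apply: leq_trans (leq_trans (max_poly_roots (rs := [seq y <- S | q y ==
    q x]) q0 _ _) _) sq.
  - by apply/allP => y; rewrite mem_filter => /andP[/eqP <- yS]; have [] := Hq y yS.
  - exact: filter_uniq.
  - exact: size_poly.
rewrite leq_mul2l; apply/orP; right; apply: size_bounded_polys; first exact: undup_uniq.
by move=> f; rewrite mem_undup => /mapP [x xS ->]; have [] := Hq x xS.
Qed.

End Counting.

Lemma double_bound (R : realType) (m : R) : 1 <= m -> m <= 2 -> 0 <= 2 * m <= 4.
Proof. by move=> h1 h2; apply/andP; split; lra. Qed.

(** * Irreducible factors with equal keys *)

Section FactorFibers.

Variables (L : splittingFieldType rat) (R : realType) (nrm : L -> R).
Variables (V : nat -> L -> Prop) (D : nat).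
Hypothesis hN : absolute_value nrm.
Hypothesis hV : forall p, prime p -> valuation_ring p (V p).
Local Notation G := (gal_of {:L}).

(** Equal codes g make the quotients integral at every p. The polynomial having all quotients over
    [O] as roots is Galois invariant, so its coefficients are integers. Each quotient is at most 2,
    so each root contributes at most 2 * 2 to the coefficient bound, whence 4^D. *)
Lemma quotient_bounded_integral (O : {set {set G}}) (h h' : {set G} -> L) (g : {set G} -> nat) :
  (forall (s : G) A, A \in O -> shift s A \in O) -> (#|O| <= D)%N ->
  (forall (s : G) A, A \in O -> s (h A) = h (shift s A)) ->
  (forall (s : G) A, A \in O -> s (h' A) = h' (shift s A)) ->
  (forall A, A \in O -> h' A != 0) ->
  (forall A, A \in O -> [/\ (0 < g A)%N,
    forall p, prime p -> vunit (V p) (h A ^+ D`! / (g A)%:R) &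
    forall p, prime p -> vunit (V p) (h' A ^+ D`! / (g A)%:R)]) ->
  (forall A, A \in O -> nrm (h A / h' A) <= 2) ->
  forall A, A \in O -> bounded_integral D (4 ^ D) (h A / h' A).
Proof.
move=> cO sO eh eh' h'0 hg hb A AO.
pose q B := h B / h' B.
have qV B p : B \in O -> prime p -> V p (q B).
  move=> BO pr; have [g0 u u'] := hg B BO.
  apply: (vunit_root (hV pr) (fact_gt0 D) _ (h'0 B BO) (u p pr) (u' p pr)).
  by rewrite (pchar0_natf_neq0 L) -lt0n.
pose P := \prod_(B in O) ('X - (q B)%:P).
have [Q DQ] : exists Q : {poly rat}, P = map_poly (in_alg L) Q.
  apply: gal_fixed_poly => s; apply: (equivariant_prod_poly (h := q)) => // t B BO.
  by rewrite /q rmorphM fmorphV /= eh // eh'.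
have PV p : prime p -> over_pred (V p) P.
  move=> pr; apply: (over_prod (hV pr)) => B BO; apply: (overD (hV pr)).
    exact: (overX (hV pr)).
  exact/(overN (hV pr))/(overC (hV pr))/qV.
have QZ i : Q`_i \is a Num.int.
  apply: (vr_ratr_int hV) => p pr; have := PV p pr i.
  by rewrite DQ coef_map /= alg_num_field.
have /choice [k Dk] : forall i, exists n : int, Q`_i = n%:~R by move=> i; apply/intrP.
pose r : {poly int} := \poly_(i < size Q) k i.
have rQ : map_poly intr r = Q.
  apply/polyP => i; rewrite coef_map coef_poly; case: ltnP => [_|le]; first by rewrite Dk.
  by rewrite nth_default.
have rP : map_poly intr r = P :> {poly L}.
  rewrite DQ -rQ -map_poly_comp; apply: eq_map_poly => n /=.
  by rewrite alg_num_field ratr_int.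
have sP : size P = #|O|.+1 by rewrite /P -big_enum size_prod_XsubC -cardE.
have intr_inj0 : injective (intr : int -> L).
  move=> a b e; apply/eqP; rewrite -subr_eq0 -(pchar0_intf_neq0 L) rmorphB /= e.
  by rewrite subrr.
have sr : size r = #|O|.+1.
  by rewrite -sP -rP size_map_inj_poly.
exists r; split.
- have mP : P \is monic by apply: monic_prod => B _; apply: monicXsubC.
  have r0 : lead_coef r != 0 by rewrite lead_coef_eq0 -size_poly_eq0 sr.
  apply/monicP; apply: intr_inj0; rewrite rmorph1; apply: etrans (monicP mP).
  by rewrite -rP lead_coef_map_eq //= (pchar0_intf_neq0 L).
- by rewrite sr ltnS.
- move=> i; have e : (r`_i)%:~R = P`_i :> L by rewrite -rP coef_map.
  have eP : P = \prod_(b <- map q (enum O)) ('X - b%:P) by rewrite big_map big_enum.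
  rewrite -(ler_int R) -(nrm_int hN) e eP.
  apply: le_trans (nrm_coef_prod_XsubC hN _ _) _; rewrite big_map big_enum /=.
  apply: le_trans (_ : \prod_(B in O) (4 : R) <= _).
    apply: ler_prod => B BO; have h2 := max1_ge1 nrm (q B).
    have h1 : max1 nrm (q B) <= 2 by rewrite /max1 ge_max ler1n //= hb.
    exact: double_bound.
  rewrite prodr_const -[_%:~R]/((4 ^ D)%N%:R) natrX; apply: ler_weXn2l => //.
  by rewrite ler1n.
by rewrite rP /P (bigD1 A) //= rootM root_XsubC eqxx.
Qed.

Section Keys.

Variables (rt : {poly int} -> L) (N : nat).
Implicit Types f : {poly int}.

Definition is_factor f := [/\ irreducible_poly f,
  (size f <= D.+1)%N & root (map_poly intr f) (rt f)].

Definition roots_of f := conj_seq (rt f).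
Definition bcoef f A j := block_coef nrm (lead_coef f) (roots_of f) A j.
Definition bprod f j := blocks_coef nrm (lead_coef f) (roots_of f) j.
Definition pat f := pattern nrm (rt f).
Definition pats f := patterns nrm (roots_of f).
Definition ncoef f j : int := xget 0 [set n : int | bprod f j = n%:~R]%classic.
Definition gcode f A j : nat := xget 0%N [set g : nat | [/\ (0 < g)%N,
    (g %| (`|lead_coef f| ^ D * `|ncoef f j|) ^ D`!)%N &
    forall p, prime p -> vunit (V p) (bcoef f A j ^+ D`! / g%:R)]]%classic.
(** The dyadic size. [N] is chosen later such that the scaled value of a nonzero coefficient is at
    least 1 and survives the truncation. *)
Definition lcode f A j : nat := trunc_log 2 (Num.truncn (nrm (bcoef f A j) * N%:R)).

Lemma is_factor_lead f : is_factor f -> lead_coef f != 0.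
Proof.
move=> [[s1 _] _ _]; rewrite lead_coef_eq0 -size_poly_gt0; exact: ltn_trans s1.
Qed.

Lemma factorE f : is_factor f ->
  map_poly intr f = (lead_coef f)%:~R *: \prod_(b <- roots_of f) ('X - b%:P).
Proof. by move=> [irr _ rr]; apply: irreducible_conj. Qed.

Lemma size_roots_of f : is_factor f -> (size (roots_of f)).+1 = size f.
Proof.
move=> hf; have l0 := is_factor_lead hf.
have := congr1 (fun p : {poly L} => size p) (factorE hf).
rewrite size_scale ?(pchar0_intf_neq0 L) // size_prod_XsubC => <-.
by rewrite size_map_poly_id0 ?(pchar0_intf_neq0 L).
Qed.

Lemma ncoefP f j : is_factor f -> bprod f j = (ncoef f j)%:~R.
Proof.
move=> hf; rewrite /ncoef; case: xgetP => [n -> //|] no.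
have [n Dn] := blocks_coef_int nrm hV (conj_seq_perm (rt f)) (factorE hf) j.
by case: (no n).
Qed.

Lemma pats_pat f A : A \in pats f -> exists s : G, A = shift s (pat f).
Proof.
rewrite inE => /mapP [b /conj_seqP [s ->] ->]; exists s; exact: pattern_gal.
Qed.

Lemma pat_pats f : pat f \in pats f.
Proof. by apply: mem_patterns; apply: conj_seq_id. Qed.

Lemma pats_closed f s A : A \in pats f -> shift s A \in pats f.
Proof. by apply: patterns_closed; apply: conj_seq_perm. Qed.

Lemma bcoef_gal f (s : G) A j : s (bcoef f A j) = bcoef f (shift s A) j.
Proof. by apply: block_coef_gal; apply: conj_seq_perm. Qed.

Lemma eq_pats f g : pat f = pat g -> pats f = pats g.
Proof.
suff sub f1 f2 : pat f1 = pat f2 -> pats f1 \subset pats f2.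
  by move=> e; apply/eqP; rewrite finset.eqEsubset !sub.
move=> e; apply/fintype.subsetP => A /pats_pat [s ->]; rewrite e.
exact/pats_closed/pat_pats.
Qed.

Lemma card_pats f : is_factor f -> (#|pats f| <= D)%N.
Proof.
move=> hf; apply: leq_trans (card_patterns nrm (roots_of f)) _.
by rewrite -ltnS size_roots_of //; case: hf.
Qed.

Lemma gcodeP f A j : is_factor f -> ncoef f j != 0 -> A \in pats f ->
  [/\ (0 < gcode f A j)%N,
    (gcode f A j %| (`|lead_coef f| ^ D * `|ncoef f j|) ^ D`!)%N &
    forall p, prime p -> vunit (V p) (bcoef f A j ^+ D`! / (gcode f A j)%:R)].
Proof.
move=> hf n0 Af; rewrite /gcode; case: xgetP => [g _ //|] no.
have sD : (size (roots_of f) <= D)%N by rewrite -ltnS size_roots_of //; case: hf.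
have [g Hg] := block_coef_code hV (conj_seq_perm (rt f)) (factorE hf)
   (is_factor_lead hf) n0 (ncoefP j hf) sD Af.
by case: (no g).
Qed.

Lemma prod_bcoef f j : is_factor f ->
  \prod_(A in pats f) bcoef f A j * (lead_coef f)%:~R =
  (lead_coef f)%:~R ^+ #|pats f| * (ncoef f j)%:~R.
Proof. by move=> hf; rewrite -ncoefP //; apply: prod_block_coef. Qed.

(** The blocks of an irreducible polynomial are permuted transitively, so their j-th coefficients
    vanish together. *)
Lemma bcoef_eq0 f A j : is_factor f -> A \in pats f ->
  (bcoef f A j == 0) = (ncoef f j == 0).
Proof.
move=> hf Af; have l0 : (lead_coef f)%:~R != 0 :> L.
  by rewrite (pchar0_intf_neq0 L) is_factor_lead.
apply/eqP/eqP => [b0|n0].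
  apply/eqP; rewrite -(pchar0_intf_neq0 L).
  have := prod_bcoef j hf; rewrite (bigD1 A) //= b0 !mul0r => /esym/eqP.
  by rewrite mulf_eq0 (negPf (expf_neq0 _ l0)).
have /eqP := prod_bcoef j hf; rewrite n0 mulr0 mulf_eq0 (negPf l0) orbF.
case/prodf_eq0 => B Bf /eqP B0.
have [s ->] := pats_pat Af; have [t Bt] := pats_pat Bf.
have <- : shift (t^-1 * s)%g B = shift s (pat f).
  by rewrite Bt; apply/setP => u; rewrite !inE !mulgA mulgV mul1g.
by rewrite -bcoef_gal B0 raddf0.
Qed.

Definition same_key f g := [/\ pat f = pat g, lead_coef f = lead_coef g,
  forall j : 'I_D.+1, ncoef f j = ncoef g j,
  forall A (j : 'I_D.+1), A \in pats f -> gcode f A j = gcode g A j &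
  forall A (j : 'I_D.+1), A \in pats f -> lcode f A j = lcode g A j].

(** For each of the [D.+1] coefficient indices, the bound of [size_bounded_integral] with height
    4^D; the inner successor leaves room for the single value 0 of a vanishing coefficient. *)
Definition key_bound := ((D * (2 * 4 ^ D).+1 ^ D.+1).+1 ^ D.+1)%N.

Hypothesis N0 : (0 < N)%N.

(** Relative to a fixed [f0] in [S], the coefficients of the block containing the chosen root are
    multiplied by bounded algebraic integers, so each has boundedly many values. These coefficients
    determine the block, hence a root, hence the irreducible polynomial. *)
Lemma size_same_key (S : seq {poly int}) : uniq S ->
  (forall f, f \in S -> is_factor f) ->
  (forall f A j, f \in S -> A \in pats f -> ncoef f j != 0 -> 1 <= nrm (bcoef f A j) * N%:R) ->
  {in S &, forall f g, same_key f g} ->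
  (size S <= key_bound)%N.
Proof.
move=> uS Sf Sb Sk; case: S => [//|f0 S'] in uS Sf Sb Sk *; set S := f0 :: S' in uS Sf Sb Sk *.
have f0S : f0 \in S by apply: mem_head.
pose A := pat f0.
have ApatS f : f \in S -> A = pat f by move=> fS; have [] := Sk f0 f f0S fS.
have AS f : f \in S -> A \in pats f by move=> fS; rewrite (ApatS f fS) pat_pats.
apply: (size_le_values (v := fun f j => bcoef f A j)) => // [j|f g fS gS e].
  have [n0|n0] := eqVneq (ncoef f0 j) 0.
    apply: (@leq_trans (size [:: (0 : L)])); last by [].
    apply: uniq_leq_size; first exact: undup_uniq.
    move=> x; rewrite mem_undup => /mapP [f fS ->]; rewrite inE bcoef_eq0 ?AS //; last exact: Sf.
    by have [_ _ <- _ _] := Sk f0 f f0S fS; rewrite n0.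
  apply: leqW; have b0 : bcoef f0 A j != 0 by rewrite bcoef_eq0 ?AS //; exact: Sf.
  rewrite -(size_map (fun x => x / bcoef f0 A j)).
  apply: size_bounded_integral.
    by rewrite map_inj_uniq ?undup_uniq // => x y /(mulIf _) -> //; rewrite invr_eq0.
  move=> x /mapP [y]; rewrite mem_undup => /mapP [f fS ->] -> {x y}.
  have [pf lf nf gf cf] := Sk f f0 fS f0S.
  have epat := eq_pats pf.
  have nf0 : ncoef f j != 0 by rewrite nf.
  apply: (quotient_bounded_integral (O := pats f) (g := fun A => gcode f A j)
     (h := fun A => bcoef f A j) (h' := fun A => bcoef f0 A j)).
  - by move=> s B; apply: pats_closed.
  - exact/card_pats/Sf.
  - by move=> s B _; apply: bcoef_gal.
  - by move=> s B _; apply: bcoef_gal.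
  - by move=> B Bf; rewrite bcoef_eq0 ?n0 //; [apply: Sf | rewrite -epat].
  - move=> B Bf; have [g0 _ u] := gcodeP (Sf f fS) nf0 Bf.
    rewrite epat in Bf; have [_ _ u0] := gcodeP (Sf f0 f0S) n0 Bf.
    by split=> // p pr; rewrite gf ?epat //; apply: u0.
  - move=> B Bf.
    have l1 := Sb f B j fS Bf nf0; have lc := cf B j Bf.
    rewrite epat in Bf; have l2 := Sb f0 B j f0S Bf n0.
    have n00 : 0 < nrm (bcoef f0 B j) by rewrite (nrm_gt0 hN) bcoef_eq0 ?n0 //; exact: Sf.
    rewrite (nrmM hN) (nrmV hN) ler_pdivrMr //.
    have Npos : 0 < (N%:R : R) by rewrite ltr0n.
    rewrite -(ler_pM2r Npos) -mulrA.
    (* With t the common logarithm, x < truncn x + 1 <= 2^(t+1) <= 2 truncn y <= 2 y. *)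
    move: lc; rewrite /lcode; move: (nrm (bcoef f B j) * N%:R) l1 => x l1.
    move: (nrm (bcoef f0 B j) * N%:R) l2 => y l2 lc.
    have x0 : 0 <= x by apply: le_trans l1.
    have y0 : 0 <= y by apply: le_trans l2.
    have /andP[_ hx] := truncn_itv x0; have /andP[hy _] := truncn_itv y0.
    apply: ltW; apply: lt_le_trans hx _.
    have tx : (0 < Num.truncn x)%N by rewrite truncn_gt0.
    have ty : (0 < Num.truncn y)%N by rewrite truncn_gt0.
    have := trunc_log_ltn (Num.truncn x) (isT : 1 < 2)%N.
    have := trunc_logP (isT : 1 < 2)%N ty; rewrite lc expnS.
    move: (2 ^ _)%N => w h1 h2; apply: le_trans (_ : (2 * w)%N%:R <= _); first by rewrite ler_nat.
    rewrite natrM; apply: ler_wpM2l => //; apply: le_trans hy; by rewrite ler_nat.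
  - exact: AS.
have [pf lf nf _ _] := Sk f g fS gS.
have hf := Sf f fS; have hg := Sf g gS.
have l0 : (lead_coef f)%:~R != 0 :> L by rewrite (pchar0_intf_neq0 L) is_factor_lead.
have sblock h : is_factor h -> (size (block nrm (roots_of h) A) <= D.+1)%N.
  move=> hh; rewrite /block -big_filter size_prod_XsubC ltnS size_filter.
  apply: leq_trans (count_size _ _) _; rewrite -ltnS size_roots_of //; by case: hh.
have eb : block nrm (roots_of f) A = block nrm (roots_of g) A.
  apply/polyP => i; have [lt|ge] := ltnP i D.+1; last first.
    by rewrite !nth_default // ?(leq_trans _ ge) ?sblock.
  have := e (Ordinal lt); rewrite /bcoef /block_coef /= -lf => /(mulfI l0) //.
(* The common block contains [rt f]. Two irreducible polynomials with a common root and the same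
   leading coefficient coincide. *)
have zg : rt f \in roots_of g.
  rewrite -root_prod_XsubC -(prod_blocks nrm) rootE.
  rewrite (bigD1 A) ?AS //= hornerM -eb.
  have /rootP -> : root (block nrm (roots_of f) A) (rt f); last by rewrite mul0r.
  rewrite /block -big_filter root_prod_XsubC mem_filter (ApatS f fS) eqxx.
  exact: conj_seq_id.
have fg : map_poly intr f = map_poly intr g :> {poly L}.
  have rg : root (map_poly intr g) (rt f).
    by rewrite (factorE hg) rootE hornerZ (eqP (_ : root _ _)) ?mulr0 // root_prod_XsubC.
  have [irrg _ _] := hg; rewrite (irreducible_conj irrg rg) -lf.
  exact: factorE.
apply/polyP => i; have := congr1 (fun p : {poly L} => p`_i) fg.
rewrite !coef_map => /eqP; rewrite -subr_eq0 -rmorphB (pchar0_intf_neq0 L) subr_eq0.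
by move/eqP.
Qed.

End Keys.

End FactorFibers.

(** * The product of the roots outside the unit disk *)

Section OuterProduct.

Variables (L : splittingFieldType rat) (R : realType) (nrm : L -> R).
Variables (V : nat -> L -> Prop).
Hypothesis hN : absolute_value nrm.
Hypothesis hV : forall p, prime p -> valuation_ring p (V p).
Local Notation G := (gal_of {:L}).
Local Notation out z := (1 <= nrm z).

Definition splits (f : {poly int}) (rs : seq L) :=
  map_poly intr f = (lead_coef f)%:~R *: \prod_(z <- rs) ('X - z%:P).

(** Its absolute value is the Mahler measure. Unlike that real number it is an element of L, on
    which the Galois group acts. *)
Definition outer (f : {poly int}) (rs : seq L) : L :=
  (lead_coef f)%:~R * \prod_(z <- rs | out z) z.

Lemma lead_intr_neq0 (f : {poly int}) : f != 0 -> (lead_coef f)%:~R != 0 :> L.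
Proof. by rewrite (pchar0_intf_neq0 L) lead_coef_eq0. Qed.

Lemma splits_perm f rs (s : G) : f != 0 -> splits f rs -> perm_eq (map s rs) rs.
Proof.
move=> f0 hf; apply: prod_XsubC_eq; rewrite big_map.
have := congr1 (map_poly s) hf; rewrite map_polyZ rmorph_int rmorph_prod /=.
have -> : map_poly s (map_poly intr f) = map_poly intr f.
  by apply/polyP => i; rewrite !coef_map /= rmorph_int.
rewrite {1}hf => e; apply: (scalerI (lead_intr_neq0 f0)).
rewrite -[RHS]/(_ *: _) e; congr (_ *: _); apply: eq_bigr => b _.
by rewrite rmorphB /= map_polyX map_polyC.
Qed.

Lemma splits_factor f g rs rf : f * g != 0 -> splits (f * g) rs -> splits f rf ->
  exists2 rg, perm_eq rs (rf ++ rg) & splits g rg.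
Proof.
move=> fg0 hfg hf; move: (fg0); rewrite mulf_eq0 negb_or => /andP[f0 g0].
have e : (\prod_(z <- rf) ('X - z%:P)) * map_poly intr g =
   (lead_coef g)%:~R *: \prod_(z <- rs) ('X - z%:P) :> {poly L}.
  apply: (scalerI (lead_intr_neq0 f0)); rewrite scalerAl -hf scalerA -rmorphM -rmorphM /=.
  by rewrite -lead_coefM.
have [rg Dg] : exists rg, perm_eq rs (rf ++ rg).
  have : \prod_(z <- rf) ('X - z%:P) %| \prod_(z <- rs) ('X - z%:P).
    rewrite -(dvdpZr _ _ (lead_intr_neq0 g0)) -e; exact: dvdp_mulr.
  elim: rf rs {hfg hf e} => [|b rf IH] rs; first by exists rs.
  rewrite big_cons => h.
  have brs : b \in rs.
    by rewrite -root_prod_XsubC -dvdp_XsubCl; apply: dvdp_trans h; apply: dvdp_mulr.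
  move: h; rewrite (perm_big _ (perm_to_rem brs)) big_cons dvdp_mul2l ?polyXsubC_eq0 //.
  move/IH => [rg pg]; exists rg; apply: perm_trans (perm_to_rem brs) _.
  by rewrite /= perm_cons.
exists rg => //; rewrite /splits.
have P0 : \prod_(z <- rf) ('X - z%:P) != 0 :> {poly L}.
  by apply: monic_neq0; apply: monic_prod => z _; apply: monicXsubC.
apply: (mulfI P0); rewrite e (perm_big _ Dg) big_cat /= -scalerAr.
by [].
Qed.

Lemma outer_mul f g rs rf rg : perm_eq rs (rf ++ rg) ->
  outer (f * g) rs = outer f rf * outer g rg.
Proof.
move=> prs; rewrite /outer lead_coefM rmorphM (perm_big _ prs) big_cat /=.
by rewrite mulrACA.
Qed.

Section One.

Variables (f : {poly int}) (rs : seq L).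
Hypotheses (f0 : f != 0) (fS : splits f rs).
Local Notation l := ((lead_coef f)%:~R : L).
Local Notation al := (outer f rs).

Lemma outer_neq0 : al != 0.
Proof.
rewrite mulf_neq0 ?lead_intr_neq0 // prodf_seq_neq0; apply/allP => z _.
by apply/implyP => oz; rewrite -(nrm_gt0 hN); apply: lt_le_trans oz.
Qed.

Lemma nrm_outer : nrm al = `|lead_coef f|%:~R * \prod_(z <- rs) max1 nrm z.
Proof.
rewrite (nrmM hN) (nrm_int hN) (nrm_prod hN); congr (_ * _).
rewrite [RHS](bigID (fun z => out z)) /= [X in _ = _ * X]big1 ?mulr1.
  by apply: eq_bigr => z oz; rewrite /max1; apply/esym/max_idPr.
by move=> z; rewrite -ltNge => iz; rewrite /max1; apply/max_idPl/ltW.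
Qed.

(** Since s permutes the roots, |al| is |l| times the product of max(1, |s z|) over all roots. Since
    s fixes al, it is also |l| times the product of |s z| over the outer roots only. Equality forces
    |s z| >= 1 for every outer z, and counting gives the converse. *)
Lemma out_gal_stable (s : G) z : s al = al -> z \in rs -> out (s z) = out z.
Proof.
move=> sal zrs.
have ps := splits_perm s f0 fS.
have e : \prod_(z <- rs | out z) nrm (s z) = \prod_(z <- rs | out z) max1 nrm (s z) *
     \prod_(z <- rs | ~~ out z) max1 nrm (s z).
  transitivity (\prod_(z <- rs) max1 nrm (s z)); last by rewrite (bigID (fun z => out z)).
  rewrite -(big_map s xpredT (max1 nrm)) (perm_big _ ps) /=.
  have ln0 : (`|lead_coef f|%:~R : R) != 0 by rewrite intr_eq0 normr_eq0 lead_coef_eq0.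
  apply: (mulfI ln0); rewrite -nrm_outer -{1}sal /outer rmorphM rmorph_int rmorph_prod.
  by rewrite (nrmM hN) (nrm_int hN) (nrm_prod hN).
have imp w : w \in rs -> out w -> out (s w).
  move=> wrs ow; rewrite leNgt; apply/negP => isw.
  have : \prod_(z <- rs | out z) nrm (s z) < \prod_(z <- rs | out z) max1 nrm (s z).
    rewrite !(perm_big _ (perm_to_rem wrs)) /= !big_cons ow.
    have [z0|z0] := eqVneq (nrm (s w)) 0.
      rewrite z0 mul0r mulr_gt0 ?max1_gt0 //.
      by apply: lt_le_trans (prod_max1_ge1 _ _ _ _).
    apply: lt_le_trans (_ : max1 nrm (s w) * \prod_(j <- rem w rs | out j) nrm (s j) <= _).
      rewrite ltr_pM2r; first by rewrite /max1 lt_max isw.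
      apply: (big_ind (fun x : R => 0 < x)) => // [x y|j oj]; first exact: mulr_gt0.
      rewrite (nrm_gt0 hN) -(rmorph0 s) (inj_eq (@gal_inj _ s)) -(nrm_gt0 hN).
      exact: lt_le_trans oj.
    rewrite ler_pM2l ?max1_gt0 //; apply: ler_prod => j _.
    by rewrite (nrm_ge0 hN) /max1 le_max lexx orbT.
  rewrite e ltNge => /negP; apply.
  rewrite -{1}[X in X <= _]mulr1; apply: ler_wpM2l; last exact: prod_max1_ge1.
  by apply: le_trans (prod_max1_ge1 _ _ _ _).
apply/idP/idP => [osz|]; last exact: imp.
(* A permutation of the roots keeps the number of outer ones, so no inner root can become outer in
   addition. *)
have cnt : count (fun w => out (s w)) rs = count (fun w => out w) rs.
  by rewrite -(count_map s (fun w => out w)); apply/seq.permP.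
apply: contraTT isT => iz.
have : (count (fun w => out w) rs < count (fun w => out (s w)) rs)%N; last by rewrite cnt ltnn.
rewrite !(seq.permP (perm_to_rem zrs)) /= osz (negPf iz) add0n add1n ltnS.
have sub w : w \in rem z rs -> w \in rs by exact: mem_rem.
elim: (rem z rs) sub => //= w t IH sub; apply: leq_add; last first.
  by apply: IH => x xt; apply: sub; rewrite inE xt orbT.
by have := imp w (sub w (mem_head _ _)); case: (out w) => // ->.
Qed.

Lemma outer_gal_le (s : G) : nrm (s al) <= nrm al.
Proof.
have ps := splits_perm s f0 fS.
rewrite nrm_outer -(perm_big _ ps) /= big_map rmorphM rmorph_int (nrmM hN) (nrm_int hN).
apply: ler_wpM2l; first by rewrite ler0z.
rewrite rmorph_prod (nrm_prod hN) [leRHS](bigID (fun z => out z)) /=.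
rewrite -[leLHS]mulr1; apply: ler_pM => //; last exact: prod_max1_ge1.
  by apply: prodr_ge0 => z _; apply: nrm_ge0.
apply: ler_prod => z _; rewrite (nrm_ge0 hN) /max1 le_max lexx orbT //.
Qed.

Lemma outer_gal_integral (s : G) p : prime p -> V p (s al).
Proof.
move=> pr; have hp := hV pr; have ps := splits_perm s f0 fS.
have -> : s al = l * \prod_(w <- rs | out ((s^-1)%g w)) w.
  rewrite /outer rmorphM rmorph_int rmorph_prod -[in RHS](perm_big _ ps) /= big_map.
  by congr (_ * _); apply: eq_bigl => z; rewrite galVKf.
apply: (over_lead_prod pr hp); rewrite -fS => i.
by rewrite coef_map; apply: (sr_int hp).
Qed.

(** A conjugate is l times the product over some subsequence of [rs], which a mask encodes. *)
Lemma size_conj_outer : (size (conj_seq al) <= 2 ^ size rs)%N.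
Proof.
rewrite -card_bool -card_tuple.
pose g (m : (size rs).-tuple bool) : L := l * \prod_(w <- mask m rs) w.
rewrite cardE -(size_map g); apply: uniq_leq_size; first exact: conj_seq_uniq.
move=> _ /conj_seqP [s ->]; have ps := splits_perm s f0 fS.
have sm : size (map (fun w => out ((s^-1)%g w)) rs) == size rs by rewrite size_map.
apply/mapP; exists (Tuple sm); first by rewrite mem_enum.
rewrite /g /= -filter_mask big_filter /outer rmorphM rmorph_int rmorph_prod.
rewrite -[in RHS](perm_big _ ps) /= big_map.
by congr (_ * _); apply: eq_bigl => z; rewrite galVKf.
Qed.

Lemma outer_norm_int : exists N : int, \prod_(x <- conj_seq al) x = N%:~R.
Proof.
have [q Dq] : exists q, \prod_(x <- conj_seq al) x = ratr q.
  apply: gal_fixed_rat => s; rewrite rmorph_prod /=.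
  by rewrite -[RHS](perm_big _ (conj_seq_perm al s)) big_map.
suff /intrP [n qn] : q \is a Num.int by exists n; rewrite Dq qn [LHS]ratr_int.
apply: (vr_ratr_int hV) => p pr; rewrite -Dq big_seq; apply: (sr_prod (hV pr)) => x.
by move=> /conj_seqP [s ->]; apply: outer_gal_integral.
Qed.

Definition stab (x : L) : {set G} := [set s : G | s x == x].

Lemma stab_gt0 x : (0 < #|stab x|)%N.
Proof. by apply/card_gt0P; exists 1%g; rewrite inE gal1f. Qed.

Lemma prod_gal_norm x : \prod_(s : G) s x = (\prod_(y <- conj_seq x) y) ^+ #|stab x|.
Proof.
transitivity (\prod_(y <- [seq s x | s : G]) y); first by rewrite big_map big_enum.
rewrite -big_undup_iterop_count /= -prodrXl big_seq [RHS]big_seq.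
apply: eq_bigr => y /conj_seqP [t ->].
suff -> : count_mem (t x) [seq s x | s : G] = #|stab x| by [].
rewrite count_map -sum1_count big_enum_cond /= -sum1_card.
rewrite [RHS](reindex_inj (@mulIg _ (t^-1)%g)) /=; apply: eq_bigl => s.
rewrite inE galMf; apply/eqP/eqP => [->|e]; first by rewrite galVKf.
by rewrite -{2}e galKVf.
Qed.

End One.

Lemma card_shift (s : G) A : #|shift s A| = #|A|.
Proof.
rewrite -!sum1_card [RHS](reindex_inj (mulgI s)) /=; apply: eq_bigl => t.
by rewrite inE.
Qed.

(** Every root occurs in the conjugate of the outer product under s for exactly [#|pattern nrm z|]
    of the s, all patterns being translates of each other. The powers of the roots combine to a
    power of the constant coefficient, which up to sign is the leading coefficient times the product
    of the roots. *)
Lemma prod_gal_outer f z : f != 0 -> splits f (conj_seq z) ->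
  exists e : nat, \prod_(s : G) s (outer f (conj_seq z)) = (-1) ^+ e *
    ((lead_coef f)%:~R ^+ (#|{: G}| - #|pattern nrm z|) * (f`_0)%:~R ^+ #|pattern nrm z|).
Proof.
move=> f0 fS; set rf := conj_seq z; set t := #|pattern nrm z|.
have tG : (t <= #|{: G}|)%N by rewrite max_card.
have D0 : (f`_0)%:~R = (-1) ^+ size rf * ((lead_coef f)%:~R * \prod_(w <- rf) w) :> L.
  have := congr1 (fun p : {poly L} => p`_0) fS; rewrite coef_map coefZ coef0_prod => ->.
  rewrite mulrCA; congr (_ * _); rewrite (eq_bigr (fun w => -1 * w)).
    by rewrite big_split /= big_const_seq count_predT iter_mulr_1.
  by move=> w _; rewrite coefB coefX coefC eqxx sub0r mulN1r.
exists (size rf * t)%N; rewrite D0 exprMn -exprM [X in _ = _ * X]mulrCA [RHS]mulrA -expr2.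
rewrite sqrr_sign mul1r exprMn mulrA -exprD subnK //.
transitivity (\prod_(s : G) ((lead_coef f)%:~R * \prod_(w <- rf | out ((s^-1)%g w)) w) : L).
  apply: eq_bigr => s _; have ps := splits_perm s f0 fS.
  rewrite /outer rmorphM rmorph_int rmorph_prod -[in RHS](perm_big _ ps) /= big_map.
  by congr (_ * _); apply: eq_bigl => w; rewrite galVKf.
rewrite big_split /= prodr_const; congr (_ * _).
rewrite (exchange_big_dep xpredT) //= -prodrXl big_seq [RHS]big_seq.
apply: eq_bigr => w /conj_seqP [s ->]; rewrite prodr_const; congr (_ ^+ _).
rewrite /t -(card_shift s) -pattern_gal -!sum1_card [LHS](reindex_inj invg_inj) /=.
by apply: eq_bigl => u; rewrite inE unfold_in /= invgK.
Qed.

Section Divisors.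

Variables (al : L) (N : int).
Hypothesis Dal : \prod_(x <- conj_seq al) x = N%:~R.
Hypothesis al0 : al != 0.

Lemma norm_neq0 : N != 0.
Proof.
rewrite -(pchar0_intf_neq0 L) -Dal prodf_seq_neq0; apply/allP => x /conj_seqP [s ->] /=.
by rewrite -(rmorph0 s) (inj_eq (@gal_inj _ s)).
Qed.

Lemma fixed_integral_int x : (forall s : G, s x = x) -> (forall p, prime p -> V p x) ->
  exists m : int, x = m%:~R.
Proof.
move=> /gal_fixed_rat [q Dq] Vx.
suff /intrP [n qn] : q \is a Num.int by exists n; rewrite Dq qn [LHS]ratr_int.
by apply: (vr_ratr_int hV) => p pr; rewrite -Dq; apply: Vx.
Qed.

Lemma prod_gal_int x : (forall (s : G) p, prime p -> V p (s x)) ->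
  exists m : int, \prod_(s : G) s x = m%:~R.
Proof.
move=> Vx; apply: fixed_integral_int => [t|p pr]; last first.
  by apply: (sr_prod (hV pr)) => s _; apply: Vx.
rewrite rmorph_prod /= [RHS](reindex_inj (@mulIg _ t)) /=.
by apply: eq_bigr => s _; rewrite galMf.
Qed.

Lemma intr_inj_L : injective (intr : int -> L).
Proof.
move=> a b e; apply/eqP; rewrite -subr_eq0 -(pchar0_intf_neq0 L) rmorphB /= e.
by rewrite subrr.
Qed.

(** The product over the group is N to the power [#|stab al|], so the divisibility holds for these
    powers, and then for m and N themselves. *)
Lemma dvd_norm (m q : int) (k : nat) : (#|stab al| <= k)%N ->
  \prod_(s : G) s al = m%:~R ^+ k * q%:~R -> (m %| N)%Z.
Proof.
rewrite prod_gal_norm Dal => lk.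
rewrite -!rmorphXn -rmorphM => /intr_inj_L e.
have h0 := stab_gt0 al.
rewrite dvdzE -(dvdn_pexp2r _ _ h0) -!abszX e abszM !abszX.
apply: dvdn_mulr; exact: dvdn_exp2l.
Qed.

Variables (A : {poly int}) (rs : seq L).
Hypotheses (A0 : A != 0) (AS : splits A rs) (Aal : outer A rs = al).

Lemma outer_cofactor_int f rf : splits f rf -> forall g, A = f * g ->
  exists m : int, \prod_(s : G) s al = \prod_(s : G) s (outer f rf) * m%:~R.
Proof.
move=> fS g DA; have fg0 : f * g != 0 by rewrite -DA.
have [g0] : g != 0 by move: fg0; rewrite mulf_eq0 negb_or => /andP[].
have AS' : splits (f * g) rs by rewrite -DA.
have [rg prs gS] := splits_factor fg0 AS' fS.
have [m Dm] : exists m : int, \prod_(s : G) s (outer g rg) = m%:~R.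
  by apply: prod_gal_int => s p pr; apply: outer_gal_integral.
exists m; rewrite -Dm -big_split /=; apply: eq_bigr => s _.
by rewrite -rmorphM -Aal DA (outer_mul f g prs).
Qed.

Lemma pattern_stab z s h : z \in rs -> h \in stab al ->
  ((s * h)%g \in pattern nrm z) = (s \in pattern nrm z).
Proof.
rewrite !inE => zrs /eqP hal; rewrite galMf; apply: (out_gal_stable A0 AS); first by rewrite Aal.
by rewrite -(perm_mem (splits_perm s A0 AS)) map_f.
Qed.

Lemma card_pattern_ge z s : z \in rs -> s \in pattern nrm z ->
  (#|stab al| <= #|pattern nrm z|)%N.
Proof.
move=> zrs sz; rewrite -(card_imset (mem (stab al)) (mulgI s)); apply: subset_leq_card.
by apply/fintype.subsetP => _ /imsetP [h hH ->]; rewrite pattern_stab.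
Qed.

Lemma card_pattern_le z s : z \in rs -> s \notin pattern nrm z ->
  (#|stab al| <= #|{: G}| - #|pattern nrm z|)%N.
Proof.
move=> zrs sz; rewrite -(cardsC (pattern nrm z)) addKn.
rewrite -(card_imset (mem (stab al)) (mulgI s)); apply: subset_leq_card.
by apply/fintype.subsetP => _ /imsetP [h hH ->]; rewrite finset.inE pattern_stab.
Qed.

(** The complement of the pattern is a nonempty union of cosets of [stab al], so the exponent of the
    leading coefficient in [prod_gal_outer] is at least [#|stab al|]. The cofactor g contributes an
    integer. *)
Lemma lead_dvd_norm f g z : A = f * g -> z \in rs -> splits f (conj_seq z) ->
  pattern nrm z != [set: G] -> (lead_coef f %| N)%Z.
Proof.
move=> DA zrs fS /eqP nT.
have [s sz] : exists s, s \notin pattern nrm z.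
  apply/existsP; rewrite -negb_forall; apply/negP => /forallP h; apply: nT.
  by apply/setP => s; rewrite h inE.
have f0 : f != 0 by apply: contraNneq A0 => f0; rewrite DA f0 mul0r.
have [m Dm] := outer_cofactor_int fS DA.
have [e De] := prod_gal_outer f0 fS.
apply: (@dvd_norm _ ((-1) ^+ e * f`_0 ^+ #|pattern nrm z| * m)).
  exact: card_pattern_le zrs sz.
by rewrite Dm De !rmorphM !rmorphXn rmorphN1 !mulrA; congr (_ * _ * _); rewrite mulrC.
Qed.

(** The same argument with a coset inside the pattern, whose cardinality is the exponent of the
    constant coefficient. *)
Lemma coef0_dvd_norm f g z : A = f * g -> z \in rs -> splits f (conj_seq z) ->
  pattern nrm z != finset.set0 -> (f`_0 %| N)%Z.
Proof.
move=> DA zrs fS /set0Pn [s sz].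
have f0 : f != 0 by apply: contraNneq A0 => f0; rewrite DA f0 mul0r.
have [m Dm] := outer_cofactor_int fS DA.
have [e De] := prod_gal_outer f0 fS.
apply: (@dvd_norm _ ((-1) ^+ e * lead_coef f ^+ (#|{: G}| - #|pattern nrm z|) * m)).
  exact: card_pattern_ge zrs sz.
by rewrite Dm De !rmorphM !rmorphXn rmorphN1 !mulrA; congr (_ * _); rewrite mulrC mulrA.
Qed.

(* Patterns are unions of left cosets of the stabiliser of the outer product,
   hence determined by a set of conjugates of that product. *)
Definition pattern_code n (P : {set G}) : {set 'I_n.+1} :=
  [set inord (index (((s : G)^-1 : G)%g al) (conj_seq al)) | s in P].

(** The value of s^-1 at [al] is the same on the whole coset of s and separates cosets; this is why
    the code applies inverses. *)
Lemma pattern_code_mem n z (s : G) : (size (conj_seq al) <= n.+1)%N -> z \in rs ->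
  (s \in pattern nrm z) = (inord (index ((s^-1 : G)%g al) (conj_seq al)) \in pattern_code n
    (pattern nrm z)).
Proof.
move=> sn zrs; apply/idP/imsetP => [sz|[t tz e]]; first by exists s.
have mem (u : G) : (u^-1 : G)%g al \in conj_seq al by apply/conj_seqP; exists (u^-1)%g.
have lt (u : G) : (index ((u^-1 : G)%g al) (conj_seq al) < n.+1)%N.
  by apply: leq_trans sn; rewrite index_mem mem.
have := congr1 (@nat_of_ord _) e; rewrite !inordK // => ei.
have eal : (s^-1 : G)%g al = (t^-1 : G)%g al.
  by have := nth_index 0 (mem s); rewrite ei (nth_index _ (mem t)) => ->.
have -> : s = (t * (t^-1 * s))%g by rewrite mulKVg.
by rewrite pattern_stab // inE galMf -eal galKVf.
Qed.

End Divisors.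

Lemma pattern_code_inj al A A' rs rs' n z z' : A != 0 -> A' != 0 -> splits A rs ->
  splits A' rs' ->
  outer A rs = al -> outer A' rs' = al -> (size (conj_seq al) <= n.+1)%N ->
  z \in rs -> z' \in rs' ->
  pattern_code al n (pattern nrm z) = pattern_code al n (pattern nrm z') ->
  pattern nrm z = pattern nrm z'.
Proof.
move=> A0 A0' AS AS' Da Da' sn zrs zrs' e; apply/setP => s.
by rewrite (pattern_code_mem A0 AS Da s sn zrs) (pattern_code_mem A0' AS' Da' s sn zrs') e.
Qed.

End OuterProduct.

(** Irreducibility disregards constants, so the content of A is not split off and remains in some
    factor. *)
Lemma int_factorization (A : {poly int}) : (1 < size A)%N ->
  exists fs : seq {poly int}, A = \prod_(f <- fs) f /\ forall f, f \in fs -> irreducible_poly f.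
Proof.
have [n] := ubnP (size A); elim: n A => // n IH A lt sA.
have A0 : A != 0 by rewrite -size_poly_gt0; apply: ltn_trans sA.
have [irr|nirr] := pselect (irreducible_poly A).
  by exists [:: A]; rewrite big_seq1; split => // f; rewrite inE => /eqP ->.
have [q [sq qA nqA]] : exists q : {poly int}, [/\ size q != 1%N, q %| A & ~~ (q %= A)].
  apply: contrapT => no; apply: nirr; split => // q sq qA.
  by apply: contrapT => /negP nqA; apply: no; exists q.
have [r Dr] : exists r : {poly int}, A = zprimitive q * r.
  by have [r Dr] := dvdpP_int qA; exists r.
have zr0 : zprimitive q * r != 0 by rewrite -Dr.
have := zr0; rewrite mulf_eq0 negb_or zprimitive_eq0 => /andP[q0 r0].
have szq := size_zprimitive q.
have sA' : size A = (size q + size r).-1 by rewrite Dr size_mul ?zprimitive_eq0 // szq.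
have sqA : size q != size A.
  by rewrite (Pdiv.Idomain.dvdp_size_eqp qA).
have q1 : (1 < size q)%N by rewrite ltn_neqAle eq_sym sq size_poly_gt0.
have rp : (0 < size r)%N by rewrite size_poly_gt0.
have [|| fs1 [D1 I1]] := IH (zprimitive q); rewrite ?szq //; first by lia.
have r1 : (1 < size r)%N.
  rewrite ltn_neqAle rp andbT; apply/eqP => r1; move: sA'.
  by rewrite -r1 addn1 /= => /esym/eqP; rewrite (negPf sqA).
have [|fs2 [D2 I2]] := IH r _ r1; first by lia.
exists (fs1 ++ fs2); rewrite big_cat /= -D1 -D2; split=> // f.
by rewrite mem_cat => /orP[/I1|/I2].
Qed.

Lemma size_prod_irreducible (fs : seq {poly int}) : (forall f, f \in fs -> irreducible_poly f) ->
  (size fs < size (\prod_(f <- fs) f)%R)%N.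
Proof.
elim: fs => [|f fs IH] hf; first by rewrite big_nil size_poly1.
have {}IH : (size fs < size (\prod_(f <- fs) f)%R)%N.
  by apply: IH => g gs; apply: hf; rewrite inE gs orbT.
have [s1 _] := hf f (mem_head _ _).
rewrite big_cons size_mul.
- by rewrite /=; move: s1 IH; move: (size f) (size (\prod_(g <- fs) g)%R) => a b; lia.
- by rewrite -size_poly_gt0; apply: ltn_trans s1.
by rewrite -size_poly_gt0; apply: leq_ltn_trans IH.
Qed.

Lemma leq_of_pred_addn (a b c : nat) : (0 < b)%N -> (a + b).-1 = c -> (a <= c)%N.
Proof. by lia. Qed.

(** * Polynomials sharing one outer product *)

Section Families.

Variables (L : splittingFieldType rat) (R : realType) (nrm : L -> R).
Variables (V : nat -> L -> Prop).
Hypothesis hN : absolute_value nrm.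
Hypothesis hV : forall p, prime p -> valuation_ring p (V p).
Local Notation G := (gal_of {:L}).

Variables (d X : nat) (rt : {poly int} -> L) (fsF : {poly int} -> seq {poly int}).
Variables (al : L) (S : seq {poly int}).
Hypothesis alX : nrm al <= X%:R.

(** The factorization [fsF] is a parameter: the general bound takes a full factorization, while the
    bound for special polynomials takes the one-term list of the polynomial itself. *)
Record in_family (A : {poly int}) : Prop := InFamily {
  fam_size : size A = d.+1;
  fam_prod : A = \prod_(f <- fsF A) f;
  fam_irr : forall f, f \in fsF A -> irreducible_poly f;
  fam_root : forall f, f \in fsF A -> root (map_poly intr f) (rt f);
  fam_outer : exists2 rs, splits A rs & outer nrm A rs = al }.

Local Notation is_factor := (is_factor d rt).
Local Notation roots_of := (roots_of rt).

Lemma fam_neq0 A : in_family A -> A != 0.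
Proof. by move=> hA; rewrite -size_poly_gt0 (fam_size hA). Qed.

Lemma fam_dvd A f : in_family A -> f \in fsF A -> A = f * \prod_(g <- rem f (fsF A)) g.
Proof. by move=> hA ff; rewrite {1}(fam_prod hA) (perm_big _ (perm_to_rem ff)) big_cons. Qed.

Lemma fam_factor A f : in_family A -> f \in fsF A -> is_factor f.
Proof.
move=> hA ff; split; [exact: fam_irr hA _ ff | | exact: fam_root hA _ ff].
have [g Dg] : exists g : {poly int}, A = f * g by eexists; exact: fam_dvd ff.
have := fam_neq0 hA; have := fam_size hA.
rewrite {}Dg mulf_eq0 negb_or => + /andP[f0 g0]; rewrite size_mul // => sz.
by apply: leq_of_pred_addn sz; rewrite size_poly_gt0.
Qed.

Lemma fam_size_factors A : in_family A -> (size (fsF A) <= d)%N.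
Proof.
move=> hA; rewrite -ltnS -(fam_size hA) {2}(fam_prod hA).
exact: size_prod_irreducible (fam_irr hA).
Qed.

Lemma fam_splits f : is_factor f -> splits f (roots_of f).
Proof. exact: factorE. Qed.

Lemma fam_rt_mem A f rs : in_family A -> f \in fsF A -> splits A rs -> rt f \in rs.
Proof.
move=> hA ff AS; rewrite -root_prod_XsubC.
rewrite -(rootZ _ _ (lead_intr_neq0 L (fam_neq0 hA))) -AS (fam_dvd hA ff).
by rewrite rmorphM rootM (fam_root hA ff).
Qed.

Definition msr f : R := lead_max1 nrm (lead_coef f) (roots_of f).

Lemma msr_ge1 f : is_factor f -> 1 <= msr f.
Proof.
move=> hf; rewrite /msr /lead_max1 -[leLHS]mulr1; apply: ler_pM => //; last exact: prod_max1_ge1.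
by rewrite -[1]/(1%:~R) ler_int -gtz0_ge1 normr_gt0 (is_factor_lead hf).
Qed.

Lemma fam_msr A : in_family A -> \prod_(f <- fsF A) msr f = nrm al.
Proof.
move=> hA; have [rs AS <-] := fam_outer hA; rewrite (nrm_outer hN).
have gen (fs : seq {poly int}) B rsB : (forall f, f \in fs -> is_factor f) -> B != 0 ->
     B = \prod_(f <- fs) f -> splits B rsB ->
     \prod_(f <- fs) msr f = `|lead_coef B|%:~R * \prod_(z <- rsB) max1 nrm z.
  elim: fs B rsB => [|f fs IH] B rsB hfs B0 DB BS.
    rewrite big_nil in DB; rewrite big_nil DB lead_coef1 normr1 mul1r.
    move: BS; rewrite /splits DB lead_coef1 rmorph1 scale1r => /(congr1 (fun p : {poly L} =>
      size p)).
    by rewrite size_poly1 size_prod_XsubC; case: rsB => //; rewrite big_nil.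
  rewrite big_cons in DB; have hf := hfs f (mem_head _ _).
  have B0' := B0; rewrite DB in B0'; have BS' := BS; rewrite DB in BS'.
  have [rg prs gS] := splits_factor B0' BS' (fam_splits hf).
  move: (B0'); rewrite mulf_eq0 negb_or => /andP[_ g0].
  rewrite big_cons (IH _ rg _ g0 erefl gS); last by move=> g gfs; apply: hfs;
    rewrite inE gfs orbT.
  rewrite DB lead_coefM normrM rmorphM (perm_big _ prs) big_cat /= /msr /lead_max1.
  by rewrite mulrACA.
apply: gen AS => //; [by move=> f ff; apply: fam_factor ff | exact: fam_neq0 | exact: fam_prod].
Qed.

Lemma fam_msr_le A f : in_family A -> f \in fsF A -> msr f <= nrm al.
Proof.
move=> hA ff; rewrite -(fam_msr hA) (perm_big _ (perm_to_rem ff)) big_cons.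
rewrite ler_peMr //; first by apply: le_trans (msr_ge1 (fam_factor hA ff)).
have sub g : g \in rem f (fsF A) -> is_factor g.
  by move=> /mem_rem gg; apply: fam_factor gg.
rewrite big_seq; apply: (big_ind (fun y : R => 1 <= y)) => // [x y h1 h2|g /sub /msr_ge1 //].
by rewrite -[leLHS]mulr1; apply: ler_pM.
Qed.

Lemma fam_X_gt0 A : in_family A -> (0 < X)%N.
Proof.
move=> hA; rewrite lt0n; apply/negP => /eqP X0; move: alX; rewrite X0.
have [rs AS Da] := fam_outer hA.
by rewrite leNgt (nrm_gt0 hN) -Da (outer_neq0 hN) // fam_neq0.
Qed.

Definition base : nat := (2 ^ d * X)%N.

(** The bound involves the measure of the single factor, so that a product over all factors is still
    bounded by a constant times the measure of A. *)
Lemma fam_ncoef_msr A f j : in_family A -> f \in fsF A ->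
  `|ncoef nrm rt f j|%:~R <= 2 ^+ d * msr f.
Proof.
move=> hA ff; have hf := fam_factor hA ff.
rewrite -(nrm_int hN) -(ncoefP nrm hV j hf).
apply: le_trans (nrm_blocks_coef hN _ _ _) _; rewrite ler_wpM2r //.
  exact: le_trans (msr_ge1 hf).
apply: ler_weXn2l; first by rewrite ler1n.
by rewrite -ltnS (size_roots_of hf); have [] := hf.
Qed.

Lemma msr_base A f : in_family A -> f \in fsF A -> 2 ^+ d * msr f <= base%:R.
Proof.
move=> hA ff; rewrite /base natrM natrX ler_wpM2l ?exprn_ge0 //.
exact: le_trans (fam_msr_le hA ff) alX.
Qed.

Lemma fam_ncoef A f j : in_family A -> f \in fsF A -> (`|ncoef nrm rt f j| <= base)%N.
Proof.
move=> hA ff; rewrite -(ler_nat R) natr_absz.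
exact: le_trans (fam_ncoef_msr j hA ff) (msr_base hA ff).
Qed.

Lemma fam_lead A f : in_family A -> f \in fsF A -> (`|lead_coef f| <= base)%N.
Proof.
move=> hA ff; rewrite -(ler_nat R) natr_absz; apply: le_trans (msr_base hA ff).
rewrite /msr /lead_max1 mulrCA -[leLHS]mulr1 ler_pM //.
rewrite -[leLHS]mulr1; apply: ler_pM => //; last exact: prod_max1_ge1.
by apply: exprn_ege1; rewrite ler1n.
Qed.

Lemma fam_bcoef A f P j : in_family A -> f \in fsF A -> nrm (bcoef nrm rt f P j) <= base%:R.
Proof.
move=> hA ff; have hf := fam_factor hA ff; apply: le_trans (msr_base hA ff).
apply: le_trans (nrm_block_coef hN _ _ _ _) _; rewrite ler_wpM2r //.
  exact: le_trans (msr_ge1 hf).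
apply: ler_weXn2l; first by rewrite ler1n.
by rewrite -ltnS (size_roots_of hf); have [] := hf.
Qed.

(* All conjugates of the nonzero algebraic integer bcoef f P j are at most base,
   and their product is at least 1. *)
Lemma fam_bcoef_ge A f P j : in_family A -> f \in fsF A -> P \in pats nrm rt f ->
  ncoef nrm rt f j != 0 -> 1 <= nrm (bcoef nrm rt f P j) * (base ^ d)%:R.
Proof.
move=> hA ff Pf n0; have hf := fam_factor hA ff.
have base1 : 1 <= (base%:R : R).
  by rewrite ler1n /base muln_gt0 expn_gt0 (fam_X_gt0 hA).
have l0 : 0 < (`|lead_coef f|%:~R : R) by rewrite ltr0z normr_gt0 (is_factor_lead hf).
have l1 : 1 <= (`|lead_coef f|%:~R : R).
  by rewrite -[1]/(1%:~R) ler_int -gtz0_ge1 normr_gt0 (is_factor_lead hf).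
have n1 : 1 <= (`|ncoef nrm rt f j|%:~R : R) by rewrite -[1]/(1%:~R) ler_int -gtz0_ge1 normr_gt0.
have c0 : (0 < #|pats nrm rt f|)%N by apply/card_gt0P; exists P.
have prod1 : 1 <= \prod_(B in pats nrm rt f) nrm (bcoef nrm rt f B j).
  have := congr1 nrm (prod_bcoef nrm hV j hf);
    rewrite !(nrmM hN) !(nrmX hN) !(nrm_int hN) (nrm_prod hN).
  move=> e; rewrite -(ler_pM2r l0) e mul1r.
  rewrite -[leLHS]mulr1; apply: ler_pM => //.
  by rewrite -(prednK c0) exprS -[leLHS]mulr1 ler_pM ?exprn_ege1.
apply: le_trans prod1 _; rewrite (bigD1 P) //= ler_wpM2l ?(nrm_ge0 hN) // natrX.
apply: le_trans (_ : \prod_(B in pats nrm rt f | B != P) (base%:R : R) <= _).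
  by apply: ler_prod => B _; rewrite (nrm_ge0 hN) (fam_bcoef B j hA ff).
rewrite prodr_const; apply: ler_weXn2l => //.
apply: leq_trans (card_pats nrm hf); apply: subset_leq_card.
by apply/fintype.subsetP => B; rewrite unfold_in => /andP[].
Qed.

End Families.

(** * Counting polynomials with equal keys *)

Section KeyCounting.

Variables (L : splittingFieldType rat) (R : realType) (nrm : L -> R).
Variables (V : nat -> L -> Prop).
Hypothesis hN : absolute_value nrm.
Hypothesis hV : forall p, prime p -> valuation_ring p (V p).
Local Notation G := (gal_of {:L}).

Variables (d X : nat) (rt : {poly int} -> L) (fsF : {poly int} -> seq {poly int}).
Variables (al : L) (S : seq {poly int}).
Hypothesis alX : nrm al <= X%:R.
Hypothesis uS : uniq S.
Hypothesis fam : forall A, A \in S -> in_family nrm d rt fsF al A.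

Local Notation B := (base d X).
Variables (W T : nat).
Hypothesis WB : (B ^ (d.+1 * d`! + 2 ^ d) <= W)%N.
Hypothesis TW : forall m : nat, (0 < m <= W)%N -> (size (divisors m) <= T)%N.

Local Notation ncf := (ncoef nrm rt).
Local Notation gcd_ := (gcode nrm V d rt).
Local Notation lcd := (lcode nrm rt (B ^ d)).
Local Notation ptn f := (pat nrm rt f).
Local Notation ptns f := (pats nrm rt f).

Definition factor_of A i : {poly int} := nth 0 (fsF A) i.

(** The part of the data that may take more than M^eps values. An absent factor is marked by the
    leading coefficient 0, which no factor has, so the key also determines the number of factors. *)
Definition main_key A : {ffun 'I_d -> int * {ffun 'I_d.+1 -> int}} :=
  [ffun i : 'I_d => if (i < size (fsF A))%N
     then (lead_coef (factor_of A i), [ffun j : 'I_d.+1 => ncf (factor_of A i) j])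
     else (0, [ffun=> 0])].

Definition gbase f j : nat := ((`|lead_coef f| ^ d * `|ncf f j|) ^ d`!)%N.

Definition small_type : finType :=
  ({set 'I_(2 ^ d).-1.+1} * {ffun 'I_d * 'I_d.+1 -> 'I_(trunc_log 2 W).+1 * 'I_T.+1})%type.

Definition lkey f (q : 'I_d) (j : 'I_d.+1) : nat := lcd f (nth finset.set0 (enum (ptns f)) q) j.
Definition gkey f (q : 'I_d) (j : 'I_d.+1) : nat :=
  index (gcd_ f (nth finset.set0 (enum (ptns f)) q) j) (divisors (gbase f j)).

(** What [same_key] asks for beyond the main key: patterns, dyadic sizes, and divisors given by
    their index in the list of divisors. Its range is bounded by powers of log W and T. *)
Definition small_key A : {ffun 'I_d -> small_type} :=
  [ffun i : 'I_d => let f := factor_of A i in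
    (pattern_code al (2 ^ d).-1 (ptn f),
     [ffun ij : 'I_d * 'I_d.+1 => (inord (lkey f ij.1 ij.2), inord (gkey f ij.1 ij.2))])].

Lemma factor_of_mem A i : (i < size (fsF A))%N -> factor_of A i \in fsF A.
Proof. exact: mem_nth. Qed.

Lemma base_gt0 A : A \in S -> (0 < B)%N.
Proof.
move=> AS; rewrite /base muln_gt0 expn_gt0 /=.
exact: (fam_X_gt0 hN alX (fam AS)).
Qed.

(** A vanishing block coefficient is not a unit multiple of anything at the prime 2, so the default
    value of [xget] is returned and codes agree in this case too. *)
Lemma gcode0 f P j : is_factor d rt f -> P \in ptns f -> ncf f j = 0 -> gcd_ f P j = 0%N.
Proof.
move=> hf Pf n0; rewrite /gcode; case: xgetP => // g _ [g0 _ /(_ 2%N isT) [+ _ _]].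
have b0 : bcoef nrm rt f P j = 0 by apply/eqP; rewrite (bcoef_eq0 hV j hf Pf) n0.
by rewrite b0 expr0n gtn_eqF ?fact_gt0 // mul0r eqxx.
Qed.

Lemma gbase_le A i j : A \in S -> (i < size (fsF A))%N -> (gbase (factor_of A i) j <= W)%N.
Proof.
move=> AS li; have ff := factor_of_mem li; apply: leq_trans WB.
have b1 := base_gt0 AS.
apply: leq_trans (_ : ((B ^ d * B) ^ d`!)%N <= _)%N.
  rewrite leq_exp2r ?fact_gt0 // leq_mul //; last exact: (fam_ncoef hN hV alX j (fam AS) ff).
  have := fam_lead hN alX (fam AS) ff; case: (d) => // d' h; by rewrite leq_exp2r.
rewrite -expnSr -expnM leq_pexp2l // leq_addr //.
Qed.

Lemma lcd_le A i P j : A \in S -> (i < size (fsF A))%N ->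
  (lcd (factor_of A i) P j < (trunc_log 2 W).+1)%N.
Proof.
move=> AS li; rewrite ltnS /lcode; apply: leq_trunc_log.
have ff := factor_of_mem li; have b1 := base_gt0 AS.
apply: leq_trans (_ : B ^ d.+1 <= W)%N.
  rewrite -(ler_nat R); apply: le_trans (_ : nrm (bcoef nrm rt (factor_of A i) P j) * (B ^
    d)%:R <= _).
    by have /andP[] := truncn_itv (mulr_ge0 (nrm_ge0 hN (bcoef nrm rt (factor_of A i) P j))
      (ler0n R (B ^ d))).
  rewrite expnS natrM ler_wpM2r //; exact: (fam_bcoef hN alX P j (fam AS) ff).
apply: leq_trans WB; rewrite leq_pexp2l //.
by apply: leq_trans (leq_addr _ _); rewrite leq_pmulr // fact_gt0.
Qed.

Lemma al_conj A : A \in S -> (size (conj_seq al) <= (2 ^ d).-1.+1)%N.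
Proof.
move=> AS; have [rs As <-] := fam_outer (fam AS).
rewrite prednK ?expn_gt0 //.
have A0 := fam_neq0 (fam AS).
have -> : d = size rs.
  have := congr1 (fun p : {poly L} => size p) As.
  rewrite size_scale ?lead_intr_neq0 // size_prod_XsubC size_map_poly_id0 ?lead_intr_neq0 //.
  by rewrite (fam_size (fam AS)) => -[].
exact: size_conj_outer.
Qed.

(** Equal pattern codes give equal patterns, hence the same enumeration of the blocks. Only then do
    entries of the small keys at the same position refer to the same block. *)
Lemma same_key_of_codes A A' i : A \in S -> A' \in S -> main_key A = main_key A' ->
  small_key A = small_key A' -> (i < size (fsF A))%N ->
  (i < size (fsF A'))%N /\ same_key nrm V d rt (B ^ d) (factor_of A i) (factor_of A' i).
Proof.
move=> AS AS' /ffunP em /ffunP es li.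
have id_ : (i < d)%N by apply: leq_trans li (fam_size_factors (fam AS)).
have ff := factor_of_mem li; have hf := fam_factor (fam AS) ff.
have := em (Ordinal id_); rewrite !ffunE /= li.
have [li'|_] := ifP; last first.
  by case=> /eqP; rewrite (negPf (is_factor_lead hf)).
case=> el /ffunP en; split=> //.
have ff' := factor_of_mem li'; have hf' := fam_factor (fam AS') ff'.
have {}en j : ncf (factor_of A i) (j : 'I_d.+1) = ncf (factor_of A' i) j.
  by have := en j; rewrite !ffunE.
have := es (Ordinal id_); rewrite !ffunE => e_.
have ep : pattern_code al (2 ^ d).-1 (ptn (factor_of A i)) =
    pattern_code al (2 ^ d).-1 (ptn (factor_of A' i)) := congr1 fst e_.
have ef : [ffun u : 'I_d * 'I_d.+1 => (inord (lkey (factor_of A i) u.1 u.2) : 'I_(trunc_log 2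
  W).+1,
       inord (gkey (factor_of A i) u.1 u.2) : 'I_T.+1)] =
    [ffun u : 'I_d * 'I_d.+1 => (inord (lkey (factor_of A' i) u.1 u.2),
      inord (gkey (factor_of A' i) u.1 u.2))]
  := congr1 snd e_.
have e2 (q : 'I_d) (j : 'I_d.+1) := etrans (esym (ffunE (fun u : 'I_d * 'I_d.+1 =>
     (inord (lkey (factor_of A i) u.1 u.2) : 'I_(trunc_log 2 W).+1,
       inord (gkey (factor_of A i) u.1 u.2) : 'I_T.+1)) (q, j)))
  (etrans (congr1 (fun h : {ffun 'I_d * 'I_d.+1 ->
    'I_(trunc_log 2 W).+1 * 'I_T.+1} => h (q, j)) ef)
   (ffunE (fun u : 'I_d * 'I_d.+1 => (inord (lkey (factor_of A' i) u.1 u.2) : 'I_(trunc_log 2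
     W).+1,
       inord (gkey (factor_of A' i) u.1 u.2) : 'I_T.+1)) (q, j))).
have el_ (q : 'I_d) (j : 'I_d.+1) : (inord (lkey (factor_of A i) q j) : 'I_(trunc_log 2 W).+1) =
    inord (lkey (factor_of A' i) q j) := congr1 fst (e2 q j).
have eg_ (q : 'I_d) (j : 'I_d.+1) : (inord (gkey (factor_of A i) q j) : 'I_T.+1) =
    inord (gkey (factor_of A' i) q j) := congr1 snd (e2 q j).
clear e_ ef es e2.
have [rs As Da] := fam_outer (fam AS); have [rs' As' Da'] := fam_outer (fam AS').
have epat : ptn (factor_of A i) = ptn (factor_of A' i).
  apply: (pattern_code_inj hN (fam_neq0 (fam AS)) (fam_neq0 (fam AS')) As As' Da Da' (al_conj
    AS) _ _ ep).
    exact: fam_rt_mem (fam AS) ff As.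
  exact: fam_rt_mem (fam AS') ff' As'.
have epats := eq_pats epat.
have pos P : P \in ptns (factor_of A i) ->
  exists2 q : 'I_d, P = nth finset.set0 (enum (ptns (factor_of A i))) q &
    P = nth finset.set0 (enum (ptns (factor_of A' i))) q.
  move=> Pf; have lq : (index P (enum (ptns (factor_of A i))) < d)%N.
    apply: leq_trans (card_pats nrm hf); rewrite cardE index_mem mem_enum //.
  by exists (Ordinal lq); rewrite -?epats nth_index // mem_enum.
have gidx A1 P (j : 'I_d.+1) : A1 \in S -> (i < size (fsF A1))%N -> P \in ptns (factor_of A1 i) ->
    ncf (factor_of A1 i) j != 0 ->
    gcd_ (factor_of A1 i) P j \in divisors (gbase (factor_of A1 i) j) /\
    (index (gcd_ (factor_of A1 i) P j) (divisors (gbase (factor_of A1 i) j)) < T.+1)%N.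
  move=> AS1 l1 Pf n0; have hf1 := fam_factor (fam AS1) (factor_of_mem l1).
  have gb0 : (0 < gbase (factor_of A1 i) j)%N.
    by rewrite expn_gt0 muln_gt0 expn_gt0 !absz_gt0 n0 (is_factor_lead hf1).
  have gm : gcd_ (factor_of A1 i) P j \in divisors (gbase (factor_of A1 i) j).
    by rewrite -dvdn_divisors //; have [] := gcodeP hV hf1 n0 Pf.
  split=> //; apply: (@leq_trans (size (divisors (gbase (factor_of A1 i) j)))).
    by rewrite index_mem.
  by apply: leqW; apply: TW; rewrite gb0 gbase_le.
split=> //.
- move=> P j Pf; have [q Pq Pq'] := pos P Pf; have Pf' := Pf; rewrite epats in Pf'.
  have := congr1 (@nat_of_ord _) (eg_ q j).
  have -> : gkey (factor_of A i) q j =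
    index (gcd_ (factor_of A i) P j) (divisors (gbase (factor_of A i) j)).
    exact: (congr1 (fun P0 => index (gcd_ (factor_of A i) P0 j) _) (esym Pq)).
  have -> : gkey (factor_of A' i) q j =
    index (gcd_ (factor_of A' i) P j) (divisors (gbase (factor_of A' i) j)).
    exact: (congr1 (fun P0 => index (gcd_ (factor_of A' i) P0 j) _) (esym Pq')).
  have [n0|n0] := eqVneq (ncf (factor_of A i) j) 0.
    by move=> _; rewrite !gcode0 // -en.
  have [m1 l1] := gidx A P j AS li Pf n0.
  have n0' := n0; rewrite en in n0'.
  have [m2 l2] := gidx A' P j AS' li' Pf' n0'.
  have eb : gbase (factor_of A i) j = gbase (factor_of A' i) j by rewrite /gbase el en.
  rewrite !inordK // -eb => ei.
  by rewrite -(nth_index 0%N m1) ei nth_index // eb.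
- move=> P j Pf; have [q Pq Pq'] := pos P Pf.
  have := congr1 (@nat_of_ord _) (el_ q j).
  have -> : lkey (factor_of A i) q j = lcd (factor_of A i) P j.
    exact: (congr1 (fun P0 => lcd (factor_of A i) P0 j) (esym Pq)).
  have -> : lkey (factor_of A' i) q j = lcd (factor_of A' i) P j.
    exact: (congr1 (fun P0 => lcd (factor_of A' i) P0 j) (esym Pq')).
  by rewrite !inordK ?lcd_le.
Qed.

(** When both keys are fixed, the number of factors is fixed, and the factor at each of at most d
    positions has at most [key_bound d] values by [size_same_key]. *)
Theorem family_size :
  (size S <= key_bound d ^ d * #|{ffun 'I_d -> small_type}| * size (undup (map main_key S)))%N.
Proof.
apply: (size_le_fiber_code (c := small_key)) => // A0 A0S.
set S' := [seq _ <- _ | _].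
have S'S A : A \in S' -> [/\ A \in S, main_key A = main_key A0 & small_key A = small_key A0].
  by rewrite mem_filter => /andP[/andP[/eqP -> /eqP ->] ->].
have B0 : (0 < B ^ d)%N by rewrite expn_gt0 (base_gt0 A0S).
have same A A' i : A \in S' -> A' \in S' -> (i < size (fsF A))%N ->
   (i < size (fsF A'))%N /\ same_key nrm V d rt (B ^ d) (factor_of A i) (factor_of A' i).
  move=> /S'S [AS m c] /S'S [AS' m' c'].
  exact: (same_key_of_codes AS AS' (etrans m (esym m')) (etrans c (esym c'))).
apply: (size_le_values (v := fun A (i : 'I_d) => factor_of A i)).
- exact: filter_uniq.
- move=> i; have [li|li] := ltnP i (size (fsF A0)); last first.
    apply: leq_trans (_ : 1 <= _)%N; last by rewrite /key_bound expn_gt0.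
    apply: (@leq_trans (size [:: (0 : {poly int})])); last by [].
    apply: uniq_leq_size; first exact: undup_uniq.
    move=> f; rewrite mem_undup => /mapP [A AS' ->]; rewrite inE /factor_of nth_default //.
    rewrite leqNgt; apply/negP => lA.
    have A0S' : A0 \in S' by rewrite mem_filter !eqxx A0S.
    by have [] := same A A0 i AS' A0S' lA; rewrite ltnNge li.
  have A0S' : A0 \in S' by rewrite mem_filter !eqxx A0S.
  have mem f : f \in undup (map (fun A => factor_of A i) S') ->
      exists A, [/\ A \in S', (i < size (fsF A))%N & f = factor_of A i].
    rewrite mem_undup => /mapP [A AS' ->]; exists A; split => //.
    by have [] := same A0 A i A0S' AS' li.
  apply: (size_same_key hN hV B0); first exact: undup_uniq.
  + move=> f /mem [A [AS' lA ->]]; have [AS _ _] := S'S A AS'.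
    exact: fam_factor (fam AS) (factor_of_mem lA).
  + move=> f P j /mem [A [AS' lA ->]] Pf n0; have [AS _ _] := S'S A AS'.
    exact: (fam_bcoef_ge hN hV alX (fam AS) (factor_of_mem lA) Pf n0).
  + by move=> f g /mem [A [AS' lA ->]] /mem [A' [AS'' lA' ->]];
    have [] := same A A' i AS' AS'' lA.
move=> A A' AS' AS'' e; have [AS _ _] := S'S A AS'; have [ASS _ _] := S'S A' AS''.
have sz : size (fsF A) = size (fsF A').
  apply/eqP; rewrite eqn_leq; apply/andP; split.
    rewrite leqNgt; apply/negP => lt; have [] := same A A' (size (fsF A')) AS' AS'' lt.
    by rewrite ltnn.
  rewrite leqNgt; apply/negP => lt; have [] := same A' A (size (fsF A)) AS'' AS' lt.
  by rewrite ltnn.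
rewrite (fam_prod (fam AS)) (fam_prod (fam ASS)); congr (\prod_(f <- _) f).
apply: (eq_from_nth (x0 := 0)) => // i li.
have id_ : (i < d)%N by apply: leq_trans li (fam_size_factors (fam AS)).
exact: (e (Ordinal id_)).
Qed.

End KeyCounting.

Lemma size_undup_factor (T Y : eqType) (S : seq T) (F : finType) (D : T -> Y) (c : T -> F) :
  {in S &, forall x y, c x = c y -> D x = D y} -> (size (undup (map D S)) <= #|F|)%N.
Proof.
move=> h; case: S h => [//|x0 S'] h; set S := x0 :: S' in h *.
have pre y : y \in undup (map D S) -> exists2 x, x \in S & D x = y.
  by rewrite mem_undup => /mapP [x xS ->]; exists x.
have /choice [r Hr] : forall y, exists x, y \in undup (map D S) -> x \in S /\ D x = y.
  move=> y; have [/pre [x xS Dx]|yS] := boolP (y \in undup (map D S)); first by exists x.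
  by exists x0.
apply: (size_le_code (c := c \o r)); first exact: undup_uniq.
move=> y z /Hr [rS ry] /Hr [rS' rz] /= e; rewrite -ry -rz; exact: h.
Qed.

Definition div_code (T m : nat) (n : int) : bool * 'I_T.+1 :=
  (0 <= n, inord (index `|n|%N (divisors m))).

Lemma div_code_inj T m (a b : int) : (0 < m)%N -> (size (divisors m) <= T)%N ->
  (`|a| %| m)%N -> (`|b| %| m)%N -> div_code T m a = div_code T m b -> a = b.
Proof.
move=> m0 sT am bm e; have e1 := congr1 fst e; have /(congr1 (@nat_of_ord _)) := congr1 snd e.
have ma : `|a|%N \in divisors m by rewrite -dvdn_divisors.
have mb : `|b|%N \in divisors m by rewrite -dvdn_divisors.
have lt x : x \in divisors m -> (index x (divisors m) < T.+1)%N.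
  by move=> xm; rewrite ltnS ltnW //; apply: leq_trans sT; rewrite index_mem.
rewrite /= !inordK ?lt // => ei.
have : `|a|%N = `|b|%N by rewrite -(nth_index 0%N ma) ei nth_index.
move: e1; rewrite /=; case: (lerP 0 a) => sa; case: (lerP 0 b) => sb //= _ eab; lia.
Qed.

(** * The extreme coefficients of the blocks *)

Section FactorShape.

Variables (L : splittingFieldType rat) (R : realType) (nrm : L -> R).
Variables (V : nat -> L -> Prop) (d : nat) (rt : {poly int} -> L).
Hypothesis hV : forall p, prime p -> valuation_ring p (V p).
Local Notation G := (gal_of {:L}).
Local Notation ncf := (ncoef nrm rt).

(** The common degree of all blocks of f, which are conjugate to each other. *)
Definition block_deg f := count (fun z => pattern nrm z == pat nrm rt f) (roots_of rt f).

Lemma size_block f P : P \in pats nrm rt f ->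
  size (block nrm (roots_of rt f) P) = (block_deg f).+1.
Proof.
move=> /pats_pat [s ->].
rewrite -(block_gal nrm (conj_seq_perm (rt f))) size_map_poly /block -big_filter.
by rewrite size_prod_XsubC size_filter.
Qed.

Lemma block_deg_gt0 f : (0 < block_deg f)%N.
Proof. by rewrite -has_count; apply/hasP; exists (rt f); rewrite ?conj_seq_id /=. Qed.

Lemma intr_inj_ext : injective (intr : int -> L).
Proof.
move=> a b e; apply/eqP; rewrite -subr_eq0 -(pchar0_intf_neq0 L) rmorphB /= e.
by rewrite subrr.
Qed.

Lemma ncoef_lead f : is_factor d rt f -> ncf f (block_deg f) = lead_coef f.
Proof.
move=> hf; apply: intr_inj_ext; rewrite -(ncoefP nrm hV _ hf) /bprod /blocks_coef.
rewrite big1 ?mulr1 // => P Pf.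
have : block nrm (roots_of rt f) P \is monic by apply: monic_prod => z _; apply: monicXsubC.
by move/monicP; rewrite /lead_coef size_block.
Qed.

Lemma ncoef_large f j : is_factor d rt f -> (block_deg f < j)%N -> ncf f j = 0.
Proof.
move=> hf lt; apply: intr_inj_ext; rewrite -(ncoefP nrm hV _ hf) /bprod /blocks_coef.
by rewrite (bigD1 (pat nrm rt f)) ?pat_pats //=
  nth_default ?mul0r ?mulr0 // size_block // pat_pats.
Qed.

Lemma ncoef_0 f : is_factor d rt f -> ncf f 0 = f`_0.
Proof.
move=> hf; apply: intr_inj_ext; rewrite -(ncoefP nrm hV _ hf) /bprod /blocks_coef.
rewrite -coef0_prod prod_blocks -coefZ -(factorE hf) coef_map //.
Qed.

End FactorShape.

(** * The number of main keys *)

Section KeyValues.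

Variables (L : splittingFieldType rat) (R : realType) (nrm : L -> R).
Variables (V : nat -> L -> Prop).
Hypothesis hN : absolute_value nrm.
Hypothesis hV : forall p, prime p -> valuation_ring p (V p).
Local Notation G := (gal_of {:L}).

Variables (d X : nat) (rt : {poly int} -> L) (fsF : {poly int} -> seq {poly int}).
Variables (al : L) (S : seq {poly int}).
Hypothesis alX : nrm al <= X%:R.
Hypothesis fam : forall A, A \in S -> in_family nrm d rt fsF al A.
Hypothesis d0 : (0 < d)%N.

Local Notation B := (base d X).
Variables (W T : nat).
Hypothesis WB : (B ^ (d.+1 * d`! + 2 ^ d) <= W)%N.
Hypothesis TW : forall m : nat, (0 < m <= W)%N -> (size (divisors m) <= T)%N.

Local Notation ncf := (ncoef nrm rt).
Local Notation ptn f := (pat nrm rt f).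
Local Notation mkey := (main_key nrm d rt fsF).
Local Notation fac := (factor_of fsF).
Local Notation bdeg := (block_deg nrm rt).

(** N is the absolute value of the norm of [al]. None of the at most 2^d conjugates exceeds [al] in
    absolute value, whence N <= X^(2^d). *)
Lemma al_norm A : A \in S -> exists N : nat, [/\ (0 < N)%N, (N <= W)%N &
  forall A' f, A' \in S -> f \in fsF A' ->
    (ptn f != [set: G] -> (`|lead_coef f| %| N)%N) /\ (ptn f != finset.set0 ->
      (`|(f`_0)%R| %| N)%N)].
Proof.
move=> AS; have [rs As Da] := fam_outer (fam AS); have A0 := fam_neq0 (fam AS).
have [N DN] := outer_norm_int nrm hV A0 As; rewrite Da in DN.
have al0 : al != 0 by rewrite -Da (outer_neq0 hN).
have N0 := norm_neq0 DN al0.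
exists `|N|%N; split; first by rewrite absz_gt0.
  have X0 := fam_X_gt0 hN alX (fam AS).
  apply: leq_trans (_ : X ^ 2 ^ d <= _)%N.
    rewrite -(ler_nat R) natr_absz -(nrm_int hN) -DN (nrm_prod hN).
    apply: le_trans (_ : \prod_(x <- conj_seq al) (X%:R : R) <= _).
      rewrite big_seq [leRHS]big_seq; apply: ler_prod => x /conj_seqP [s ->].
      rewrite (nrm_ge0 hN) /=; apply: le_trans alX; rewrite -Da.
      exact: (outer_gal_le hN A0 As).
    rewrite big_const_seq count_predT iter_mulr_1 natrX; apply: ler_weXn2l;
      first by rewrite ler1n.
    have := al_conj fam AS; rewrite prednK // expn_gt0 //.
  apply: leq_trans WB; apply: leq_trans (_ : B ^ 2 ^ d <= _)%N.
    by rewrite leq_exp2r ?expn_gt0 // /base leq_pmull ?expn_gt0.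
  by rewrite leq_pexp2l ?leq_addl // /base muln_gt0 expn_gt0.
move=> A' f AS' ff; have hf := fam_factor (fam AS') ff.
have [rs' As' Da'] := fam_outer (fam AS'); have A0' := fam_neq0 (fam AS').
have zrs := fam_rt_mem (fam AS') ff As'.
have DA := fam_dvd (fam AS') ff.
split=> nT.
  have := lead_dvd_norm hN hV DN A0' As' Da' DA zrs (fam_splits hf) nT.
  by rewrite dvdzE.
have := coef0_dvd_norm hN hV DN A0' As' Da' DA zrs (fam_splits hf) nT.
by rewrite dvdzE.
Qed.

Lemma finfun_inj (aT : finType) (rT : Type) (g h : aT -> rT) :
  finfun g = finfun h -> forall x, g x = h x.
Proof. by move=> e x; have := congr1 (fun u : {ffun aT -> rT} => u x) e; rewrite !ffunE. Qed.

Lemma main_key_eq A A' : A \in S -> A' \in S -> size (fsF A) = size (fsF A') ->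
  (forall i, (i < size (fsF A))%N -> lead_coef (fac A i) = lead_coef (fac A' i) /\
     forall j, (j <= d)%N -> ncf (fac A i) j = ncf (fac A' i) j) -> mkey A = mkey A'.
Proof.
move=> AS AS' es h; apply/ffunP => i; rewrite !ffunE -es; case: ifP => // li.
have [-> hn] := h i li; congr (_, _); apply/ffunP => j; rewrite !ffunE.
by apply: hn; rewrite -ltnS.
Qed.

Section Slots.

Variable e : nat.
Hypothesis be : forall A f, A \in S -> f \in fsF A -> (bdeg f <= e)%N.

(** The integers of size up to M that remain after one has been read off as a divisor of the norm,
    namely [yval]. For the full pattern that divisor is the constant coefficient, and the indices 1
    to e remain. Otherwise it is the leading coefficient, and the indices 0 to e - 1 remain. *)
Definition xval A i m : int := if (i < size (fsF A))%N then
  (if ptn (fac A i) == [set: G] then ncf (fac A i) m.+1 else ncf (fac A i) m) else 0.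
Definition yval A i : int :=
  if ptn (fac A i) == [set: G] then (fac A i)`_0 else lead_coef (fac A i).
(** All factors share one slot for each m. The Mahler measure being multiplicative, the slot is at
    most a constant times X, and every nonzero [xval] divides it. Hence e integers of size X and
    some divisor indices suffice, however many factors there are. *)
Definition slot A m : nat := (\prod_(i < d) maxn 1 `|xval A i m|)%N.
(** There are at most d factors, and each contributes 2^d besides its measure. *)
Definition slot_bound : nat := (2 ^ (d * d) * X)%N.

Lemma slot_gt0 A m : (0 < slot A m)%N.
Proof. by apply: prodn_gt0 => i; rewrite leq_max. Qed.

Lemma slot_le A m : A \in S -> (slot A m <= slot_bound)%N.
Proof.
move=> AS; have sd := fam_size_factors (fam AS).
have -> : slot A m = (\prod_(i < size (fsF A)) maxn 1 `|xval A i m|)%N.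
  rewrite (big_ord_widen _ (fun i => maxn 1 `|xval A i m|%N) sd) /= /slot.
  rewrite [LHS](bigID (fun i : 'I_d => (i < size (fsF A))%N)) /=
    [X in (_ * X)%N]big1 ?muln1 // => i.
  by rewrite /xval => /negbTE ->.
rewrite -(ler_nat R) natr_prod.
have le1 (i : 'I_(size (fsF A))) : (maxn 1 `|xval A i m|%N)%:R <= 2 ^+ d * msr nrm rt (fac A i).
  have ff : fac A i \in fsF A by apply: factor_of_mem.
  have m1 := msr_ge1 nrm (fam_factor (fam AS) ff).
  have bd j := fam_ncoef_msr hN hV j (fam AS) ff.
  have : `|xval A i m|%:R <= 2 ^+ d * msr nrm rt (fac A i).
    by rewrite /xval ltn_ord natr_absz; case: ifP => _; apply: bd.
  have : (1 : R) <= 2 ^+ d * msr nrm rt (fac A i).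
    by rewrite -[leLHS]mulr1; apply: ler_pM => //; apply: exprn_ege1; rewrite ler1n.
  by rewrite /maxn; case: ifP.
apply: le_trans (_ : \prod_(i < size (fsF A)) (2 ^+ d * msr nrm rt (fac A i)) <= _).
  by apply: ler_prod => i _; rewrite ler0n le1.
rewrite big_split /= prodr_const card_ord.
have -> : \prod_(i < size (fsF A)) msr nrm rt (fac A i) = nrm al.
  by rewrite -(fam_msr hN (fam AS)) (big_nth 0) big_mkord.
rewrite /slot_bound natrM natrX exprM; apply: ler_pM;
  [by rewrite -!exprM exprn_ge0 | exact: (nrm_ge0 hN) | | exact: alX].
rewrite -!exprM; apply: ler_weXn2l; first by rewrite ler1n.
by rewrite leq_mul2l sd orbT.
Qed.

Lemma slot_bound_le_W A : A \in S -> (slot_bound <= W)%N.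
Proof.
move=> AS; have X0 := fam_X_gt0 hN alX (fam AS).
apply: leq_trans WB; apply: leq_trans (_ : B ^ d <= _)%N.
  rewrite /slot_bound /base expnMn -expnM leq_mul //.
  by rewrite -{1}(expn1 X) leq_pexp2l.
rewrite leq_pexp2l ?muln_gt0 ?expn_gt0 //.
by apply: leq_trans (leq_addr _ _); apply: leq_trans (leqnSn d) _; rewrite leq_pmulr // fact_gt0.
Qed.

Section Code.

Variable N : nat.

Definition code1 A (i : 'I_d) : bool * bool * 'I_d.+1 * (bool * 'I_T.+1) :=
  ((i < size (fsF A))%N, ptn (fac A i) == [set: G], inord (bdeg (fac A i)),
    div_code T N (yval A i)).
Definition code2 A (m : 'I_e) : 'I_slot_bound.+1 := inord (slot A m).
(** The value 0 is flagged separately and replaced by 1, so that the coded integer always divides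
    the slot. *)
Definition code3 A (u : 'I_e * 'I_d) : bool * (bool * 'I_T.+1) :=
  (xval A u.2 u.1 == 0, div_code T (slot A u.1) (if xval A u.2 u.1 ==
    0 then 1 else xval A u.2 u.1)).

Definition slot_type : finType :=
  ({ffun 'I_d -> bool * bool * 'I_d.+1 * (bool * 'I_T.+1)} * {ffun 'I_e -> 'I_slot_bound.+1}
   * {ffun 'I_e * 'I_d -> bool * (bool * 'I_T.+1)})%type.

Definition slot_code A : slot_type := (finfun (code1 A), finfun (code2 A), finfun (code3 A)).

Hypotheses (N0 : (0 < N)%N) (NW : (N <= W)%N).
Hypothesis Ndvd : forall A' f, A' \in S -> f \in fsF A' ->
    (ptn f != [set: G] -> (`|lead_coef f| %| N)%N) /\ (ptn f != finset.set0 ->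
      (`|(f`_0)%R| %| N)%N).

(** The block degree, which is part of the code, tells at which index the leading coefficient of f
    stands and beyond which index the entries vanish. This settles every index not covered by [xval]
    and [yval]. *)
Lemma slot_code_inj : {in S &, forall A A', slot_code A = slot_code A' -> mkey A = mkey A'}.
Proof.
move=> A A' AS AS' ec.
have e1 := finfun_inj (congr1 (fun u : slot_type => u.1.1) ec).
have e2 := finfun_inj (congr1 (fun u : slot_type => u.1.2) ec).
have e3 := finfun_inj (congr1 (fun u : slot_type => u.2) ec).
have es : size (fsF A) = size (fsF A').
  have sub A1 A2 : A1 \in S -> (forall i : 'I_d, (i < size (fsF A1))%N = (i < size (fsF A2))%N) ->
      (size (fsF A1) <= size (fsF A2))%N.
    move=> AS1 h; rewrite leqNgt; apply/negP => lt.
    have ld : (size (fsF A2) < d)%N by apply: leq_trans lt (fam_size_factors (fam AS1)).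
    by have := h (Ordinal ld); rewrite /= lt ltnn.
  have h i := congr1 (fun u : bool * bool * 'I_d.+1 * (bool * 'I_T.+1) => u.1.1.1) (e1 i).
  by apply/eqP; rewrite eqn_leq !sub // => i; apply/esym/h.
have ex i m : (i < size (fsF A))%N -> (m < e)%N -> xval A i m = xval A' i m.
  move=> li lm; have ld : (i < d)%N by apply: leq_trans li (fam_size_factors (fam AS)).
  have es_ : slot A m = slot A' m.
    have := congr1 (@nat_of_ord _) (e2 (Ordinal lm)).
    by rewrite /code2 !inordK ?ltnS ?slot_le.
  have := e3 (Ordinal lm, Ordinal ld) => e3'.
  have z := congr1 (fun u : bool * (bool * 'I_T.+1) => u.1) e3'.
  have := congr1 (fun u : bool * (bool * 'I_T.+1) => u.2) e3'.
  rewrite /code3 /= in z *; rewrite -es_ -z.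
  case: eqP z => [-> /esym/eqP -> //|x0 z]; apply: div_code_inj; first exact: slot_gt0.
  - by apply: TW; rewrite slot_gt0 (leq_trans (slot_le _ AS)) ?(slot_bound_le_W AS).
  - rewrite /slot (bigD1 (Ordinal ld)) //=; apply: dvdn_mulr.
    by rewrite (maxn_idPr _) // absz_gt0; apply/eqP.
  - rewrite es_ /slot (bigD1 (Ordinal ld)) //=; apply: dvdn_mulr.
    by rewrite (maxn_idPr _) // absz_gt0 -z.
apply: main_key_eq => // i li.
have ld : (i < d)%N by apply: leq_trans li (fam_size_factors (fam AS)).
have li' := li; rewrite es in li'.
have ff := factor_of_mem li; have ff' := factor_of_mem li'.
have hf := fam_factor (fam AS) ff; have hf' := fam_factor (fam AS') ff'.
have e1' := e1 (Ordinal ld).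
have full := congr1 (fun u : bool * bool * 'I_d.+1 * (bool * 'I_T.+1) => u.1.1.2) e1'.
have deg := congr1 (fun u : bool * bool * 'I_d.+1 * (bool * 'I_T.+1) => nat_of_ord u.1.2) e1'.
have dv := congr1 (fun u : bool * bool * 'I_d.+1 * (bool * 'I_T.+1) => u.2) e1'.
rewrite /code1 /= in full deg dv.
have bd f : is_factor d rt f -> (bdeg f < d.+1)%N.
  move=> hff; rewrite ltnS; apply: leq_trans (count_size _ _) _.
  by rewrite -ltnS (size_roots_of hff); case: hff.
rewrite !inordK ?bd // in deg.
have ey : yval A i = yval A' i.
  have yN A1 : A1 \in S -> (i < size (fsF A1))%N -> (`|yval A1 i| %| N)%N.
    move=> AS1 l1; have [h1 h2] := Ndvd AS1 (factor_of_mem l1).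
    rewrite /yval; case: eqP => [fl|/eqP nfl]; last exact: h1.
    apply: h2; rewrite fl; apply/set0Pn; exists 1%g; by rewrite inE.
  by apply: div_code_inj dv => //; [apply: TW; rewrite N0 | apply: yN | apply: yN].
have xeq m : (m < e)%N -> _ := ex i m li.
rewrite /xval li li' in xeq; rewrite /yval in ey.
have b1 : (0 < bdeg (fac A i))%N by apply: block_deg_gt0.
have le_b := be AS ff; have le_b' := be AS' ff'.
case: eqP full xeq ey => [fl|nfl] full; rewrite -full => xeq ey; last first.
  split=> // j lj; have [lt|ge] := ltnP j e; first exact: xeq.
  have [bj|bj] := eqVneq j (bdeg (fac A i)).
    by rewrite bj (ncoef_lead nrm hV hf) deg (ncoef_lead nrm hV hf').
  rewrite (ncoef_large hV hf) ?(ncoef_large hV hf') //.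
    by rewrite -deg ltn_neqAle eq_sym bj (leq_trans le_b).
  by rewrite ltn_neqAle eq_sym bj (leq_trans le_b).
have ncj j : (j <= d)%N -> ncf (fac A i) j = ncf (fac A' i) j.
  case: j => [|j] lj; first by rewrite (ncoef_0 nrm hV hf) (ncoef_0 nrm hV hf').
  have [lt|ge] := ltnP j e; first exact: xeq.
  by rewrite (ncoef_large hV hf) ?(ncoef_large hV hf') // ltnS (leq_trans _ ge).
split=> //; rewrite -(ncoef_lead nrm hV hf) -(ncoef_lead nrm hV hf') -deg.
by apply: ncj; rewrite -ltnS bd.
Qed.

End Code.

Lemma slot_values : (size (undup (map mkey S)) <= #|slot_type|)%N.
Proof.
case ES : S => [|A0 S'].
  rewrite /=; apply: leq0n.
have AS : A0 \in S by rewrite ES mem_head.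
have [N [N0 NW Nd]] := al_norm AS.
rewrite -ES; exact: (size_undup_factor (slot_code_inj N0 NW Nd)).
Qed.

End Slots.

Section Injective.

Hypothesis inj1 : forall A, A \in S -> [/\ fsF A = [:: A], bdeg A = 1%N,
   ptn A != [set: G] & ptn A != finset.set0].

(** With blocks of degree 1 the key consists of the constant and the leading coefficient. The
    pattern being neither empty nor full, both divide the norm of [al], so no slot of size X is
    needed. *)
Lemma injective_values :
  (size (undup (map mkey S)) <= #|{: (bool * 'I_T.+1) * (bool * 'I_T.+1)}|)%N.
Proof.
case ES : S => [|A0 S']; first exact: leq0n.
have AS0 : A0 \in S by rewrite ES mem_head.
have [N [N0 NW Nd]] := al_norm AS0; rewrite -ES.
apply: (size_undup_factor (c := fun A : {poly int} =>
  (div_code T N (lead_coef A), div_code T N A`_0))).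
move=> A A' AS AS' ec; have [eA bA fA zA] := inj1 AS; have [eA' bA' fA' zA'] := inj1 AS'.
have mA : A \in fsF A by rewrite eA mem_head.
have mA' : A' \in fsF A' by rewrite eA' mem_head.
have hf := fam_factor (fam AS) mA; have hf' := fam_factor (fam AS') mA'.
have [h1 h2] := Nd A A AS mA; have [h1' h2'] := Nd A' A' AS' mA'.
have TN : (size (divisors N) <= T)%N by apply: TW; rewrite N0.
have el : lead_coef A = lead_coef A'.
  apply: (div_code_inj N0 TN (h1 fA) (h1' fA')); exact: (congr1 fst ec).
have e0 : A`_0 = A'`_0.
  apply: (div_code_inj N0 TN (h2 zA) (h2' zA')); exact: (congr1 snd ec).
apply: main_key_eq => //; first by rewrite eA eA'.
rewrite eA /factor_of eA eA' => -[|//] _ /=; split=> // -[|[|j]] _.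
- by rewrite (ncoef_0 nrm hV hf) (ncoef_0 nrm hV hf').
- by rewrite -[in LHS]bA -bA' (ncoef_lead nrm hV hf) (ncoef_lead nrm hV hf').
- by rewrite (ncoef_large hV hf) ?bA // (ncoef_large hV hf') ?bA'.
Qed.

End Injective.

End KeyValues.

(** * Bounds for families of polynomials with equal outer product *)

Section DivisorBound.

(** For q = n %/ r one has n + 1 <= r (q + 1) <= r 2^q. *)
Lemma succn_exp_bound (r n : nat) : (0 < r)%N -> (n.+1 ^ r <= r ^ r * 2 ^ n)%N.
Proof.
move=> r0; rewrite {1 2}(divn_eq n r).
have lt := ltn_pmod n r0.
apply: leq_trans (_ : (r * 2 ^ (n %/ r)) ^ r <= _)%N.
  rewrite leq_exp2r //; apply: leq_trans (_ : r * (n %/ r).+1 <= _)%N; first by lia.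
  by rewrite leq_mul2l ltn_expl ?orbT.
by rewrite expnMn -expnM leq_mul2l leq_pexp2l ?leq_addr // orbT.
Qed.

Definition tau n := size (divisors n).

Lemma tau_coprime_part p n : prime p -> (0 < n)%N ->
  (tau n <= (logn p n).+1 * tau (n %/ p ^ logn p n))%N.
Proof.
move=> pr n0; set e := logn p n; set m := (n %/ p ^ e)%N.
have pe : (p ^ e %| n)%N by apply: pfactor_dvdnn.
have m0 : (0 < m)%N by rewrite divn_gt0 ?expn_gt0 ?prime_gt0 // dvdn_leq.
have Dn : n = (p ^ e * m)%N by rewrite mulnC divnK.
have pm : coprime p m.
  rewrite prime_coprime //; apply/negP => pm.
  have : (p ^ e.+1 %| n)%N by rewrite Dn expnSr dvdn_mul.
  by rewrite pfactor_dvdn // ltnn.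
rewrite /tau -[(e.+1 * _)%N]/(muln _ _).
have -> : (e.+1 * size (divisors m))%N = size [seq (p ^ i * x)%N | i <- iota 0 e.+1,
  x <- divisors m].
  by rewrite size_allpairs size_iota.
apply: uniq_leq_size; first exact: divisors_uniq.
move=> x; rewrite -dvdn_divisors // => xn.
have x0 : (0 < x)%N by apply: dvdn_gt0 xn.
apply/allpairsP; exists (logn p x, x %/ p ^ logn p x)%N; split.
- by rewrite mem_iota add0n /= ltnS dvdn_leq_log.
- have px : (p ^ logn p x %| x)%N by apply: pfactor_dvdnn.
  have cx : coprime (x %/ p ^ logn p x) (p ^ e).
    rewrite coprime_sym coprimeXl // prime_coprime //; apply/negP => pd.
    have : (p ^ (logn p x).+1 %| x)%N.
      by rewrite -{2}(divnK px) mulnC expnSr dvdn_mul.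
    by rewrite pfactor_dvdn // ltnn.
  rewrite -dvdn_divisors // -(Gauss_dvdr _ cx) -Dn.
  by apply: dvdn_trans xn; apply/dvdnP; exists (p ^ logn p x)%N; rewrite mulnC divnK.
by rewrite /= mulnC divnK // pfactor_dvdnn.
Qed.

(** A prime power p^e contributes (e + 1)^r <= 2^(e r) <= p^e. *)
Lemma tau_bound_large_primes (r n : nat) : (0 < n)%N ->
  (forall p, prime p -> (p %| n)%N -> (2 ^ r <= p)%N) -> (tau n ^ r <= n)%N.
Proof.
have [m] := ubnP n; elim: m n => // m IH n lt n0 hp.
have [n1|n1] := leqP n 1.
  by have -> : n = 1%N by [lia]; rewrite /tau /= exp1n.
have pr := pdiv_prime n1; have pn := pdiv_dvd n; set p := pdiv n in pr pn.
set e := logn p n; set q := (n %/ p ^ e)%N.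
have pe : (p ^ e %| n)%N by apply: pfactor_dvdnn.
have Dn : n = (p ^ e * q)%N by rewrite mulnC divnK.
have e0 : (0 < e)%N by rewrite logn_gt0 mem_primes pr n0.
have q0 : (0 < q)%N by rewrite divn_gt0 ?expn_gt0 ?prime_gt0 // dvdn_leq.
have lq : (q < n)%N by rewrite ltn_Pdiv // -(expn0 p) ltn_exp2l // prime_gt1.
apply: leq_trans (_ : (e.+1 * tau q) ^ r <= _)%N.
  case: (r) => // r'; rewrite leq_exp2r //; exact: tau_coprime_part.
rewrite {1}Dn expnMn leq_mul //; last first.
  apply: IH => //; first by lia.
  by move=> l lpr lq'; apply: hp => //; rewrite Dn dvdn_mull.
apply: leq_trans (_ : (2 ^ e) ^ r <= _)%N.
  by case: (r) => // r'; rewrite leq_exp2r // ltn_expl.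
rewrite -expnM mulnC expnM leq_exp2r //; exact: hp.
Qed.

(** Only primes below 2^r violate the bound with constant 1, and each costs a factor r^r by
    [succn_exp_bound]. The induction lowers the least admissible prime from 2^r to 0. *)
Lemma tau_bound (r : nat) : (0 < r)%N -> exists C : nat, (0 < C)%N /\
  forall n, (0 < n)%N -> (tau n ^ r <= C * n)%N.
Proof.
move=> r0.
suff H k : exists C : nat, (0 < C)%N /\ forall n, (0 < n)%N ->
    (forall p, prime p -> (p %| n)%N -> (2 ^ r - k <= p)%N) -> (tau n ^ r <= C * n)%N.
  have [C [C0 HC]] := H (2 ^ r)%N; exists C; split=> // n n0; apply: HC => // p _ _.
  by rewrite subnn.
elim: k => [|k [C [C0 HC]]].
  exists 1%N; split=> // n n0 hp; rewrite mul1n; apply: tau_bound_large_primes => // p pr pn.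
  by rewrite -[(2 ^ r)%N]subn0; apply: hp.
exists (r ^ r * C)%N; split; first by rewrite muln_gt0 expn_gt0 r0.
move=> n n0 hp; set p := (2 ^ r - k.+1)%N.
have [/andP[pr pn]|npn] := boolP (prime p && (p %| n)%N); last first.
  apply: leq_trans (HC n n0 _) _.
    move=> l lpr ln; have := hp l lpr ln; rewrite -/p leq_eqVlt => /orP[/eqP pl|];
      last by rewrite /p subnS; case: (2 ^ r - k)%N.
    by rewrite -pl in lpr ln; rewrite lpr ln in npn.
  by rewrite leq_mul2r leq_pmull ?orbT // expn_gt0 r0.
set e := logn p n; set q := (n %/ p ^ e)%N.
have pe : (p ^ e %| n)%N by apply: pfactor_dvdnn.
have Dn : n = (p ^ e * q)%N by rewrite mulnC divnK.
have q0 : (0 < q)%N by rewrite divn_gt0 ?expn_gt0 ?prime_gt0 // dvdn_leq.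
have pq : ~~ (p %| q)%N.
  apply/negP => pq; have : (p ^ e.+1 %| n)%N by rewrite Dn expnSr dvdn_mul.
  by rewrite pfactor_dvdn // ltnn.
apply: leq_trans (_ : (e.+1 * tau q) ^ r <= _)%N.
  by rewrite leq_exp2r //; exact: tau_coprime_part.
rewrite {1}Dn expnMn.
have -> : (r ^ r * C * (p ^ e * q) = (r ^ r * p ^ e) * (C * q))%N by lia.
apply: leq_mul.
  apply: leq_trans (succn_exp_bound e r0) _; rewrite leq_mul2l; apply/orP; right.
  by case: (e) => // e'; rewrite leq_exp2r // prime_gt1.
apply: HC => // l lpr lq.
have ln : (l %| n)%N by rewrite Dn dvdn_mull.
have := hp l lpr ln; rewrite -/p leq_eqVlt => /orP[/eqP pl|]; last by rewrite /p subnS;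
  case: (2 ^ r - k)%N.
by rewrite -pl (negPf pq) in lq.
Qed.

(* Products of divisor-function values and logarithms of polynomially bounded
   numbers grow slower than any power. *)
Lemma subpolynomial (d K m : nat) : (0 < K)%N -> (0 < m)%N -> exists C : nat, (0 < C)%N /\
  forall X, (0 < X)%N -> exists T : nat,
    (forall n : nat, (0 < n <= (2 ^ d * X) ^ K)%N -> (tau n <= T)%N) /\
    (((trunc_log 2 ((2 ^ d * X) ^ K)).+1 * T.+1) ^ m <= C * X)%N.
Proof.
(* The factor K undoes the K-th power in W. The factor 2 bounds the 2m-th powers of the logarithm
   and of T by a constant times X each, so that the m-th power of their product is again at most a
   constant times X. *)
move=> K0 m0; have [r Dr r0] : exists2 r, r = (2 * m * K)%N & (0 < r)%N.
  by eexists; first reflexivity; rewrite !muln_gt0 m0 K0.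
have [C1 [C10 HC1]] := tau_bound r0.
have root1 (a b C : nat) : (0 < C)%N -> (a ^ K <= C * b ^ K)%N -> (a <= C * b)%N.
  move=> C0 h; rewrite -(leq_exp2r _ _ K0); apply: leq_trans h _; rewrite expnMn leq_mul2r.
  by rewrite -{1}(expn1 C) leq_pexp2l // orbT.
exists ((2 ^ (2 * m) * C1 * 2 ^ d) * (r ^ r * 2 ^ d))%N; split.
  by rewrite !muln_gt0 !expn_gt0 C10 r0.
move=> X X0; set W := ((2 ^ d * X) ^ K)%N.
have W0 : (0 < W)%N by rewrite expn_gt0 muln_gt0 expn_gt0 X0.
exists (\max_(n < W.+1 | (0 < n)%N) tau n); set T := \max_(_ < _ | _) _.
split=> [n /andP[n0 nW]|].
  have lt : (n < W.+1)%N by [].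
  exact: (@leq_bigmax_cond _ (fun n : 'I_W.+1 => (0 < n)%N) (fun n => tau n) (Ordinal lt)).
have TW : (T.+1 ^ (2 * m) <= 2 ^ (2 * m) * C1 * (2 ^ d * X))%N.
  rewrite -mulnA.
  have T1 : (0 < T)%N.
    have lt : (1 < W.+1)%N by [].
    by apply: leq_trans (@leq_bigmax_cond _ (fun n : 'I_W.+1 => (0 < n)%N) (fun n => tau n)
      (Ordinal lt) isT).
  apply: leq_trans (_ : (2 * T) ^ (2 * m) <= _)%N; first by rewrite leq_exp2r; [lia | lia].
  rewrite expnMn leq_mul2l; apply/orP; right; apply: root1 => //; rewrite -/W -expnM -Dr.
  have [] : (T ^ r <= C1 * W)%N; last by [].
  have [n n0 ->] : exists2 n : 'I_W.+1, (0 < n)%N & T = tau n.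
    have lt : (1 < W.+1)%N by [].
    have c0 : (0 < #|fun n : 'I_W.+1 => (0 < n)%N|)%N by apply/card_gt0P; exists (Ordinal lt).
    by have [n n0 Tn] := eq_bigmax_cond (fun n : 'I_W.+1 => tau n) c0; exists n.
  apply: leq_trans (HC1 n n0) _; rewrite leq_mul2l -ltnS ltn_ord orbT //.
have LW : ((trunc_log 2 W).+1 ^ (2 * m) <= r ^ r * (2 ^ d * X))%N.
  apply: root1; first by rewrite expn_gt0 r0.
  rewrite -expnM -Dr -/W; apply: leq_trans (succn_exp_bound _ r0) _.
  by rewrite leq_mul2l trunc_logP ?orbT.
rewrite -(leq_exp2r _ _ (isT : 0 < 2)%N) -expnM [(m * 2)%N]mulnC expnMn.
apply: leq_trans (leq_mul LW TW) _.
set c1 := (2 ^ (2 * m) * C1)%N; set c2 := (2 ^ d)%N; set c3 := (r ^ r)%N.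
have c10 : (0 < c1)%N by rewrite muln_gt0 expn_gt0 C10.
have c20 : (0 < c2)%N by rewrite expn_gt0.
have c30 : (0 < c3)%N by rewrite expn_gt0 r0.
have -> : (c3 * (c2 * X) * (c1 * (c2 * X)) =
  (c1 * c2 * (c3 * c2)) * X ^ 2)%N by rewrite expnS expn1; nia.
rewrite expnMn leq_mul2r; apply/orP; right.
have c0 : (0 < c1 * c2 * (c3 * c2))%N.
  by move: c1 c2 c3 c10 c20 c30 {TW LW} => c1 c2 c3 c10 c20 c30; rewrite !muln_gt0 c10 c20 c30.
by rewrite -{1}(expn1 (c1 * c2 * (c3 * c2))%N) leq_pexp2l.
Qed.

End DivisorBound.

Section FamilyBounds.

Lemma leq_exp2rW (a b n : nat) : (a <= b)%N -> (a ^ n <= b ^ n)%N.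
Proof. by case: n => // n; rewrite leq_exp2r. Qed.

Lemma card_setsT (T : finType) : #|{set T}| = (2 ^ #|T|)%N.
Proof.
rewrite -(cardsT T) -card_powerset -cardsT; congr #|pred_of_set _|.
by apply/setP => A; rewrite inE powersetE finset.subsetT.
Qed.

(** The first term bounds the integers (|l|^d |n|)^(d!) whose divisors are indexed, the second the
    norm of [al], a product of at most 2^d conjugates. *)
Definition height_exp d := (d.+1 * d`! + 2 ^ d)%N.

Lemma height_exp_gt0 d : (0 < height_exp d)%N.
Proof. by rewrite addn_gt0 expn_gt0 orbT. Qed.

Lemma card_small_type d W T :
  #|{ffun 'I_d -> small_type d W T}| =
    ((2 ^ (2 ^ d) * ((trunc_log 2 W).+1 * T.+1) ^ (d * d.+1)) ^ d)%N.
Proof.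
rewrite card_ffun card_ord /small_type card_prod card_setsT card_ord prednK ?expn_gt0 //.
by rewrite card_ffun !card_prod !card_ord.
Qed.

Lemma card_slot_type d X T e :
  #|slot_type d X T e| =
    ((2 * 2 * d.+1 * (2 * T.+1)) ^ d * (slot_bound d X).+1 ^ e * (2 * (2 * T.+1)) ^ (e * d))%N.
Proof. by rewrite /slot_type !card_prod !card_ffun !card_prod !card_ord !card_bool. Qed.

(** The e slots give X^e. Every other factor is a constant or a power of the logarithm and of T; in
    the r-th power all of these together cost one more X. *)
Lemma slot_family_bound (d e r : nat) : (0 < d)%N -> (0 < r)%N ->
  exists C : nat, (0 < C)%N /\
  forall (L : splittingFieldType rat) (R : realType) (nrm : L -> R) (V : nat -> L -> Prop)
    (X : nat) (rt : {poly int} -> L) (fsF : {poly int} -> seq {poly int}) (al : L)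
    (S : seq {poly int}),
  absolute_value nrm -> (forall p, prime p -> valuation_ring p (V p)) ->
  nrm al <= X%:R -> uniq S -> (forall A, A \in S -> in_family nrm d rt fsF al A) ->
  (forall A f, A \in S -> f \in fsF A -> (block_deg nrm rt f <= e)%N) ->
  (size S ^ r <= C * X ^ (e * r).+1)%N.
Proof.
(* The exponent of the product of logarithm and T: the first term comes from the small keys, the
   others from the divisor indices in [code1] and [code3]. *)
move=> d0 r0; set a := (d * d.+1 * d + d + e * d)%N.
have a0 : (0 < a)%N by rewrite /a; lia.
have ar0 : (0 < a * r)%N by rewrite muln_gt0 a0.
have [C1 [C10 HC1]] := subpolynomial d (height_exp_gt0 d) ar0.
pose c := (key_bound d ^ d * (2 ^ (2 ^ d)) ^ d * (2 * 2 * d.+1 * 2) ^ d * (2 * 2) ^ (e * d)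
   * (2 ^ (d * d).+1) ^ e)%N.
have c0 : (0 < c)%N.
  have k0 : (0 < key_bound d)%N by rewrite /key_bound expn_gt0.
  by rewrite /c; move: (key_bound d) k0 => kb k0; rewrite !muln_gt0 !expn_gt0 k0.
exists (c ^ r * C1)%N; split; first by rewrite muln_gt0 expn_gt0 c0.
move=> L R nrm V X rt fsF al S hN hV alX uS fam be.
case ES : S => [|A S']; first by rewrite exp0n.
have AS : A \in S by rewrite ES mem_head.
have X0 := fam_X_gt0 hN alX (fam A AS).
rewrite -ES; have [T [TW QX]] := HC1 X X0.
set W := ((2 ^ d * X) ^ height_exp d)%N in TW QX.
set Q := ((trunc_log 2 W).+1 * T.+1)%N in QX.
have TQ : (T.+1 <= Q)%N by rewrite /Q leq_pmull.
have h1 := family_size hN hV alX uS fam (leqnn _) TW.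
have h2 := slot_values hN hV alX fam d0 (leqnn _) TW be.
have {h1 h2} h : (size S <= c * Q ^ a * X ^ e)%N.
  apply: leq_trans (leq_trans h1 (leq_mul (leqnn _) h2)) _.
  rewrite card_small_type card_slot_type -/W -/Q.
  have Zb : ((slot_bound d X).+1 <= 2 ^ (d * d).+1 * X)%N.
    rewrite /slot_bound expnS -mulnA mul2n -addnn -addn1 leq_add2l muln_gt0 expn_gt0 X0 //.
  apply: leq_trans (_ : key_bound d ^ d * (2 ^ 2 ^ d * Q ^ (d * d.+1)) ^ d *
     ((2 * 2 * d.+1 * (2 * Q)) ^ d * (2 ^ (d * d).+1 * X) ^ e * (2 * (2 * Q)) ^ (e * d)) <= _)%N.
    rewrite leq_mul2l; apply/orP; right; apply: leq_mul; last first.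
      by apply: leq_exp2rW; rewrite !leq_mul2l TQ.
    apply: leq_mul; apply: leq_exp2rW => //.
    by rewrite !leq_mul2l TQ !orbT.
  rewrite /c /a; move: (key_bound d) (Q) (X) => kb q x.
  rewrite 2!expnD !(expnMn _ _ d) !(expnMn _ _ e) !(expnMn _ _ (e * d)) -!expnM.
  move: (2 ^ (2 ^ d * d))%N (2 ^ ((d * d).+1 * e))%N (2 ^ (e * d))%N (2 ^ d)%N => u1 u2 u3 u4.
  move: (kb ^ _)%N (q ^ (d * _ * _))%N (q ^ (e * d))%N (q ^ d)%N (x ^ e)%N (d.+1 ^ d)%N => k1
    k2 k3 k4 k5 k6.
  by rewrite leq_eqVlt; apply/orP; left; apply/eqP; ring.
apply: leq_trans (leq_exp2rW r h) _.
move: (c) (Q) QX => c' q QX; rewrite !expnMn -!expnM expnS.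
apply: leq_trans (_ : c' ^ r * (C1 * X) * X ^ (e * r) <= _)%N.
  by rewrite leq_mul2r leq_mul2l QX !orbT.
by rewrite leq_eqVlt; apply/orP; left; apply/eqP; ring.
Qed.

Lemma injective_family_bound (d r : nat) : (0 < d)%N -> (0 < r)%N ->
  exists C : nat, (0 < C)%N /\
  forall (L : splittingFieldType rat) (R : realType) (nrm : L -> R) (V : nat -> L -> Prop)
    (X : nat) (rt : {poly int} -> L) (fsF : {poly int} -> seq {poly int}) (al : L)
    (S : seq {poly int}),
  absolute_value nrm -> (forall p, prime p -> valuation_ring p (V p)) ->
  nrm al <= X%:R -> uniq S -> (forall A, A \in S -> in_family nrm d rt fsF al A) ->
  (forall A, A \in S -> [/\ fsF A = [:: A], block_deg nrm rt A = 1%N,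
     pat nrm rt A != [set: gal_of {:L}] & pat nrm rt A != finset.set0]) ->
  (size S ^ r <= C * X)%N.
Proof.
move=> d0 r0; set a := (d * d.+1 * d + 2)%N.
have ar0 : (0 < a * r)%N by rewrite muln_gt0 r0 andbT /a addn2.
have [C1 [C10 HC1]] := subpolynomial d (height_exp_gt0 d) ar0.
pose c := (key_bound d ^ d * (2 ^ (2 ^ d)) ^ d * 4)%N.
have c0 : (0 < c)%N.
  have k0 : (0 < key_bound d)%N by rewrite /key_bound expn_gt0.
  by rewrite /c; move: (key_bound d) k0 => kb k0; rewrite !muln_gt0 !expn_gt0 k0.
exists (c ^ r * C1)%N; split; first by rewrite muln_gt0 expn_gt0 c0.
move=> L R nrm V X rt fsF al S hN hV alX uS fam inj.
case ES : S => [|A S']; first by rewrite exp0n.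
have AS : A \in S by rewrite ES mem_head.
have X0 := fam_X_gt0 hN alX (fam A AS).
rewrite -ES; have [T [TW QX]] := HC1 X X0.
set W := ((2 ^ d * X) ^ height_exp d)%N in TW QX.
set Q := ((trunc_log 2 W).+1 * T.+1)%N in QX.
have TQ : (T.+1 <= Q)%N by rewrite /Q leq_pmull.
have h1 := family_size hN hV alX uS fam (leqnn _) TW.
have h2 := injective_values hN hV alX fam (leqnn _) TW inj.
have {h1 h2} h : (size S <= c * Q ^ a)%N.
  apply: leq_trans (leq_trans h1 (leq_mul (leqnn _) h2)) _.
  rewrite card_small_type -/W -/Q !card_prod card_bool card_ord.
  apply: leq_trans (_ : key_bound d ^ d * (2 ^ 2 ^ d * Q ^ (d * d.+1)) ^ d *
     (2 * Q * (2 * Q)) <= _)%N.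
    by rewrite leq_mul2l; apply/orP; right; apply: leq_mul; rewrite leq_mul2l TQ.
  rewrite /c /a; move: (key_bound d) (Q) => kb q.
  rewrite expnD !expnMn -!expnM.
  move: (kb ^ _)%N (2 ^ _)%N (q ^ (d * _ * _))%N => k1 k2 k3.
  by rewrite leq_eqVlt; apply/orP; left; apply/eqP; rewrite expnS expn1; ring.
apply: leq_trans (leq_exp2rW r h) _.
by move: (c) (Q) QX => c' q QX; rewrite expnMn -expnM -mulnA leq_mul2l QX orbT.
Qed.

End FamilyBounds.

(** * Polynomials of given Mahler measure *)

Section ComplexRoots.

Variable R : realType.
Local Notation C := R[i].
Local Notation cabs := (@cabs R).
Local Notation czeros := (@czeros R).

Lemma cabs_absolute_value : absolute_value cabs.
Proof.
split.
- exact: Normc.normcM.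
- exact: le_normcD.
- by move=> x; apply/eqP/eqP => [/Normc.eq0_normc //|->]; apply: Normc.normc0.
- move=> n; rewrite /cabs /Normc.normc.
  have -> : (n%:~R : C) = (n%:~R)%:C%C by rewrite rmorph_int.
  by rewrite /= expr0n addr0 sqrtr_sqr intr_norm.
Qed.

Lemma comp_absolute_value (L : fieldType) (iota : {rmorphism L -> C}) :
  absolute_value (cabs \o iota).
Proof.
have hC := cabs_absolute_value; split=> /=.
- by move=> x y /=; rewrite rmorphM (nrmM hC).
- by move=> x y; rewrite rmorphD (nrmD hC).
- by move=> x; rewrite (nrm_eq0 hC) fmorph_eq0.
- by move=> n; rewrite rmorph_int (nrm_int hC).
Qed.

Lemma czerosP (A : {poly int}) :
  map_poly (intr : int -> C) A = (lead_coef A)%:~R *: \prod_(z <- czeros A) ('X - z%:P).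
Proof.
rewrite /Defs.czeros; case: closed_field_poly_normal => r /= ->.
by rewrite lead_coef_map_inj //; apply: intr_inj.
Qed.

Lemma czeros_perm (A : {poly int}) (s : seq C) : A != 0 ->
  map_poly (intr : int -> C) A = (lead_coef A)%:~R *: \prod_(z <- s) ('X - z%:P) ->
  perm_eq (czeros A) s.
Proof.
move=> A0 e; apply: prod_XsubC_eq.
have l0 : (lead_coef A)%:~R != 0 :> C by rewrite intr_eq0 lead_coef_eq0.
by apply: (scalerI l0); rewrite -czerosP e.
Qed.

Lemma czeros_mul (A B : {poly int}) : A * B != 0 ->
  perm_eq (czeros (A * B)) (czeros A ++ czeros B).
Proof.
move=> AB0; apply: czeros_perm => //; rewrite big_cat /= rmorphM /= !czerosP.
by rewrite -scalerAl -scalerAr scalerA lead_coefM rmorphM.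
Qed.

Lemma size_czeros (A : {poly int}) : A != 0 -> (size (czeros A)).+1 = size A.
Proof.
move=> A0; have l0 : (lead_coef A)%:~R != 0 :> C by rewrite intr_eq0 lead_coef_eq0.
have := congr1 (fun p : {poly C} => size p) (czerosP A).
by rewrite size_scale // size_prod_XsubC size_map_inj_poly //; apply: intr_inj.
Qed.

Lemma mahler_mul (A B : {poly int}) : A * B != 0 -> mahler R (A * B) = mahler R A * mahler R B.
Proof.
move=> AB0; rewrite /mahler (perm_big _ (czeros_mul AB0)) big_cat /= lead_coefM normrM rmorphM.
by rewrite mulrACA.
Qed.

Lemma nzeros_mul (A B : {poly int}) : A * B != 0 ->
  nzeros_in_disk R (A * B) = (nzeros_in_disk R A + nzeros_in_disk R B)%N.
Proof. by move=> AB0; rewrite /nzeros_in_disk (seq.permP (czeros_mul AB0)) count_cat. Qed.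

Lemma coef_mahler (A : {poly int}) j :
  `|A`_j|%:~R <= 2 ^+ (size A).-1 * mahler R A.
Proof.
have hC := cabs_absolute_value; have [->|A0] := eqVneq A 0.
  rewrite coef0 normr0 mulr_ge0 // mulr_ge0 ?ler0z //.
  by apply: prodr_ge0 => z _; rewrite le_max ler01.
have -> : `|A`_j|%:~R = cabs (A`_j)%:~R by rewrite (nrm_int hC).
have -> : (A`_j)%:~R = (lead_coef A)%:~R * (\prod_(z <- czeros A) ('X - z%:P))`_j :> C.
  by rewrite -coefZ -czerosP coef_map.
rewrite (nrmM hC) (nrm_int hC) /mahler mulrCA; apply: ler_wpM2l; first by rewrite ler0z.
apply: le_trans (nrm_coef_prod_XsubC hC _ _) _.
by rewrite big_split /= big_const_seq count_predT iter_mulr_1 -size_czeros.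
Qed.

Lemma mahler_ge1 (A : {poly int}) : A != 0 -> 1 <= mahler R A.
Proof.
move=> A0; rewrite /mahler -[leLHS]mulr1; apply: ler_pM => //.
  by rewrite -[1]/(1%:~R) ler_int -gtz0_ge1 normr_gt0 lead_coef_eq0.
apply: (big_ind (fun y : R => 1 <= y)) => // [x y h1 h2|z _]; last by rewrite le_max lexx.
by rewrite -[leLHS]mulr1; apply: ler_pM.
Qed.

Definition couter (A : {poly int}) : C :=
  (lead_coef A)%:~R * \prod_(z <- czeros A | 1 <= cabs z) z.

Lemma czeros_conj (A : {poly int}) : A != 0 -> perm_eq (czeros A) (map (@conjc R) (czeros A)).
Proof.
move=> A0; apply: czeros_perm => //; rewrite big_map.
have := congr1 (map_poly (@conjc R)) (czerosP A); rewrite map_polyZ rmorph_int rmorph_prod /=.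
have -> : map_poly (@conjc R) (map_poly intr A) = map_poly intr A.
  by apply/polyP => i; rewrite !coef_map /= rmorph_int.
move=> ->; congr (_ *: _); apply: eq_bigr => z _.
by rewrite rmorphB /= map_polyX map_polyC.
Qed.

Lemma cabs_conj (z : C) : cabs (conjc z) = cabs z.
Proof. by case: z => a b; rewrite /Defs.cabs /= sqrrN. Qed.

(** Complex conjugation permutes the zeros and keeps their absolute values. *)
Lemma couter_real (A : {poly int}) : A != 0 -> exists x : R, couter A = x%:C%C.
Proof.
move=> A0; have : conjc (couter A) = couter A.
  rewrite /couter rmorphM rmorph_int rmorph_prod /=; congr (_ * _).
  rewrite [RHS](perm_big _ (czeros_conj A0)) /= big_map.
  by apply: eq_bigl => z; rewrite cabs_conj.
case: (couter A) => a b [] /eqP; rewrite eq_sym -addr_eq0 -mulr2n mulrn_eq0 /= => /eqP ->.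
by exists a.
Qed.

Lemma cabs_couter (A : {poly int}) : cabs (couter A) = mahler R A.
Proof.
have hC := cabs_absolute_value.
rewrite (nrmM hC) (nrm_int hC) (nrm_prod hC); congr (_ * _).
rewrite [RHS](bigID (fun z => 1 <= cabs z)) /= [X in _ = _ * X]big1 ?mulr1.
  by apply: eq_bigr => z oz; apply/esym/max_idPr.
by move=> z; rewrite -ltNge => iz; apply/max_idPl/ltW.
Qed.

Lemma couter_cases (A : {poly int}) : A != 0 ->
  couter A = (mahler R A)%:C%C \/ couter A = (- mahler R A)%:C%C.
Proof.
move=> A0; have [x Dx] := couter_real A0; have := cabs_couter A; rewrite Dx.
rewrite /Defs.cabs /= expr0n addr0 sqrtr_sqr => <-.
case: (boolP (0 <= x)) => x0; first by left; rewrite ger0_norm.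
by right; rewrite ltr0_norm ?opprK // ltNge.
Qed.

Lemma splits_dvd (L : splittingFieldType rat) (f g : {poly int}) (rs : seq L) :
  f * g != 0 -> splits (f * g) rs -> exists rf : seq L, splits f rf.
Proof.
move=> fg0 fgS; move: (fg0); rewrite mulf_eq0 negb_or => /andP[f0 g0].
have dv : map_poly (intr : int -> L) f %| \prod_(z <- rs) ('X - z%:P).
  rewrite -(dvdpZr _ _ (lead_intr_neq0 L fg0)) -fgS rmorphM; exact: dvdp_mulr.
have [m /eqpfP Dm] := dvdp_prod_XsubC dv; exists (mask m rs).
have lm : lead_coef (\prod_(z <- mask m rs) ('X - z%:P)) = 1 :> L.
  by apply/monicP; apply: monic_prod => z _; apply: monicXsubC.
have li : lead_coef (map_poly intr f) = (lead_coef f)%:~R :> L.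
  by rewrite lead_coef_map_eq // (lead_intr_neq0 L f0).
by rewrite /splits {1}Dm lm divr1 li.
Qed.

(** One field for the whole finite list, namely a splitting field of the product, lets the outer
    products be compared with each other. *)
Lemma common_splitting (S : seq {poly int}) : (forall A, A \in S -> A != 0) ->
  exists (L : splittingFieldType rat) (iota : {rmorphism L -> C}),
    forall A, A \in S -> exists rs : seq L, splits A rs.
Proof.
move=> S0; pose P := \prod_(A <- S) A.
have P0 : P != 0.
  by rewrite /P prodf_seq_neq0; apply/allP => A AS; rewrite S0.
have PQ0 : map_poly (intr : int -> rat) P != 0.
  by rewrite -size_poly_eq0 size_rat_int_poly size_poly_eq0.
have [L [iota [rs Drs]]] := @splitting_field_exists C _ PQ0.
exists L, iota => A AS.
have DP : P = A * \prod_(B <- rem A S) B by rewrite /P (perm_big _ (perm_to_rem AS)) big_cons.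
have PS : splits (A * \prod_(B <- rem A S) B) rs.
  rewrite -DP /splits; have -> : map_poly intr P = map_poly (in_alg L) (map_poly intr P).
    by apply/polyP => i; rewrite !coef_map /= alg_num_field ratr_int.
  rewrite Drs lead_coef_map_inj //; last exact: intr_inj.
  by rewrite alg_num_field ratr_int.
by apply: (splits_dvd _ PS); rewrite -DP.
Qed.

Section Embedded.

Variables (L : splittingFieldType rat) (iota : {rmorphism L -> C}).
Let nrm : L -> R := cabs \o iota.

Lemma splits_czeros A (rs : seq L) : A != 0 -> splits A rs -> perm_eq (czeros A) (map iota rs).
Proof.
move=> A0 AS; apply: czeros_perm => //; rewrite big_map.
have := congr1 (map_poly iota) AS; rewrite map_polyZ rmorph_int rmorph_prod /=.
have -> : map_poly iota (map_poly intr A) = map_poly intr A.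
  by apply/polyP => i; rewrite !coef_map /= rmorph_int.
move=> ->; congr (_ *: _); apply: eq_bigr => z _.
by rewrite rmorphB /= map_polyX map_polyC.
Qed.

Lemma iota_outer A (rs : seq L) : A != 0 -> splits A rs -> iota (outer nrm A rs) = couter A.
Proof.
move=> A0 AS; rewrite /outer /couter rmorphM rmorph_int rmorph_prod /=; congr (_ * _).
by rewrite [RHS](perm_big _ (splits_czeros A0 AS)) /= big_map.
Qed.

Lemma count_in A (rs : seq L) : A != 0 -> splits A rs ->
  count (fun z => nrm z < 1) rs = nzeros_in_disk R A.
Proof.
by move=> A0 AS; rewrite /nzeros_in_disk (seq.permP (splits_czeros A0 AS)) count_map.
Qed.

End Embedded.

(* All roots in a block lie on the same side of the unit circle. *)
Lemma block_deg_le (L : splittingFieldType rat) (nrm : L -> R) d rt fsF al A f rs k :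
  in_family nrm d rt fsF al A -> f \in fsF A -> splits A rs ->
  count (fun z => nrm z < 1) rs = k -> (block_deg nrm rt f <= maxn k (d - k))%N.
Proof.
move=> hA ff AS ck; have hf := fam_factor hA ff; have A0 := fam_neq0 hA.
have DA := fam_dvd hA ff.
have fg0 : f * \prod_(g <- rem f (fsF A)) g != 0 by rewrite -DA.
have AS' : splits (f * \prod_(g <- rem f (fsF A)) g) rs by rewrite -DA.
have [rg prs _] := splits_factor fg0 AS' (fam_splits hf).
have srs : size rs = d.
  have := congr1 (fun p : {poly L} => size p) AS.
  rewrite size_scale ?lead_intr_neq0 // size_prod_XsubC size_map_poly_id0 ?lead_intr_neq0 //.
  by rewrite (fam_size hA) => -[].
have cP (p : pred L) : (count p (roots_of rt f) <= count p rs)%N.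
  by rewrite (seq.permP prs) count_cat leq_addr.
have side z : pattern nrm z == pat nrm rt f -> (nrm z < 1) = (nrm (rt f) < 1).
  move/eqP/setP/(_ 1%g); rewrite !inE !gal1f !ltNge => -> //.
rewrite /block_deg leq_max; have [i|o] := boolP (nrm (rt f) < 1).
  apply/orP; left; rewrite -ck; apply: leq_trans (cP (fun z => nrm z < 1)).
  by apply: sub_count => z /side ->.
apply/orP; right.
have <- : count (fun z => ~~ (nrm z < 1)) rs = (d - k)%N.
  by rewrite -srs -ck -(count_predC (fun z => nrm z < 1) rs) addKn.
apply: leq_trans (cP (fun z => ~~ (nrm z < 1))).
by apply: sub_count => z /side ->.
Qed.

Lemma valuation_family (L : splittingFieldType rat) :
  exists V : nat -> L -> Prop, forall p, prime p -> valuation_ring p (V p).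
Proof.
have /choice [V HV] : forall p, exists V : L -> Prop, prime p -> valuation_ring p V.
  move=> p; have [pr|npr] := boolP (prime p); last by exists (fun=> True).
  by have [V HV] := valuation_ring_exists pr (pchar0_fieldExt L); exists V.
by exists V.
Qed.

Lemma AtildeE k d (M : R) A : A \in Atilde R k d M ->
  [/\ size A = d.+1, mahler R A = M & nzeros_in_disk R A = k].
Proof. by rewrite inE => -[? [? ?]]. Qed.

Definition factors (A : {poly int}) : seq {poly int} :=
  xget [::] [set fs : seq {poly int} | A = \prod_(f <- fs) f /\ forall f, f \in fs ->
    irreducible_poly f]%classic.

Lemma factorsP (A : {poly int}) : (1 < size A)%N -> A = \prod_(f <- factors A) f /\
  forall f, f \in factors A -> irreducible_poly f.
Proof.
move=> sA; rewrite /factors; case: xgetP => [fs _ //|no].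
by have [fs h] := int_factorization sA; case: (no fs).
Qed.

Section RootChoice.

Variables (L : splittingFieldType rat).

Definition some_root (f : {poly int}) : L :=
  xget 0 [set z : L | root (map_poly intr f) z]%classic.

Lemma some_rootP f (z : L) : root (map_poly intr f) z -> root (map_poly intr f) (some_root f).
Proof. by move=> rz; rewrite /some_root; case: xgetP => [y _ //|/(_ z)]. Qed.

Lemma factor_root (A f g : {poly int}) (rs : seq L) : A != 0 -> A = f * g -> irreducible_poly f ->
  splits A rs -> root (map_poly intr f) (some_root f).
Proof.
move=> A0 DA [sf _] AS; rewrite DA in A0 AS.
have [rf fS] := splits_dvd A0 AS.
have f0 : f != 0 by apply: contraNneq A0 => ->; rewrite mul0r.
case: rf fS => [|z rf] fS.
  move: sf; have := congr1 (fun p : {poly L} => size p) fS.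
  rewrite big_nil size_map_poly_id0 ?lead_intr_neq0 // size_scale ?lead_intr_neq0 //.
  by rewrite size_poly1 => ->.
apply: (@some_rootP f z); rewrite fS rootE hornerZ big_cons hornerM hornerXsubC subrr.
by rewrite mul0r mulr0.
Qed.

End RootChoice.

Lemma in_family_of (L : splittingFieldType rat) (nrm : L -> R) d (A : {poly int}) rs al
   (fsF : {poly int} -> seq {poly int}) : size A = d.+1 -> splits A rs -> outer nrm A rs = al ->
  A = \prod_(f <- fsF A) f -> (forall f, f \in fsF A -> irreducible_poly f) ->
  in_family nrm d (@some_root L) fsF al A.
Proof.
move=> sA AS oA DA irr; split=> //; last by exists rs.
move=> f ff; have A0 : A != 0 by rewrite -size_poly_gt0 sA.
have DA' : A = f * \prod_(g <- rem f (fsF A)) g.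
  by rewrite {1}DA (perm_big _ (perm_to_rem ff)) big_cons.
exact: factor_root A0 DA' (irr f ff) AS.
Qed.

(* The sign distinguishes the two possible values M and -M of the outer product. *)
Lemma size_by_sign (S : seq {poly int}) (n : nat) :
  (forall b, (size [seq A <- S | (0 <= complex.Re (couter A))%R == b] <= n)%N) ->
    (size S <= 2 * n)%N.
Proof.
move=> h; rewrite -(count_predC (fun A : {poly int} => (0 <= complex.Re (couter A))%R ==
  true) S) mul2n -addnn.
apply: leq_add; first by rewrite -size_filter; apply: h.
apply: leq_trans (h false); rewrite size_filter.
by apply: sub_count => A /=; case: (0 <= _).
Qed.

Lemma couter_sign (M : R) (A A' : {poly int}) : A != 0 -> A' != 0 -> mahler R A = M ->
  mahler R A' = M ->
  (0 <= complex.Re (couter A))%R = (0 <= complex.Re (couter A'))%R -> couter A = couter A'.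
Proof.
move=> A0 A0' MA MA'; have M1 := mahler_ge1 A0; rewrite MA in M1.
have M0 : 0 < M by apply: lt_le_trans M1.
have := couter_cases A0; have := couter_cases A0'; rewrite MA MA'.
by case=> ->; case=> -> //=; rewrite oppr_ge0 (ltW M0) leNgt M0.
Qed.

(** In the complex numbers the outer product is M or -M. The embedding is injective, so within each
    sign class all outer products agree already in L. The two classes account for 2^r. *)
Lemma outer_reduction (k d r N : nat) (M : R) (S : seq {poly int}) : (0 < r)%N -> uniq S ->
  (forall A, A \in S -> A \in Atilde R k d M) ->
  (forall (L : splittingFieldType rat) (iota : {rmorphism L -> C}) (al : L) (Sb : seq {poly int}),
    {subset Sb <= S} -> uniq Sb -> cabs (iota al) = M ->
    (forall A, A \in Sb -> exists2 rs, splits A rs & outer (cabs \o iota) A rs = al) ->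
    (size Sb ^ r <= N)%N) ->
  (size S ^ r <= 2 ^ r * N)%N.
Proof.
move=> r0 uS SA H.
have SA0 A : A \in S -> A != 0.
  by move=> /SA /AtildeE [sA _ _]; rewrite -size_poly_gt0 sA.
suff key b : (size [seq A <- S | (0 <= complex.Re (couter A))%R == b] ^ r <= N)%N.
  have [n [hn nr]] : exists n : nat, (forall b,
    (size [seq A <- S | (0 <= complex.Re (couter A))%R == b] <= n)%N) /\ (n ^ r <= N)%N.
    exists (maxn (size [seq A <- S | (0 <= complex.Re (couter A))%R == true])
       (size [seq A <- S | (0 <= complex.Re (couter A))%R == false])); split.
      by case; rewrite leq_max leqnn ?orbT.
    by rewrite /maxn; case: ifP => _; apply: key.
  apply: leq_trans (_ : (2 * n) ^ r <= _)%N; first exact: leq_exp2rW (size_by_sign hn).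
  by rewrite expnMn leq_mul2l nr orbT.
have [L [iota hS]] := common_splitting SA0.
set Sb := [seq _ <- _ | _].
have SbS A : A \in Sb -> A \in S /\ (0 <= complex.Re (couter A))%R = b.
  by rewrite mem_filter => /andP[/eqP -> ->].
case ES : Sb => [|A1 S1]; first by rewrite exp0n.
have [A1S b1] : A1 \in S /\ (0 <= complex.Re (couter A1))%R = b by apply: SbS;
  rewrite ES mem_head.
have [rs1 As1] := hS _ A1S; have A10 := SA0 _ A1S.
have [_ M1 _] := AtildeE (SA _ A1S).
rewrite -ES; apply: (H L iota (outer (cabs \o iota) A1 rs1)).
- by move=> A /SbS [].
- exact: filter_uniq.
- by rewrite iota_outer // cabs_couter M1.
move=> A /SbS [AS bA]; have [rs As] := hS A AS; have [_ MA _] := AtildeE (SA A AS).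
exists rs => //; apply: (fmorph_inj iota); rewrite !iota_outer ?SA0 //.
by apply: (couter_sign (SA0 _ AS) A10 MA M1); rewrite bA b1.
Qed.

Lemma Atilde_bound (k d r : nat) : (0 < k < d)%N -> (0 < r)%N ->
  exists C : nat, (0 < C)%N /\ forall (M : R) (X : nat) (S : seq {poly int}),
    M <= X%:R -> uniq S -> (forall A, A \in S -> A \in Atilde R k d M) ->
    (size S ^ r <= C * X ^ (maxn k (d - k) * r).+1)%N.
Proof.
move=> /andP[k0 kd] r0; have d0 : (0 < d)%N by apply: ltn_trans kd.
have [C [C0 HC]] := slot_family_bound (maxn k (d - k)) d0 r0.
exists (2 ^ r * C)%N; split; first by rewrite muln_gt0 expn_gt0.
move=> M X S MX uS SA; rewrite -mulnA; apply: (outer_reduction r0 uS SA).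
move=> L iota al Sb SbS uSb Mal hS; have [V hV] := valuation_family L.
have hN : absolute_value (cabs \o iota) by apply: comp_absolute_value.
have fam A : A \in Sb -> in_family (cabs \o iota) d (@some_root L) factors al A.
  move=> AS; have [rs As oA] := hS A AS; have [sA _ _] := AtildeE (SA A (SbS A AS)).
  have [|DA irr] := @factorsP A; first by rewrite sA.
  exact: (in_family_of sA As oA DA irr).
apply: (HC L R _ V X (@some_root L) factors al Sb hN hV); rewrite /= ?Mal //.
move=> A f AS ff; have [rs As _] := hS A AS.
have [sA _ kA] := AtildeE (SA A (SbS A AS)).
apply: (block_deg_le (fam A AS) ff As); rewrite (count_in iota _ As) //.
by rewrite -size_poly_gt0 sA.
Qed.

End ComplexRoots.

(** * A positive proportion of polynomials with blocks of degree one *)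

Section MaximalIdeal.

Variables (L : fieldExtType rat) (p : nat) (V : L -> Prop).
Hypotheses (p_pr : prime p) (hV : valuation_ring p V).
Local Notation pL := (p%:R : L).

Definition vmax (x : L) : Prop := V x /\ ~ vunit V x.

Lemma vunit_V x : vunit V x -> V x. Proof. by case. Qed.

Lemma vmax_V x : vmax x -> V x. Proof. by case. Qed.

Lemma vmax_or_vunit x : V x -> vmax x \/ vunit V x.
Proof. by move=> Vx; have [|nu] := pselect (vunit V x); [right | left]. Qed.

Lemma vunit_mulr x y : V x -> V y -> vunit V (x * y) -> vunit V x.
Proof.
move=> Vx Vy [xy0 _ Vi]; have := xy0; rewrite mulf_eq0 negb_or => /andP[x0 y0].
split=> //; have -> : x^-1 = y * (x * y)^-1 by rewrite invfM mulrCA mulfV ?mulr1.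
exact: (srM hV).
Qed.

Lemma vmaxM x y : vmax x -> V y -> vmax (x * y).
Proof.
move=> [Vx nu] Vy; split; first exact: (srM hV).
by move=> /(vunit_mulr Vx Vy).
Qed.

Lemma vmaxD x y : vmax x -> vmax y -> vmax (x + y).
Proof.
move=> [Vx nx] [Vy ny]; split; first exact: (srD hV).
have [->|y0] := eqVneq y 0; first by rewrite addr0.
have [->|x0] := eqVneq x 0; first by rewrite add0r.
move=> [s0 _ Vs]; have [h|h] := vr_total hV (x / y).
  apply: ny; split=> //; have -> : y^-1 = (x + y)^-1 * (x / y + 1).
    by rewrite -[1](mulfV y0) -mulrDl mulKf.
  by apply: (srM hV) => //; apply: (srD hV) => //; apply: (sr1 hV).
apply: nx; split=> //; have -> : x^-1 = (x + y)^-1 * (y / x + 1).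
  by rewrite -[1](mulfV x0) -mulrDl addrC mulKf // addrC.
by apply: (srM hV) => //; apply: (srD hV); [rewrite -invf_div | apply: (sr1 hV)].
Qed.

Lemma vmaxN x : vmax x -> vmax (- x).
Proof. by move=> mx; rewrite -mulrN1; apply: vmaxM => //; apply/(srN hV)/(sr1 hV). Qed.

Lemma vunit_add_vmax x y : vunit V x -> vmax y -> vunit V (x + y).
Proof.
move=> ux my; have [] := @vmax_or_vunit (x + y) => //.
  by apply: (srD hV); [exact: vunit_V | exact: vmax_V].
move=> mxy; have := vmaxD mxy (vmaxN my); rewrite addrK => -[_ []].
exact: ux.
Qed.

Lemma vmax_p : vmax pL.
Proof.
split; first exact: (sr_nat hV).
by move=> [_ _]; apply: (vr_p hV).
Qed.

Lemma vmax_prime x y : V x -> V y -> vmax (x * y) -> vmax x \/ vmax y.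
Proof.
move=> Vx Vy [_ nu]; have [|ux] := vmax_or_vunit Vx; first by left.
have [|uy] := vmax_or_vunit Vy; first by right.
by case: nu; apply: (vunitM hV).
Qed.

Lemma vunit_prod (rs : seq L) (P : pred L) (F : L -> L) :
  (forall z, z \in rs -> P z -> vunit V (F z)) -> vunit V (\prod_(z <- rs | P z) F z).
Proof.
move=> h; rewrite big_seq_cond; apply: (big_ind (vunit V)) => [||z /andP[zr Pz]].
- exact: (vunit1 hV).
- exact: (vunitM hV).
- exact: h.
Qed.

Lemma over_horner_sub (P : {poly L}) x y : over_pred V P -> V x -> V y ->
  exists2 c, V c & P.[x] - P.[y] = (x - y) * c.
Proof.
move=> VP Vx Vy; have : root (P - P.[y]%:P) y by rewrite rootE !hornerE subrr.
case/factor_theorem => Q DQ.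
have /(over_root_factor p_pr hV) [VQ _] : over_pred V (('X - y%:P) * Q).
  rewrite mulrC -DQ; apply: (overD hV) => //; apply/(overN hV)/(overC hV).
  exact: (over_horner hV).
exists Q.[x]; first exact: (over_horner hV).
have := congr1 (fun P : {poly L} => P.[x]) DQ.
by rewrite hornerD hornerN hornerC hornerM hornerXsubC mulrC.
Qed.

(** No rational number has a valuation strictly between 0 and that of p. This discreteness drives
    the argument on special polynomials. *)
Lemma vr_rat_cases (q : rat) : V (ratr q) -> V (ratr q / pL) \/ vunit V (ratr q).
Proof.
move=> Vq; have pd := vr_ratr p_pr hV Vq.
have [d0 Vd Vdi] := vunit_coprime p_pr hV pd.
have [/dvdzP [m Dm]|pn] := boolP (p%:Z %| numq q)%Z.
  left; have -> : ratr q / pL = m%:~R * (denq q)%:~R^-1.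
    rewrite /ratr Dm rmorphM /= -!mulrA; congr (_ * _).
    by rewrite mulrCA mulfV ?mulr1 // (vr_p_neq0 L p_pr).
  by apply: (srM hV) => //; apply: (sr_int hV).
right; rewrite /ratr; apply: (vunitM hV); first exact: (vunit_coprime p_pr hV pn).
exact: (vunitV (vunit_coprime p_pr hV pd)).
Qed.

End MaximalIdeal.

(* Polynomials congruent to t^d + 2 t^(d-1) + 6 modulo 36: they satisfy
   Eisenstein's criterion at 2 and are congruent to t^(d-1) (t - 1) modulo 3,
   with constant coefficient not divisible by 9. *)
Definition special d (A : {poly int}) : Prop := size A = d.+1 /\
  exists B : {poly int}, A = 'X^d + 2%:P * 'X^(d.-1) + 6%:P + 36%:P * B.

Section SpecialIrreducible.

Variables (d : nat) (A : {poly int}).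
Hypotheses (d2 : (1 < d)%N) (hA : special d A).

Lemma special_coef : exists b : nat -> int, forall i, A`_i =
  (i == d)%:Z + 2 * (i == d.-1)%:Z + 6 * (i == 0%N)%:Z + 36 * b i.
Proof.
have [_ [B ->]] := hA; exists (fun i => B`_i) => i.
rewrite !coefD coefXn !coefCM coefXn coefC.
by case: (i == d); case: (i == d.-1); case: (i == 0%N).
Qed.

Lemma special_lead : exists b : int, lead_coef A = 1 + 36 * b.
Proof.
have [b Hb] := special_coef; have [sA _] := hA; exists (b d).
rewrite /lead_coef sA /= Hb eqxx; have -> : (d == d.-1) = false by lia.
by have -> : (d == 0%N) = false by lia; rewrite !mulr0 !addr0.
Qed.

Lemma special_neq0 : A != 0.
Proof. by have [sA _] := hA; rewrite -size_poly_gt0 sA. Qed.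

Lemma special_irreducible : irreducible_poly A.
Proof.
have [b Hb] := special_coef; have [sA _] := hA; have [c Dc] := special_lead.
apply: (@eisenstein_crit 2) => //.
- by rewrite sA; lia.
- by rewrite Dc; apply/negP => /dvdzP [m Dm]; lia.
- rewrite Hb; have -> : (0%N == d) = false by lia.
  have -> : (0%N == d.-1) = false by lia.
  by apply/negP => /dvdzP [m Dm]; lia.
move=> i; rewrite sA /= => lt; rewrite Hb; have -> : (i == d) = false by lia.
apply/dvdzP; exists ((i == d.-1)%:Z + 3 * (i == 0%N)%:Z + 18 * b i); lia.
Qed.

End SpecialIrreducible.

(** * Special polynomials at the prime 3 *)

Section SpecialPattern.

Variables (L : splittingFieldType rat) (R : realType) (nrm : L -> R) (V : L -> Prop).
Hypotheses (hN : absolute_value nrm) (hV : valuation_ring 3 V).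
Local Notation G := (gal_of {:L}).
Let pr3 : prime 3 := isT.

Variables (d : nat) (A : {poly int}) (z0 : L).
Hypotheses (d2 : (1 < d)%N) (hA : special d A) (rz0 : root (map_poly intr A) z0).
Local Notation rs := (conj_seq z0).
Local Notation l := ((lead_coef A)%:~R : L).

Lemma specialE : map_poly intr A = l *: \prod_(b <- rs) ('X - b%:P).
Proof. exact: irreducible_conj (special_irreducible d2 hA) rz0. Qed.

Lemma special_size_rs : size rs = d.
Proof.
have [sA _] := hA; have A0 := special_neq0 hA.
have := congr1 (fun p : {poly L} => size p) specialE.
rewrite size_scale ?lead_intr_neq0 // size_prod_XsubC size_map_poly_id0 ?lead_intr_neq0 //.
by rewrite sA => -[].
Qed.

Lemma special_lead_unit : vunit V l.
Proof.
have [b ->] := special_lead d2 hA; apply: (vunit_coprime pr3 hV).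
by apply/negP => /dvdzP [m Dm]; lia.
Qed.

Lemma special_root_V z : z \in rs -> V z.
Proof.
move=> zr; have [_ _ Vl] := special_lead_unit; have [l0 _ _] := special_lead_unit.
have : V (l * \prod_(w <- rs | w == z) w).
  by apply: (over_lead_prod pr3 hV) => i; rewrite -specialE coef_map; apply: (sr_int hV).
rewrite -big_filter (filter_pred1_uniq (conj_seq_uniq z0) zr) big_seq1 => Vlz.
by rewrite -(mulKf l0 z); apply: (srM hV).
Qed.

Lemma special_decomp : exists r : {poly int}, [/\ A = 'X^(d.-1) * ('X - 1) + 3%:P * r &
  ~~ (3 %| r`_0)%Z].
Proof.
have [_ [B DB]] := hA; exists ('X^(d.-1) + 2%:P + 12%:P * B); split.
  rewrite {1}DB -{1}(prednK (ltnW d2)) exprSr.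
  have -> : 36%:P = 3%:P * 12%:P :> {poly int} by rewrite -rmorphM.
  have -> : 6%:P = 3%:P * 2%:P :> {poly int} by rewrite -rmorphM.
  have -> : 2%:P = 3%:P - 1 :> {poly int} by rewrite -polyC1 -polyCB.
  ring.
rewrite !coefD coefXn coefC coefCM; have -> : (0%N == d.-1) = false by lia.
by rewrite /= mulr0n add0r; apply/negP => /dvdzP [m Dm]; lia.
Qed.

Lemma special_root_rel : exists c : L -> L, forall z, V z ->
  [/\ V (c z), (map_poly intr A).[z] = z ^+ d.-1 * (z - 1) + 3%:R * c z &
   vmax V z -> vunit V (c z)].
Proof.
have [r [DA r0]] := special_decomp.
pose rL : {poly L} := map_poly intr r.
have rV : over_pred V rL by move=> i; rewrite coef_map; apply: (sr_int hV).
exists (fun z => rL.[z]) => z Vz; split.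
- exact: (over_horner hV).
- rewrite {1}DA rmorphD !rmorphM rmorphXn /= rmorphB /= map_polyX map_polyC /= rmorph1.
  by rewrite !hornerE /= (_ : map_poly intr 3%:P = 3%:P) ?hornerC // map_polyC.
move=> mz; have [c Vc Dc] := over_horner_sub pr3 hV rV Vz (sr0 hV).
rewrite -[rL.[z]](subrK rL.[0]) Dc subr0 addrC; apply: (vunit_add_vmax hV).
  rewrite horner_coef0 coef_map; exact: (vunit_coprime pr3 hV r0).
exact: (vmaxM hV).
Qed.

Lemma vmax_X x n : V x -> vmax V (x ^+ n) -> vmax V x.
Proof.
move=> Vx [_ nu]; have [//|ux] := vmax_or_vunit Vx.
by case: nu; apply: (vunitX hV).
Qed.

(** For a root z in the maximal ideal both c and z - 1 are units, so z^(d-1) has exactly the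
    valuation of 3, as on the Newton polygon. *)
Lemma special_root_eq z : z \in rs -> exists c, [/\ V c, z ^+ d.-1 * (z - 1) = 3%:R * c &
  vmax V z -> vunit V c].
Proof.
move=> zr; have Vz := special_root_V zr; have [c Hc] := special_root_rel.
have [Vc e mu] := Hc z Vz; exists (- c z); split; [exact: (srN hV) | | ].
  apply/eqP; rewrite mulrN -addr_eq0 -e specialE hornerZ.
  by rewrite (eqP (_ : root _ z)) ?mulr0 // root_prod_XsubC.
move=> /mu uc; rewrite -mulN1r; apply: (vunitM hV) => //; split; rewrite ?oppr_eq0 ?oner_eq0 //.
  exact/(srN hV)/(sr1 hV).
rewrite invrN invr1; exact/(srN hV)/(sr1 hV).
Qed.

Lemma special_root_cases z : z \in rs -> vmax V z \/ vmax V (z - 1).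
Proof.
move=> zr; have Vz := special_root_V zr; have [c [Vc e _]] := special_root_eq zr.
have : vmax V (z ^+ d.-1 * (z - 1)) by rewrite e; apply: (vmaxM hV) => //; apply: (vmax_p hV).
have V1 : V (z - 1) by apply: (srB hV) => //; apply: (sr1 hV).
case/(vmax_prime hV (srX hV _ Vz) V1) => [/(vmax_X Vz)|]; by [left | right].
Qed.

(** Modulo the maximal ideal the polynomial is t^(d-1) (t - 1). Its value at 1 vanishes there, so
    some root reduces to 1. Its derivative at that root is a unit, so no second root does. *)
Lemma special_simple_root : exists z1, [/\ z1 \in rs, vmax V (z1 - 1) &
  forall w, w \in rs -> w != z1 -> vmax V w].
Proof.
have V1 : V 1 by apply: (sr1 hV).
have [z1 z1r m1] : exists2 z1, z1 \in rs & vmax V (z1 - 1).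
  apply: contrapT => no.
  have all0 z : z \in rs -> vmax V z.
    by move=> zr; case: (special_root_cases zr) => // m1; case: no; exists z.
  have [c Hc] := special_root_rel; have [Vc e _] := Hc 1 V1.
  have : vmax V (map_poly intr A).[1].
    rewrite e subrr mulr0 add0r; apply: (vmaxM hV) => //; exact: (vmax_p hV).
  rewrite specialE hornerZ horner_prod => -[_ []]; apply: (vunitM hV);
    first exact: special_lead_unit.
  apply: (vunit_prod hV) => z zr _; rewrite hornerXsubC; apply: (vunit_add_vmax hV).
    exact: (vunit1 hV).
  exact/(vmaxN hV)/all0.
exists z1; split=> // w wr wz.
have Vz := special_root_V z1r.
have uz : vunit V z1.
  by rewrite -[z1](subrK 1) addrC; apply: (vunit_add_vmax hV) => //; apply: (vunit1 hV).
pose Q := l *: \prod_(b <- rem z1 rs) ('X - b%:P).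
have DQ : map_poly intr A = ('X - z1%:P) * Q.
  by rewrite specialE (perm_big _ (perm_to_rem z1r)) big_cons scalerAr.
have uQ : vunit V Q.[z1].
  have -> : Q.[z1] = (map_poly intr A)^`().[z1].
    rewrite DQ derivM derivXsubC mul1r hornerD hornerM hornerXsubC subrr mul0r addr0 //.
  have [r [DA _]] := special_decomp.
  have -> : map_poly intr A = 'X^(d.-1) * ('X - 1%:P) + 3%:P * map_poly intr r :> {poly L}.
    rewrite {1}DA rmorphD !rmorphM rmorphXn /= rmorphB /= map_polyX rmorph1.
    by rewrite (_ : map_poly intr 3%:P = 3%:P) // map_polyC.
  have -> : ('X^(d.-1) * ('X - 1%:P) + 3%:P * map_poly intr r)^`().[z1] =
      z1 ^+ d.-1 + (('X^(d.-1))^`().[z1] * (z1 - 1) + 3%:R * (map_poly intr r)^`().[z1]) :> L.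
    rewrite derivD !derivM derivXsubC derivC mul0r add0r mulr1 !(hornerD, hornerM).
    by rewrite hornerN hornerX !hornerC hornerXn addrA [_ ^+ _ + _]addrC.
  apply: (vunit_add_vmax hV); first exact: (vunitX hV).
  apply: (vmaxD hV).
    rewrite mulrC; apply: (vmaxM hV) => //; apply: (over_horner hV) => //.
    by move=> i; rewrite coef_deriv coefXn -mulrnA; apply: (sr_nat hV).
  apply: (vmaxM hV); first exact: (vmax_p hV).
  apply: (over_horner hV) => // i; rewrite coef_deriv coef_map -mulr_natr.
  by apply: (srM hV); [exact: (sr_int hV) | exact: (sr_nat hV)].
case: (special_root_cases wr) => // mw.
have wrem : w \in rem z1 rs by rewrite mem_rem_uniq ?conj_seq_uniq // inE wz.
move: uQ; rewrite /Q hornerZ (perm_big _ (perm_to_rem wrem)) big_cons hornerM hornerXsubC.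
have mzw : vmax V (z1 - w).
  have -> : z1 - w = (z1 - 1) + - (w - 1) by rewrite opprB addrA subrK.
  by apply: (vmaxD hV) => //; apply: (vmaxN hV).
move=> u; have [_ []] : vmax V (l * ((z1 - w) * (\prod_(b <- rem w (rem z1 rs)) ('X -
  b%:P)).[z1])).
  rewrite mulrC -mulrA; apply: (vmaxM hV) => //; apply: (srM hV); last exact: (sr_int hV).
  apply: (over_horner hV) => //; rewrite big_seq; apply: (over_prod hV) => b br.
  apply: (overD hV); first exact: (overX hV).
  by apply/(overN hV)/(overC hV)/special_root_V/(mem_rem (mem_rem br)).
exact: u.
Qed.

Section Blocks.

Hypothesis two_sides : exists2 a, a \in rs & exists2 b, b \in rs & pattern nrm a != pattern nrm b.

Definition class_size z := count (fun w => pattern nrm w == pattern nrm z) rs.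
Definition mates z : L := \prod_(w <- rs | (w != z) && (pattern nrm w == pattern nrm z)) w.

Lemma mates_gal (s : G) z : s (mates z) = mates (s z).
Proof.
rewrite /mates rmorph_prod /= -[RHS](perm_big _ (conj_seq_perm z0 s)) /= big_map.
apply: eq_bigl => w; rewrite (inj_eq (@gal_inj _ s)) !pattern_gal.
by rewrite (inj_eq (@shift_inj _ s)).
Qed.

(** Lagrange interpolation of [mates] without its denominators: at a root z the value is [mates z]
    times the derivative of A at z. It has rational coefficients, so its value at the rational point
    1, which is close to z1, is rational. *)
Definition mates_poly : {poly L} :=
  \sum_(z <- rs) mates z *: (l *: \prod_(w <- rs | w != z) ('X - w%:P)).

Lemma mates_poly_rat : exists Q : {poly rat}, mates_poly = map_poly (in_alg L) Q.
Proof.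
apply: gal_fixed_poly => s; rewrite rmorph_sum /= /mates_poly.
rewrite -[RHS](perm_big _ (conj_seq_perm z0 s)) /= big_map; apply: eq_bigr => z _.
rewrite !map_polyZ rmorph_int /= mates_gal rmorph_prod; congr (_ *: (_ *: _)).
rewrite -[RHS](perm_big _ (conj_seq_perm z0 s)) /= big_map.
apply: eq_big => w; first by rewrite (inj_eq (@gal_inj _ s)).
by move=> _; rewrite rmorphB /= map_polyX map_polyC.
Qed.

Lemma mates_V z : V (mates z).
Proof.
rewrite /mates big_seq_cond; apply: (sr_prod hV) => w /andP[wr _].
exact: special_root_V.
Qed.

Lemma mates_poly_V : over_pred V mates_poly.
Proof.
apply: (over_sum hV) => z _; apply: (overZ hV (mates_V z)).
apply: (overZ hV (sr_int hV _)); rewrite big_seq_cond; apply: (over_prod hV) => w /andP[wr _].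
by apply: (overD hV); [exact: (overX hV) | exact/(overN hV)/(overC hV)/special_root_V].
Qed.

Lemma class_size_lt z : z \in rs -> (class_size z < d)%N.
Proof.
move=> zr; rewrite -special_size_rs ltn_neqAle count_size andbT; apply/negP => e.
have /allP h : all (fun w => pattern nrm w == pattern nrm z) rs by rewrite all_count.
have [a ar [b br]] := two_sides.
by rewrite (eqP (h a ar)) (eqP (h b br)) eqxx.
Qed.

(* The valuation of the product of the other roots of the class of z1 lies
   strictly between 0 and that of 3, while it is a rational number modulo 3. *)
Lemma special_class_size z1 : z1 \in rs -> vmax V (z1 - 1) ->
  (forall w, w \in rs -> w != z1 -> vmax V w) -> class_size z1 = 1%N.
Proof.
move=> z1r m1 others; set b := class_size z1.
have b1 : (0 < b)%N by rewrite -has_count; apply/hasP; exists z1.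
have bd : (b < d)%N by apply: class_size_lt.
apply/eqP; rewrite eqn_leq b1 andbT leqNgt; apply/negP => b2.
have Vz := special_root_V z1r.
have n30 : 3%:R != 0 :> L by apply: (vr_p_neq0 L pr3).
have uz : vunit V z1.
  by rewrite -[z1](subrK 1) addrC; apply: (vunit_add_vmax hV) => //; apply: (vunit1 hV).
have other_unit w : w \in rs -> w != z1 -> vunit V (w ^+ d.-1 / 3%:R).
  move=> wr wz; have mw := others w wr wz; have [c [Vc e /(_ mw) uc]] := special_root_eq wr.
  have uw : vunit V (w - 1).
    rewrite addrC; apply: (vunit_add_vmax hV) => //; split; rewrite ?oppr_eq0 ?oner_eq0 //.
      exact/(srN hV)/(sr1 hV).
    rewrite invrN invr1; exact/(srN hV)/(sr1 hV).
  have -> : w ^+ d.-1 / 3%:R = c * (w - 1)^-1.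
    have [w0 _ _] := uw; apply: (mulIf w0); rewrite mulfVK // mulrAC e mulrC mulKf //.
  exact: (vunitM hV uc (vunitV uw)).
pose y := mates z1.
(* The class of z1 contains b - 1 further roots, and the (d-1)-th power of each is 3 up to a
   unit. *)
have uy : vunit V (y ^+ d.-1 / 3%:R ^+ b.-1).
  have -> : y ^+ d.-1 / 3%:R ^+ b.-1 =
      \prod_(w <- rs | (w != z1) && (pattern nrm w == pattern nrm z1)) (w ^+ d.-1 / 3%:R).
    rewrite big_split /= prodrXl; congr (_ * _).
    rewrite -big_filter big_const_seq count_predT iter_mulr_1 -exprVn; congr (_ ^+ _).
    rewrite size_filter /b /class_size (seq.permP (perm_to_rem z1r)) /= eqxx add1n /=.
    rewrite [RHS](seq.permP (perm_to_rem z1r)) /= eqxx add0n.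
    apply: eq_in_count => w; rewrite mem_rem_uniq ?conj_seq_uniq // inE => /andP[-> _] //.
  by apply: (vunit_prod hV) => w wr /andP[wz _]; apply: other_unit.
have [q Dq] : exists q : rat, mates_poly.[1] = ratr q.
  have [Q ->] := mates_poly_rat; exists Q.[1].
  by rewrite -(rmorph1 (in_alg L)) horner_map /= alg_num_field.
have VH := mates_poly_V.
have Vy : V y := mates_V z1.
pose Q1 := l *: \prod_(w <- rs | w != z1) ('X - w%:P).
have uQ1 : vunit V Q1.[z1].
  rewrite hornerZ horner_prod; apply: (vunitM hV); first exact: special_lead_unit.
  apply: (vunit_prod hV) => w wr wz; rewrite hornerXsubC; apply: (vunit_add_vmax hV uz).
  exact/(vmaxN hV)/others.
have Hz1 : mates_poly.[z1] = y * Q1.[z1].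
  rewrite /mates_poly (perm_big _ (perm_to_rem z1r)) big_cons hornerD hornerZ.
  rewrite [X in _ + X.[z1]]big_seq horner_sum [X in _ + X]big1 ?addr0 // => w wr.
  have wz : w != z1 by move: wr; rewrite mem_rem_uniq ?conj_seq_uniq // inE => /andP[].
  rewrite !hornerZ horner_prod (perm_big _ (perm_to_rem z1r)) big_cons eq_sym wz.
  by rewrite hornerXsubC subrr /= mul0r !mulr0.
have [e Ve De] := over_horner_sub pr3 hV VH Vz (sr1 hV).
have [c0 [Vc0 Dc0 _]] := special_root_eq z1r.
(* As 3 divides z1 - 1, the values of [mates_poly] at 1 and at z1 agree modulo 3. The first is the
   rational q, the second is y times a unit. *)
have V3 : V (3%:R^-1 * (z1 - 1)).
  have [u0 _ Vi] := vunitX hV d.-1 uz.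
  have -> : 3%:R^-1 * (z1 - 1) = (z1 ^+ d.-1)^-1 * c0.
    by apply: (mulfI n30); apply: (mulfI u0); rewrite mulVKf // Dc0 mulrCA mulVKf // .
  exact: (srM hV).
have ratio : ratr q / 3%:R = y * Q1.[z1] / 3%:R - (3%:R^-1 * (z1 - 1)) * e.
  by rewrite -[_ * _ * e]mulrA -De Dq Hz1 [_^-1 * _]mulrC -mulrBl opprB addrCA subrr addr0.
have Vq : V (ratr q) by rewrite -Dq; apply: (over_horner hV) => //; apply: (sr1 hV).
(* If q is divisible by 3, so is y; if q is a unit, so is y. Both contradict [uy], because 0 < b - 1
   < d - 1. *)
have [Vq3|uq] := vr_rat_cases pr3 hV Vq.
  have V3y : V (y / 3%:R).
    have [q0 _ Vi] := uQ1.
    have -> : y / 3%:R = (ratr q / 3%:R + (3%:R^-1 * (z1 - 1)) * e) * (Q1.[z1])^-1.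
      by rewrite ratio subrK mulrAC mulfK.
    by apply: (srM hV) => //; apply: (srD hV) => //; apply: (srM hV).
  have [_ []] : vmax V (y ^+ d.-1 / 3%:R ^+ b.-1).
    have -> : y ^+ d.-1 / 3%:R ^+ b.-1 = 3%:R ^+ (d.-1 - b.-1) * (y / 3%:R) ^+ d.-1.
      rewrite exprMn exprVn mulrCA; congr (_ * _).
      have le_bd : (b.-1 <= d.-1)%N by lia.
      by rewrite -[in RHS](subnK le_bd) addnK exprD invfM mulrA mulfV ?mul1r // expf_neq0.
    apply: (vmaxM hV); last exact: (srX hV).
    have -> : (d.-1 - b.-1 = (d.-1 - b.-1).-1.+1)%N by lia.
    by rewrite exprS; apply: (vmaxM hV); [exact: (vmax_p hV) | apply/(srX hV)/(sr_nat hV)].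
  exact: uy.
have uy' : vunit V y.
  apply: (vunit_mulr hV Vy (vunit_V uQ1));
    rewrite -Hz1 -[_.[z1]](subrK mates_poly.[1]) De Dq addrC.
  by apply: (vunit_add_vmax hV uq); apply: (vmaxM hV).
have [_ []] : vmax V (y ^+ d.-1).
  have [_ Vu _] := uy; rewrite -[y ^+ _](divfK (expf_neq0 b.-1 n30)) mulrC.
  apply: (vmaxM hV) => //.
  have -> : (b.-1 = b.-2.+1)%N by lia.
  by rewrite exprS; apply: (vmaxM hV); [exact: (vmax_p hV) | apply/(srX hV)/(sr_nat hV)].
exact: (vunitX hV).
Qed.

End Blocks.

End SpecialPattern.

Section SpecialFamily.

Variables (L : splittingFieldType rat) (R : realType) (nrm : L -> R) (V : nat -> L -> Prop).
Hypotheses (hN : absolute_value nrm) (hV : forall p, prime p -> valuation_ring p (V p)).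
Variables (d : nat) (rt : {poly int} -> L) (A : {poly int}).
Hypotheses (d2 : (1 < d)%N) (hA : special d A) (rA : root (map_poly intr A) (rt A)).

(** All blocks have the same degree, so it can be computed at the root z1 congruent to 1 instead of
    the chosen root. *)
Lemma special_block_deg : (exists2 a, a \in conj_seq (rt A) &
    exists2 b, b \in conj_seq (rt A) & pattern nrm a != pattern nrm b) ->
  block_deg nrm rt A = 1%N.
Proof.
move=> two; have [z1 [z1r m1 oth]] := special_simple_root (hV (isT : prime 3)) d2 hA rA.
have e1 := special_class_size (hV (isT : prime 3)) d2 hA rA two z1r m1 oth.
apply: succn_inj; rewrite -e1.
rewrite -(size_block (P := pattern nrm z1)) ?mem_patterns //.
by rewrite /block -big_filter size_prod_XsubC size_filter.
Qed.

Lemma special_patterns rs : splits A rs -> (0 < count (fun z => (nrm z < 1)%R) rs < d)%N ->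
  [/\ block_deg nrm rt A = 1%N, pat nrm rt A != [set: gal_of {:L}] & pat nrm rt A != finset.set0].
Proof.
move=> As /andP[c0 cd]; have A0 := special_neq0 hA.
have prs : perm_eq rs (conj_seq (rt A)).
  apply: prod_XsubC_eq; apply: (scalerI (lead_intr_neq0 L A0)).
  by rewrite -As (specialE d2 hA rA).
have [a ar an] : exists2 a, a \in conj_seq (rt A) & nrm a < 1.
  by move: c0; rewrite (seq.permP prs) -has_count => /hasP [a ? ?]; exists a.
have [b br bn] : exists2 b, b \in conj_seq (rt A) & 1 <= nrm b.
  apply/hasP; rewrite has_count -(ltn_add2l (count (fun z => nrm z < 1) (conj_seq (rt A)))) addn0.
  have -> : count (fun z => 1 <= nrm z) (conj_seq (rt A)) =
      count (predC (fun z => nrm z < 1)) (conj_seq (rt A)).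
    by apply: eq_count => z /=; rewrite leNgt.
  by rewrite count_predC -(seq.permP prs) (special_size_rs d2 hA rA).
have [s Ds] := conj_seqP _ _ ar; have [t Dt] := conj_seqP _ _ br.
split.
- apply: special_block_deg; exists a => //; exists b => //; apply/negP => /eqP/setP/(_ 1%g).
  by rewrite !inE !gal1f bn leNgt an.
- by apply/negP => /eqP/setP/(_ s); rewrite !inE -Ds leNgt an.
- by apply/negP => /eqP/setP/(_ t); rewrite !inE -Dt bn.
Qed.

End SpecialFamily.

Lemma special_bound (R : realType) (k d r : nat) : (0 < k < d)%N -> (0 < r)%N ->
  exists C : nat, (0 < C)%N /\ forall (M : R) (X : nat) (S : seq {poly int}),
    M <= X%:R -> uniq S -> (forall A, A \in S -> A \in Atilde R k d M) ->
    (forall A, A \in S -> special d A) -> (size S ^ r <= C * X)%N.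
Proof.
move=> /andP[k0 kd] r0; have d0 : (0 < d)%N by apply: ltn_trans kd.
have d2 : (1 < d)%N by apply: leq_ltn_trans kd.
have [C [C0 HC]] := injective_family_bound d0 r0.
exists (2 ^ r * C)%N; split; first by rewrite muln_gt0 expn_gt0.
move=> M X S MX uS SA Ssp; rewrite -mulnA; apply: (outer_reduction r0 uS SA).
move=> L iota al Sb SbS uSb Mal hS; have [V hV] := valuation_family L.
have hN : absolute_value (@cabs R \o iota) by apply: comp_absolute_value.
have fam A : A \in Sb -> in_family (@cabs R \o iota) d (@some_root L) (fun A => [:: A]) al A.
  move=> AS; have [rs As oA] := hS A AS; have hA := Ssp A (SbS A AS).
  apply: (in_family_of hA.1 As oA); first by rewrite big_seq1.
  by move=> f; rewrite mem_seq1 => /eqP ->; apply: special_irreducible hA.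
apply: (HC L R _ V X (@some_root L) (fun A => [:: A]) al Sb hN hV); rewrite /= ?Mal //.
move=> A AS; have [rs As _] := hS A AS; have hA := Ssp A (SbS A AS).
have [sA _ kA] := AtildeE (SA A (SbS A AS)).
have rA : root (map_poly intr A) (some_root L A).
  by apply: (fam_root (fam A AS)); rewrite mem_seq1.
have ck : (0 < count (fun z => ((@cabs R \o iota) z < 1)%R) rs < d)%N.
  by rewrite (count_in iota _ As) ?kA ?k0 // (special_neq0 hA).
by have [b p1 p2] := special_patterns hV d2 hA rA As ck.
Qed.

(** * Boxes of polynomials with prescribed zeros *)

Section Boxes.

Variables (N m : nat) (b : int).

Definition box_poly (f : {ffun 'I_N -> 'I_m}) : {poly int} :=
  \poly_(i < N) oapp (fun j => (f j)%:Z + b) 0 (insub i).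

Definition box : seq {poly int} := [seq box_poly f | f <- enum {: {ffun 'I_N -> 'I_m}}].

Lemma coef_box_poly f (i : 'I_N) : (box_poly f)`_i = (f i)%:Z + b.
Proof. by rewrite coef_poly ltn_ord valK. Qed.

Lemma size_box : size box = (m ^ N)%N.
Proof. by rewrite size_map -cardE card_ffun !card_ord. Qed.

Lemma box_uniq : uniq box.
Proof.
rewrite map_inj_uniq ?enum_uniq // => f g e; apply/ffunP => i; apply/val_inj.
have := congr1 (fun p : {poly int} => p`_i) e; rewrite !coef_box_poly => /addIr; by case.
Qed.

Lemma boxP J : J \in box -> (size J <= N)%N /\
  forall i, (i < N)%N -> b <= J`_i < b + m%:Z.
Proof.
case/mapP => f _ ->; split=> [|i lt]; first exact: size_poly.
rewrite (coef_box_poly f (Ordinal lt)); move: (f _) => x.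
by have := ltn_ord x; rewrite -ltz_nat; lia.
Qed.

End Boxes.

Lemma nrm_horner_le (F : fieldType) (R : realType) (nrm : F -> R) (B : {poly int}) (N m : nat)
    (z : F) (y : R) : absolute_value nrm -> (size B <= N)%N ->
  (forall i, (i < N)%N -> `|B`_i| <= m%:Z) -> 0 <= y -> (forall i, (i < N)%N ->
    nrm z ^+ i <= y) ->
  nrm (map_poly intr B).[z] <= (N * m)%:R * y.
Proof.
move=> hC sB hB y0 hy.
have -> : (map_poly intr B).[z] = \sum_(i < N) (B`_i)%:~R * z ^+ i.
  rewrite (@horner_coef_wide _ N); last first.
    by rewrite map_polyE; apply: leq_trans (size_Poly _) _; rewrite size_map.
  by apply: eq_bigr => i _; rewrite coef_map.
have sum_le (s : seq 'I_N) : nrm (\sum_(i <- s) (B`_i)%:~R * z ^+ i) <= (size s * m)%:R * y.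
  elim: s => [|i s IH]; first by rewrite big_nil mul0n mul0r (eqP (_ : nrm 0 == 0)) ?(nrm_eq0 hC).
  rewrite big_cons; apply: le_trans (nrmD hC _ _) _.
  rewrite /= mulSn natrD mulrDl; apply: lerD => //.
  rewrite (nrmM hC) (nrm_int hC) (nrmX hC); apply: ler_pM;
    rewrite ?ler0z ?exprn_ge0 ?(nrm_ge0 hC) //.
    by rewrite -[leRHS]/(m%:Z%:~R) ler_int hB.
  exact: hy.
have := sum_le (index_enum 'I_N).
by rewrite -[index_enum _]enumT size_enum_ord.
Qed.

(** * Polynomials with one dominant coefficient *)

Section DominantCoefficient.

Variable R : realType.
Local Notation C := R[i].
Local Notation cabs := (@cabs R).
Local Notation czeros := (@czeros R).

Lemma czeros_root (A : {poly int}) z : z \in czeros A -> (map_poly intr A).[z] = 0.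
Proof.
by move=> zA; rewrite czerosP hornerZ (eqP (_ : root _ z)) ?mulr0 // root_prod_XsubC.
Qed.

Variables (d m n : nat).
Hypothesis dmn : (d * m < n)%N.

(** For |z| >= 1 the value of B is at most d m |z|^d, which is less than n |z|^d, so all zeros lie
    inside the disk and the measure is the leading coefficient. *)
Lemma dominant_lead (B : {poly int}) : B \in box d m 1 -> n%:Z *: 'X^d + B \in Atilde R d d n%:R.
Proof.
move=> /boxP [sB hB]; set A := _ + B; have n0 : n%:Z != 0 by lia.
have szX : size (n%:Z *: 'X^d : {poly int}) = d.+1 by rewrite size_scale // size_polyXn.
have sA : size A = d.+1 by rewrite /A size_polyDl szX.
have lA : lead_coef A = n%:Z.
  by rewrite /A lead_coefDl ?szX // lead_coefZ lead_coefXn mulr1.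
have A0 : A != 0 by rewrite -size_poly_gt0 sA.
have hC := cabs_absolute_value R.
have inside z : z \in czeros A -> cabs z < 1.
  move=> /czeros_root; rewrite /A rmorphD /= map_polyZ map_polyXn hornerD hornerZ hornerXn => e.
  rewrite ltNge; apply/negP => z1.
  have h : cabs (map_poly intr B).[z] <= (d * m)%:R * cabs z ^+ d.
    apply: (nrm_horner_le hC) => //; first by move=> i /hB; lia.
      by rewrite exprn_ge0 ?(nrm_ge0 hC).
    by move=> i lt; apply: ler_weXn2l => //; apply: ltnW.
  have eB : cabs (map_poly intr B).[z] = n%:R * cabs z ^+ d.
    have -> : (map_poly intr B).[z] = (- n%:Z)%:~R * z ^+ d.
      by rewrite rmorphN mulNr; apply/eqP; rewrite -addr_eq0 addrC e.
    by rewrite (nrmM hC) (nrm_int hC) (nrmX hC) normrN.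
  move: h; rewrite eB ler_pM2r ?exprn_gt0 ?(lt_le_trans ltr01) // ler_nat.
  by rewrite leqNgt dmn.
rewrite inE; split=> //; split.
  rewrite /mahler lA big_seq big1 ?mulr1 // => z /inside /ltW /max_idPl //.
rewrite /nzeros_in_disk (eq_in_count (a2 := predT)) ?count_predT.
  by apply: succn_inj; rewrite size_czeros.
by move=> z /inside ->.
Qed.

Lemma mahler_outside (A : {poly int}) : (forall z, z \in czeros A -> 1 <= cabs z) ->
  mahler R A = `|A`_0|%:~R.
Proof.
move=> out; have hC := cabs_absolute_value R.
have -> : `|A`_0|%:~R = cabs (A`_0)%:~R by rewrite (nrm_int hC).
have -> : (A`_0)%:~R = (map_poly intr A).[0] :> C by rewrite horner_coef0 coef_map.
rewrite czerosP hornerZ horner_prod (nrmM hC) (nrm_int hC) (nrm_prod hC).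
rewrite /mahler; congr (_ * _); rewrite !big_seq; apply: eq_bigr => z /out oz.
rewrite hornerXsubC sub0r -mulN1r (nrmM hC) -[-1]/((-1)%:~R) (nrm_int hC) mul1r.
exact/max_idPr.
Qed.

Lemma dominant_const (B : {poly int}) : (0 < m)%N -> B \in box d m 1 ->
  B * 'X + n%:Z%:P \in Atilde R 0 d n%:R.
Proof.
move=> m0 /boxP [sB hB]; set A := _ + _; have n0 : n%:Z != 0 by lia.
(* The box starts at 1, so the top coefficient of B does not vanish. *)
have sBd : size B = d.
  case: d sB hB => [|d'] sB hB; first by apply/eqP; rewrite -leqn0.
  apply/eqP; rewrite eqn_leq sB ltnNge; apply/negP => le.
  by have := hB d' (leqnn _); rewrite nth_default //; lia.
have sA : size A = d.+1.
  by rewrite /A size_MXaddC sBd (negbTE n0) andbF.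
have A0 : A != 0 by rewrite -size_poly_gt0 sA.
have hC := cabs_absolute_value R.
have outside z : z \in czeros A -> 1 <= cabs z.
  move=> /czeros_root; rewrite /A rmorphD rmorphM /=
    map_polyX map_polyC hornerD hornerM hornerX hornerC => e.
  rewrite leNgt; apply/negP => z1.
  have h : cabs (map_poly intr B).[z] <= (d * m)%:R * 1.
    apply: (nrm_horner_le hC) => //; first by move=> i /hB; lia.
    by move=> i lt; apply: exprn_ile1; rewrite ?(nrm_ge0 hC) ?ltW.
  have : cabs ((map_poly intr B).[z] * z) = n%:R.
    have -> : (map_poly intr B).[z] * z = (- n%:Z)%:~R.
      by rewrite rmorphN; apply/eqP; rewrite -addr_eq0 e.
    by rewrite (nrm_int hC) normrN.
  rewrite (nrmM hC) => e2.
  have : n%:R <= (d * m)%:R :> R.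
    rewrite -e2 -[leRHS]mulr1; apply: ler_pM; rewrite ?(nrm_ge0 hC) ?(ltW z1) //.
    by move: h; rewrite mulr1.
  by rewrite ler_nat leqNgt dmn.
rewrite inE; split=> //; split.
  by rewrite mahler_outside // /A coefD coefMX coefC add0r.
rewrite /nzeros_in_disk; apply/eqP; rewrite eqn0Ngt -has_count; apply/hasPn => z /outside.
by rewrite ltNge => ->.
Qed.

End DominantCoefficient.

Lemma sign_perturb (R : realDomainType) (c u u' e e' : R) : 1 <= `|u| -> 1 <= `|u'| ->
  `|e| < c -> `|e'| < c -> u * u' < 0 -> (c * u + e) * (c * u' + e') < 0.
Proof.
move=> u1 u1' ec ec' neg.
have c0 : 0 < c by apply: le_lt_trans ec.
have pos (v f : R) : 1 <= `|v| -> `|f| < c -> 0 < v -> 0 < c * v + f.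
  move=> v1 fc v0; rewrite gtr0_norm // in v1; move: fc; rewrite ltr_norml => /andP[f1 f2].
  have : c <= c * v by rewrite ler_peMr // ltW.
  lra.
have neg' (v f : R) : 1 <= `|v| -> `|f| < c -> v < 0 -> c * v + f < 0.
  move=> v1 fc v0; rewrite -oppr_gt0 opprD -mulrN; apply: pos; rewrite ?normrN ?oppr_gt0 //.
case: (ltrgtP u 0) neg => [u0|u0|->]; last by rewrite mul0r ltxx.
  by rewrite nmulr_rlt0 // => u0'; rewrite nmulr_rlt0 ?pos ?neg'.
by rewrite pmulr_rlt0 // => u0'; rewrite pmulr_rlt0 ?neg' ?pos.
Qed.

Lemma norm_absolute_value (R : realType) : absolute_value (fun x : R => `|x|).
Proof.
split=> [x y|x y|x|n]; [exact: normrM | exact: ler_normD | exact: normr_eq0 | by rewrite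
  -intr_norm].
Qed.

(** * Special polynomials with prescribed real zeros *)

Section SpecialRoots.

Variables (R : realType) (k d : nat).
Hypotheses (k0 : (0 < k)%N) (kd : (k < d)%N).
Local Notation C := R[i].

(* The roots (2i+1)/(2k) separate the points j/k, at which the polynomial takes odd
   integer values; so a perturbation of size less than 1 there keeps all roots real
   and on their side of 1 = k/k. *)
Definition alternating : {poly int} := \prod_(i < d) ((2 * k)%:Z *: 'X - (2 * i + 1)%:Z%:P).

Definition test_value (j : nat) : int := \prod_(i < d) (2 * j%:Z - (2 * i + 1)%:Z).

Lemma alternating_test j : (map_poly intr alternating).[j%:R / k%:R] = (test_value j)%:~R :> R.
Proof.
have k0' : k%:R != 0 :> R by rewrite pnatr_eq0 -lt0n.
rewrite /alternating /test_value !rmorph_prod horner_prod; apply: eq_bigr => i _.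
rewrite rmorphB /= map_polyZ map_polyX map_polyC /= !hornerE rmorphB rmorphM /=; congr (_ - _).
have -> : ((2 * k)%:Z)%:~R = 2 * k%:R :> R by rewrite PoszM rmorphM.
by rewrite mulrAC mulfK.
Qed.

Lemma test_value_neq0 j : test_value j != 0.
Proof. by apply/prodf_neq0 => i _; apply/eqP; lia. Qed.

Lemma test_value_alternate j : (j < d)%N -> test_value j * test_value j.+1 < 0.
Proof.
move=> jd; rewrite /test_value -big_split /= (bigD1 (Ordinal jd)) //= pmulr_llt0; first lia.
apply: prodr_gt0 => i; rewrite -val_eqE /= => /eqP ne.
have [lt|ge] := ltnP i j.
  by apply: mulr_gt0; lia.
have lt : (j < i)%N by lia.
by rewrite nmulr_lgt0; lia.
Qed.

Lemma alternating_factor (i : nat) :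
  size ((2 * k)%:Z *: 'X - (2 * i + 1)%:Z%:P : {poly int}) = 2 /\
  lead_coef ((2 * k)%:Z *: 'X - (2 * i + 1)%:Z%:P : {poly int}) = (2 * k)%:Z.
Proof.
have sX : size ((2 * k)%:Z *: 'X : {poly int}) = 2 by rewrite size_scale ?size_polyX //; lia.
have lt : (size (- ((2 * i + 1)%:Z)%:P : {poly int}) < size ((2 * k)%:Z *: 'X : {poly int}))%N.
  by rewrite sX size_polyN size_polyC; case: (_ != _).
by rewrite size_polyDl // lead_coefDl // lead_coefZ lead_coefX mulr1.
Qed.

Lemma size_alternating : size alternating = d.+1.
Proof.
rewrite /alternating size_prod; last first.
  by move=> i _; rewrite -size_poly_gt0 (alternating_factor i).1.
rewrite (eq_bigr (fun=> 2%N)) => [|i _]; last exact: (alternating_factor i).1.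
by rewrite sum_nat_const card_ord; lia.
Qed.

Lemma lead_alternating : lead_coef alternating = ((2 * k) ^ d)%:Z.
Proof.
rewrite /alternating lead_coef_prod (eq_bigr (fun=> (2 * k)%:Z)) => [|i _]; last first.
  exact: (alternating_factor i).2.
by rewrite prodr_const card_ord -natz -natrX natz.
Qed.

(** At the points j/k with j <= d, a polynomial of degree at most d is at most (d+1) d^d times its
    largest coefficient. The margin exceeds this factor, so [small] cannot change the signs of the
    scaled [alternating] there. *)
Definition margin : nat := (d.+1 * d ^ d).+1.

Variables (n : nat) (J : {poly int}).
Hypothesis JB : J \in box d.+1 n 0.

Definition special_poly : {poly int} :=
  'X^d + 2%:P * 'X^(d.-1) + 6%:P + 36%:P * ((margin * n)%:Z *: alternating + J).

Let small : {poly int} := 'X^d + 2%:P * 'X^(d.-1) + 6%:P + 36%:P * J.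

Lemma special_polyE : special_poly = (36 * (margin * n))%:Z *: alternating + small.
Proof.
rewrite /special_poly /small mulrDr -!mul_polyC mulrA -polyCM addrCA; congr (_ + _).
Qed.

Lemma coef_small i : small`_i =
  (i == d)%:Z + 2 * (i == d.-1)%:Z + 6 * (i == 0%N)%:Z + 36 * J`_i.
Proof.
rewrite /small !coefD coefXn !coefCM coefXn coefC.
by case: (i == d); case: (i == d.-1); case: (i == 0%N).
Qed.

Lemma n_gt0 : (0 < n)%N.
Proof. by have [_ /(_ 0%N isT)] := boxP JB; lia. Qed.

(** The coefficients of J are at most n - 1, which leaves 36 for the fixed terms 1, 2 and 6. *)
Lemma small_bound i : (i < d.+1)%N -> 0 <= small`_i <= (36 * n)%:Z.
Proof.
move=> lt; have [_ /(_ i lt)] := boxP JB; rewrite coef_small.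
by case: (i =P d); case: (i =P d.-1); case: (i =P 0%N) => /=; lia.
Qed.

Lemma size_small : (size small <= d.+1)%N.
Proof.
apply/leq_sizeP => j jd; rewrite coef_small; have [sJ _] := boxP JB.
rewrite (nth_default _ (leq_trans sJ jd)).
by have [-> [-> ->]] : (j == d) = false /\ (j == d.-1) = false /\ (j == 0%N) = false by lia.
Qed.

Let lead_special : special_poly`_d = (36 * (margin * n) * (2 * k) ^ d)%:Z + small`_d.
Proof.
rewrite special_polyE coefD coefZ.
have := lead_alternating; rewrite /lead_coef size_alternating /= => ->.
by rewrite !PoszM.
Qed.

Let top_bounds : (36 * (margin * n) * (2 * k) ^ d)%:Z <= special_poly`_d <=
  (36 * (margin * n) * (2 * k) ^ d + 36 * n)%:Z.
Proof.
rewrite lead_special; have := small_bound (ltnSn d).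
by move: (36 * _ * _)%N (small`_d) => a b; lia.
Qed.

Let n_le_top : (n <= 36 * (margin * n) * (2 * k) ^ d)%N.
Proof.
have p0 : (0 < (2 * k) ^ d)%N by rewrite expn_gt0 muln_gt0 k0.
have -> : (36 * (margin * n) * (2 * k) ^ d = n * (36 * margin * (2 * k) ^ d))%N by ring.
by apply: leq_pmulr; rewrite !muln_gt0 p0.
Qed.

Lemma size_special_poly : size special_poly = d.+1.
Proof.
apply/eqP; rewrite eqn_leq; apply/andP; split.
  rewrite special_polyE; apply: leq_trans (size_polyD _ _) _; rewrite geq_max size_small andbT.
  by apply: leq_trans (size_scale_leq _ _) _; rewrite size_alternating.
rewrite ltnNge; apply/negP => le; have := top_bounds; rewrite nth_default //.
by move: n_le_top n_gt0; move: (36 * _ * _)%N => a; lia.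
Qed.

Lemma special_special_poly : special d special_poly.
Proof. by split; [exact: size_special_poly | eexists]. Qed.

Lemma special_poly_alternate j : (j < d)%N ->
  (map_poly intr special_poly).[j%:R / k%:R] * (map_poly intr special_poly).[j.+1%:R / k%:R] <
    0 :> R.
Proof.
move=> jd; have hR := norm_absolute_value R.
have value i : (map_poly intr special_poly).[i%:R / k%:R] =
    (36 * (margin * n))%:R * (test_value i)%:~R + (map_poly intr small).[i%:R / k%:R] :> R.
  rewrite special_polyE rmorphD /= map_polyZ hornerD hornerZ alternating_test.
  by rewrite /= pmulrn.
have kR : 0 < k%:R :> R by rewrite ltr0n.
have d1 : 1 <= d%:R :> R by rewrite ler1n; lia.
have err i : (i <= d)%N -> `|(map_poly intr small).[i%:R / k%:R]| < (36 * (margin * n))%:R :> R.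
  move=> id; apply: le_lt_trans (_ : (d.+1 * (36 * n))%:R * (d ^ d)%:R < _).
    apply: (nrm_horner_le hR size_small); rewrite ?ler0n //.
      by move=> e /small_bound /andP[s0 s1]; rewrite ger0_norm.
    move=> e le; rewrite natrX; apply: le_trans (_ : d%:R ^+ e <= _).
      have q0 : 0 <= i%:R / k%:R :> R by rewrite divr_ge0.
      rewrite ger0_norm //; apply: lerXn2r; rewrite ?nnegrE //.
      by rewrite ler_pdivrMr // -natrM ler_nat; nia.
    by apply: ler_weXn2l.
  by rewrite -natrM ltr_nat /margin; have := n_gt0; move: (d ^ d)%N => e; nia.
have vge1 i : 1 <= `|(test_value i)%:~R| :> R.
  have := test_value_neq0 i; rewrite -intr_norm; move: (test_value i) => v v0.
  have v1 : 1 <= `|v| by lia.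
  by rewrite -(ler_int R) in v1.
rewrite !value; apply: sign_perturb;
  [exact: vge1 | exact: vge1 | exact: err (ltnW jd) | exact: err |].
by rewrite -rmorphM ltrz0 test_value_alternate.
Qed.

(** Each of the d intervals between consecutive points j/k contains a zero by the intermediate value
    theorem, and the degree is d. *)
Lemma special_poly_zeros : exists y : nat -> R,
  (forall i, (i < d)%N -> i%:R / k%:R < y i < i.+1%:R / k%:R) /\
  perm_eq (czeros R special_poly) [seq (y i)%:C%C | i <- iota 0 d].
Proof.
have kR : 0 < k%:R :> R by rewrite ltr0n.
have mono i j : (i <= j)%N -> i%:R / k%:R <= j%:R / k%:R :> R.
  by move=> ij; rewrite ler_pM2r ?invr_gt0 // ler_nat.
have /choice [y Hy] : forall i, exists x : R, (i < d)%N ->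
    (i%:R / k%:R < x < i.+1%:R / k%:R) && root (map_poly intr special_poly) x.
  move=> i; have [lt|_] := ltnP i d; last by exists 0.
  have [x xi rx] := polyrcf.poly_ivtoo (mono _ _ (leqnSn i)) (special_poly_alternate lt).
  by exists x => _; rewrite rx andbT; move: xi; rewrite in_itv.
have yi i : (i < d)%N -> i%:R / k%:R < y i < i.+1%:R / k%:R by move=> /Hy /andP[].
exists y; split=> //.
have lty i j : (i < j)%N -> (j < d)%N -> y i < y j.
  move=> ij jd; have /andP[_ h1] := yi i (ltn_trans ij jd); have /andP[h2 _] := yi j jd.
  by apply: lt_trans h1 _; apply: le_lt_trans (mono _ _ ij) h2.
have A0 : special_poly != 0 by rewrite -size_poly_gt0 size_special_poly.
have lA : lead_coef (map_poly intr special_poly : {poly C}) = (lead_coef special_poly)%:~R.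
  by rewrite lead_coef_map_inj //; apply: intr_inj.
apply: czeros_perm => //; rewrite -lA; apply: all_roots_prod_XsubC.
- by rewrite size_map_inj_poly //;
  [rewrite size_special_poly size_map size_iota | exact: intr_inj].
- rewrite all_map; apply/allP => i; rewrite mem_iota add0n => /andP[_ lt] /=.
  have /andP[_ /eqP ry] := Hy i lt.
  have -> : map_poly intr special_poly = map_poly (real_complex R) (map_poly intr special_poly).
    by apply/polyP => e; rewrite !coef_map /= rmorph_int.
  by rewrite rootE horner_map ry rmorph0.
rewrite uniq_rootsE map_inj_in_uniq ?iota_uniq // => i j.
rewrite !mem_iota !add0n => /andP[_ id] /andP[_ jd] [] e.
by case: (ltngtP i j) => // lt; [have := lty i j lt jd | have := lty j i lt id]; rewrite e ltxx.
Qed.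

Lemma special_poly_nzeros : nzeros_in_disk R special_poly = k.
Proof.
have [y [Hy yp]] := special_poly_zeros; have kR : 0 < k%:R :> R by rewrite ltr0n.
rewrite /nzeros_in_disk (seq.permP yp) count_map.
have -> : count (preim (fun i => (y i)%:C%C) (fun z => @cabs R z < 1)) (iota 0 d) =
    count (fun i => (i < k)%N) (iota 0 d).
  apply: eq_in_count => i; rewrite mem_iota add0n => /andP[_ lt] /=.
  have /andP[y1 y2] := Hy i lt.
  have y0 : 0 < y i by apply: le_lt_trans y1; rewrite divr_ge0.
  rewrite /cabs /= expr0n addr0 sqrtr_sqr gtr0_norm //.
  have [ik|ki] := ltnP i k.
    by apply: lt_le_trans y2 _; rewrite ler_pdivrMr // mul1r ler_nat.
  by apply/negbTE; rewrite -leNgt; apply: le_trans (ltW y1); rewrite ler_pdivlMr // mul1r ler_nat.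
rewrite -(subnKC (ltnW kd)) iotaD count_cat add0n.
have /eqP -> : count (fun i => (i < k)%N) (iota 0 k) == k.
  by rewrite -[X in _ == X](size_iota 0) -all_count; apply/allP => i; rewrite mem_iota.
rewrite [X in (_ + X)%N](_ : _ = 0%N) ?addn0 //; apply/eqP; rewrite eqn0Ngt -has_count.
by apply/hasPn => i; rewrite mem_iota -leqNgt => /andP[].
Qed.

(** The leading coefficient lies between n and a constant times n, and the zeros lie between 0 and
    d. *)
Lemma special_poly_mahler : n%:R <= mahler R special_poly <=
  ((36 * (margin * (2 * k) ^ d).+1) * d ^ d * n)%:R.
Proof.
have [y [Hy yp]] := special_poly_zeros; have kR : 0 < k%:R :> R by rewrite ltr0n.
rewrite /mahler (perm_big _ yp) /= big_map /lead_coef size_special_poly /=.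
have /andP[t1 t2] := top_bounds; have n1 := n_le_top.
have d1 : 1 <= d%:R :> R by rewrite ler1n; lia.
have t0 : 0 <= special_poly`_d by apply: le_trans t1.
rewrite ger0_norm //.
have prod_ge1 (s : seq nat) : 1 <= \prod_(i <- s) Num.max 1 (@cabs R (y i)%:C%C).
  elim: s => [|i s IH]; first by rewrite big_nil.
  by rewrite big_cons -[leLHS]mulr1; apply: ler_pM => //; rewrite le_max lexx.
have top_n : n%:R <= (special_poly`_d)%:~R :> R.
  by rewrite -[leLHS]/(n%:Z%:~R) ler_int; apply: le_trans t1; rewrite lez_nat.
apply/andP; split; first by rewrite -[leLHS]mulr1; apply: ler_pM.
apply: le_trans (_ : (36 * (margin * n) * (2 * k) ^ d + 36 * n)%:R * (d ^ d)%:R <= _).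
  apply: ler_pM; [by rewrite ler0z | exact: le_trans ler01 (prod_ge1 _) | |].
    by rewrite -[leRHS]/(_%:Z%:~R) ler_int.
  rewrite natrX -[X in _ <= _ ^+ X](size_iota 0 d).
  have : forall i, i \in iota 0 d -> (i < d)%N by move=> i; rewrite mem_iota.
  elim: (iota 0 d) => [|i s IH] hs; first by rewrite big_nil.
  rewrite big_cons [size _]/= [leRHS]exprS; apply: ler_pM; rewrite ?le_max ?ler01 //.
  - exact: le_trans ler01 (prod_ge1 _).
  - have id : (i < d)%N by apply: hs; rewrite mem_head.
    have /andP[y1 y2] := Hy i id.
    have y0 : 0 < y i by apply: le_lt_trans y1; rewrite divr_ge0.
    rewrite ge_max d1 /cabs /= expr0n addr0 sqrtr_sqr gtr0_norm //.
    apply: le_trans (ltW y2) _; rewrite ler_pdivrMr // -natrM ler_nat; nia.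
  - by apply: IH => e es; apply: hs; rewrite inE es orbT.
rewrite -natrM ler_nat; move: margin ((2 * k) ^ d)%N (d ^ d)%N => u v w.
by rewrite leq_eqVlt; apply/orP; left; apply/eqP; ring.
Qed.

End SpecialRoots.

Lemma root_bound (N r : nat) : (0 < r)%N ->
  exists f : nat, (f ^ r <= N)%N /\ forall x, (x ^ r <= N)%N -> (x <= f)%N.
Proof.
move=> r0; have ex : exists f : nat, (f ^ r <= N)%N by exists 0%N; rewrite exp0n.
have ub f : (f ^ r <= N)%N -> (f <= N)%N.
  case: f => // f; apply: leq_trans; exact: (@leq_pexp2l f.+1 1 r).
by case: (ex_maxnP ex ub) => f hf fmax; exists f.
Qed.

Lemma fibers_union (T Y : eqType) (E : Y -> seq T) (D : T -> Y) (t : seq Y) (g : nat) : uniq t ->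
  (forall y, y \in t -> [/\ uniq (E y), forall x, x \in E y -> D x = y & (g <= size (E y))%N]) ->
  exists U : seq T, [/\ uniq U, (g * size t <= size U)%N &
    forall x, x \in U -> (D x \in t) && (x \in E (D x))].
Proof.
elim: t => [|y t IH] /=; first by exists [::]; split; rewrite ?muln0.
move=> /andP[yt ut] hE; have [|U [uU sU hU]] := IH ut.
  by move=> z zt; apply: hE; rewrite inE zt orbT.
have [uy dy gy] := hE y (mem_head _ _); exists (E y ++ U); split.
- rewrite cat_uniq uy uU andbT; apply/hasPn => x /hU /andP[xt _]; apply/negP => /dy e.
  by rewrite -e xt in yt.
- by rewrite size_cat mulnS leq_add.
move=> x; rewrite mem_cat => /orP[xE|/hU /andP[h1 h2]]; first by rewrite (dy x xE) mem_head.
by rewrite inE h1 orbT.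
Qed.

(** * Cardinalities *)

Section CardSet.

Variable (T : choiceType) (S : set T).

Lemma card_set_seq : finite_set S ->
  exists s : seq T, [/\ uniq s, size s = card_set _ S & forall x, x \in s <-> S x].
Proof.
move=> fS; exists (finmap.enum_fset (fset_set S)); split=> //.
move=> x; have e := in_fset_set fS x; split=> [h|h]; first by apply: set_mem; rewrite -e.
by have := mem_set h; rewrite -e.
Qed.

Lemma card_set_ge (s : seq T) : finite_set S -> uniq s -> (forall x, x \in s -> S x) ->
  (size s <= card_set _ S)%N.
Proof.
move=> fS us sS; have [t [ut <- ht]] := card_set_seq fS.
by apply: uniq_leq_size => // x /sS /ht.
Qed.

Lemma card_set_pow_le (N r : nat) : (0 < r)%N ->
  (forall s : seq T, uniq s -> (forall x, x \in s -> S x) -> (size s ^ r <= N)%N) ->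
  finite_set S /\ (card_set _ S ^ r <= N)%N.
Proof.
move=> r0 h; have fS : finite_set S.
  apply: contrapT => /(infinite_set_fset N.+1) [B BS NB].
  have := h (finmap.enum_fset B) (finmap.fset_uniq B) (fun x xB => BS x xB).
  apply/negP; rewrite -ltnNge; apply: leq_trans NB _.
  by case: (size _) => // n; apply: (@leq_pexp2l n.+1 1 r).
split=> //; have [s [us <- hs]] := card_set_seq fS.
by apply: h => // x /hs.
Qed.

End CardSet.

Section Counts.

Variables (R : realType).

Lemma Atilde_in k d (M : R) A : Atilde R k d M A <->
  [/\ size A = d.+1, mahler R A = M & nzeros_in_disk R A = k].
Proof. by split=> [[? [? ?]]|[? ? ?]]. Qed.

Lemma total_bound (d : nat) : exists C : nat, (0 < C)%N /\
  forall (X : nat) (s : seq {poly int}), uniq s ->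
  (forall A, A \in s -> size A = d.+1 /\ mahler R A <= X%:R) -> (size s <= C * X ^ d.+1)%N.
Proof.
exists ((2 * 2 ^ d).+1 ^ d.+1)%N; rewrite expn_gt0; split=> // X s us hs.
case: X hs => [|X] hs.
  case: s us hs => [|A s] _ hs; first by rewrite /= leq0n.
  have [sA mA] := hs A (mem_head _ _); have A0 : A != 0 by rewrite -size_poly_gt0 sA.
  by have := le_trans (mahler_ge1 R A0) mA; rewrite ler10.
rewrite -expnMn; apply: leq_trans (_ : (2 * (2 ^ d * X.+1)).+1 ^ d.+1 <= _)%N.
  apply: size_bounded_polys => // A As; have [sA mA] := hs A As; rewrite sA; split=> // i.
  rewrite -(ler_int R); apply: le_trans (coef_mahler R A i) _.
  by rewrite sA /= -[leRHS]/((2 ^ d * X.+1)%:R) natrM natrX ler_wpM2l.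
by apply: leq_exp2rW; nia.
Qed.

Lemma Atilde_finite k d (M : R) : finite_set (Atilde R k d M).
Proof.
have [C [_ HC]] := total_bound d.
have [|//] := @card_set_pow_le _ (Atilde R k d M) (C * (Num.truncn M).+1 ^ d.+1) 1 isT.
move=> s us hs; rewrite expn1; apply: HC => // A /hs /Atilde_in [sA -> _].
by split=> //; apply/ltW/truncnS_gt.
Qed.

Lemma Btilde_value k d (M : R) : Btilde R k d M <-> exists A, Atilde R k d M A.
Proof.
split=> [[_ [A hA]]|[A hA]]; first by exists A; apply: set_mem hA.
have [sA <- _] := (Atilde_in _ _ _ _).1 hA; split; first by apply: mahler_ge1;
  rewrite -size_poly_gt0 sA.
exists A; apply: mem_set; apply/Atilde_in; split=> //.
by have [] := (Atilde_in _ _ _ _).1 hA.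
Qed.

Lemma BtildeM_in k d (M v : R) : BtildeM R k d M v <-> Btilde R k d v /\ v <= M.
Proof.
split=> [[h /andP[_ vM]]|[h vM]]; split=> //=.
by have [v1 _] := h; rewrite v1.
Qed.

Lemma card_BtildeM_le (d : nat) : exists C : nat, (0 < C)%N /\ forall (k X : nat) (M : R),
  M <= X%:R ->
  finite_set (BtildeM R k d M) /\ (card_set _ (BtildeM R k d M) <= C * X ^ d.+1)%N.
Proof.
have [C [C0 HC]] := total_bound d; exists C; split=> // k X M MX.
suff h : forall s : seq R, uniq s -> (forall v, v \in s -> BtildeM R k d M v) ->
  (size s ^ 1 <= C * X ^ d.+1)%N.
  by have := card_set_pow_le (isT : 0 < 1)%N h; rewrite expn1.
move=> s us hs; rewrite expn1.
have /choice [P HP] : forall v : R, exists A, v \in s -> Atilde R k d v A.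
  move=> v; have [vs|_] := boolP (v \in s); last by exists 0.
  have [bv _] := (BtildeM_in _ _ _ _).1 (hs v vs).
  by have [A hA] := (Btilde_value _ _ _).1 bv; exists A.
rewrite -(size_map P); apply: HC.
  rewrite map_inj_in_uniq // => v w vs ws e.
  have [_ <- _] := (Atilde_in _ _ _ _).1 (HP v vs).
  by have [_ <- _] := (Atilde_in _ _ _ _).1 (HP w ws); rewrite e.
move=> A /mapP [v vs ->]; have [-> -> _] := (Atilde_in _ _ _ _).1 (HP v vs); split=> //.
by have [_] := (BtildeM_in _ _ _ _).1 (hs v vs) => /le_trans; apply.
Qed.

Lemma card_BtildeM_mono k d (M M' : R) : M <= M' ->
  (card_set _ (BtildeM R k d M) <= card_set _ (BtildeM R k d M'))%N.
Proof.
move=> MM'; have [C [_ HC]] := card_BtildeM_le d.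
have [f _] := HC k _ _ (ltW (truncnS_gt M)); have [f' _] := HC k _ _ (ltW (truncnS_gt M')).
have [s [us <- hs]] := card_set_seq f; apply: card_set_ge => // v /hs /BtildeM_in [bv vM].
by apply/BtildeM_in; split=> //; apply: le_trans MM'.
Qed.

Section Generic.

Variables (k d : nat).
Hypothesis kd : (0 < k < d)%N.

Lemma card_Atilde_le r : (0 < r)%N -> exists C : nat, (0 < C)%N /\
  forall (M : R) (X : nat), M <= X%:R ->
    (card_set _ (Atilde R k d M) ^ r <= C * X ^ (maxn k (d - k) * r).+1)%N.
Proof.
move=> r0; have [C [C0 HC]] := @Atilde_bound R k d r kd r0; exists C; split=> // M X MX.
apply: (card_set_pow_le r0 _).2 => s us hs.
by apply: (HC M) => // A /hs As; apply: mem_set.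
Qed.

(** The n^(d+1) polynomials built from the box have measures between n and D n. By [special_bound] a
    value is shared by at most f of them, where f^r <= C D n, so there are at least n^(d+1) / f
    values. *)
Lemma special_values r : (0 < r)%N -> exists C D : nat, [/\ (0 < C)%N, (0 < D)%N &
  forall n : nat, (0 < n)%N -> exists T : seq R, [/\ uniq T,
    forall v, v \in T -> [/\ Btilde R k d v, n%:R <= v & v <= (D * n)%:R],
    (0 < size T)%N & (n ^ (d.+1 * r) <= C * n * size T ^ r)%N]].
Proof.
have /andP[k0 kd'] := kd.
move=> r0; have [C [C0 HC]] := special_bound R kd r0.
pose D := (36 * (margin d * (2 * k) ^ d).+1 * d ^ d)%N.
have D0 : (0 < D)%N by rewrite /D !muln_gt0 expn_gt0 (ltn_trans k0 kd').
exists (C * D)%N, D; rewrite muln_gt0 C0 D0; split=> // n n0.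
pose S := [seq special_poly k d n J | J <- box d.+1 n 0].
have uS : uniq S.
  rewrite map_inj_uniq ?box_uniq // => J J'; rewrite /special_poly => /addrI /mulfI.
  rewrite polyC_eq0 => /(_ isT); exact: addrI.
have SA A : A \in S -> [/\ special d A, nzeros_in_disk R A = k &
    n%:R <= mahler R A <= (D * n)%:R].
  case/mapP => J JB ->; split; first exact: special_special_poly.
    exact: special_poly_nzeros.
  exact: special_poly_mahler.
pose T := undup (map (mahler R) S).
have sS : size S = (n ^ d.+1)%N by rewrite size_map size_box.
have S0 : (0 < size S)%N by rewrite sS expn_gt0 n0.
have [f [fN fmax]] := root_bound (C * (D * n)) r0.
have key : (size S <= f * size T)%N.
  apply: size_le_fibers => A AS; apply: fmax.
  have [_ _ /andP[_ mA]] := SA A AS.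
  apply: (HC (mahler R A)) => //; first exact: filter_uniq.
    move=> B; rewrite mem_filter => /andP[/eqP mB BS]; have [[sB _] kB _] := SA B BS.
    by apply/mem_set/Atilde_in.
  by move=> B; rewrite mem_filter => /andP[_ BS]; have [] := SA B BS.
exists T; split.
- exact: undup_uniq.
- move=> v; rewrite mem_undup => /mapP [A AS ->]; have [[sA _] kA /andP[m1 m2]] := SA A AS.
  by split=> //; apply/Btilde_value; exists A; apply/Atilde_in.
- by rewrite lt0n; apply: contraTneq S0 => T0; rewrite -leqNgt; move: key; rewrite T0 muln0.
by rewrite expnM -sS; apply: leq_trans (leq_exp2rW r key) _;
  rewrite expnMn leq_mul2r -mulnA fN orbT.
Qed.

Lemma card_BtildeM_ge r : (0 < r)%N -> exists C D : nat, [/\ (0 < C)%N, (0 < D)%N &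
  forall n : nat, (0 < n)%N ->
   (n ^ (d.+1 * r).-1 <= C * card_set _ (BtildeM R k d (D * n)%:R) ^ r)%N].
Proof.
move=> r0; have [C [D [C0 D0 H]]] := special_values r0; exists C, D; split=> // n n0.
have [T [uT hT _ le]] := H n n0; have [C' [_ HC']] := card_BtildeM_le d.
have [fB _] := HC' k _ _ (lexx ((D * n)%:R : R)).
have dr : (0 < d.+1 * r)%N by rewrite muln_gt0.
have leT : (size T <= card_set _ (BtildeM R k d (D * n)%:R))%N.
  by apply: card_set_ge => // v /hT [bv _ vD]; apply/BtildeM_in.
rewrite -(leq_pmul2l n0) -expnS prednK //; apply: leq_trans le _.
by rewrite mulnCA mulnA leq_mul2l leq_exp2rW // orbT.
Qed.

(** Pigeonhole: if each value from [special_values] were attained more than f times, by arbitrary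
    polynomials, the union of the fibers would exceed the bound of [total_bound] for measures up to
    D n. *)
Lemma small_card_Atilde r : (0 < r)%N -> exists K : nat, forall n : nat, (0 < n)%N ->
  exists M : R, [/\ Btilde R k d M, n%:R <= M & (card_set _ (Atilde R k d M) ^ r <= K * n)%N].
Proof.
move=> r0; have [C [D [C0 D0 H]]] := special_values r0; have [C1 [C10 HC1]] := total_bound d.
exists ((C1 * D ^ d.+1) ^ r * C)%N => n n0; have [T [uT hT T0 le]] := H n n0.
set N := (_ * n)%N; have [f [fN fmax]] := root_bound N r0.
have [/hasP [v vT cv]|/hasPn no] := boolP (has (fun v => card_set _ (Atilde R k d v) <= f)%N T).
  have [bv nv _] := hT v vT; exists v; split=> //; apply: leq_trans fN; exact: leq_exp2rW.
have /choice [E HE] : forall v : R, exists s : seq {poly int}, [/\ uniq s,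
    size s = card_set _ (Atilde R k d v) & forall A, A \in s <-> Atilde R k d v A].
  by move=> v; apply: card_set_seq; apply: Atilde_finite.
have [|U [uU sU hU]] := @fibers_union _ _ E (mahler R) T f.+1 uT.
  move=> v vT; have [us ss hs] := HE v; split=> //; first by move=> A /hs /Atilde_in [].
  by rewrite ss ltnNge; apply: no.
have leU : (size U <= C1 * (D * n) ^ d.+1)%N.
  apply: HC1 => // A /hU /andP[mT AE]; have [_ _ mD] := hT _ mT; split=> //.
  by have [_ _ hs] := HE (mahler R A); have [] := (Atilde_in _ _ _ _).1 ((hs A).1 AE).
suff : (f.+1 ^ r <= N)%N by move=> /fmax; rewrite ltnn.
have T0r : (0 < size T ^ r)%N by rewrite expn_gt0 T0.
rewrite -(leq_pmul2r T0r) -expnMn; apply: leq_trans (leq_exp2rW r (leq_trans sU leU)) _.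
rewrite /N [((D * n) ^ _)%N]expnMn mulnA expnMn -[((n ^ d.+1) ^ r)%N]expnM.
apply: leq_trans (leq_mul (leqnn _) le) _.
by rewrite leq_eqVlt; apply/orP; left; apply/eqP; rewrite -!mulnA.
Qed.

End Generic.

End Counts.

(** * Counts from dominant coefficients and linear factors *)

Section DominantCounts.

Variables (R : realType).
Local Notation C := R[i].

(** The box side m has to satisfy d m < n and yet be of order n; it is (n-1)/d rounded down, or n
    when d = 0. *)
Lemma dominant_step (d n : nat) : (d < n)%N ->
  exists m, [/\ (0 < m)%N, (d * m < n)%N & (n <= 2 * d.+1 * m)%N].
Proof.
case: d => [|d] lt; first by exists n; split=> //; lia.
exists (n.-1 %/ d.+1)%N; have h := divn_eq n.-1 d.+1; have h2 := ltn_pmod n.-1 (ltn0Sn d).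
have m0 : (0 < n.-1 %/ d.+1)%N by rewrite divn_gt0 //; lia.
split=> //; first by rewrite mulnC; lia.
by move: h h2 m0; move: (n.-1 %/ d.+1)%N (n.-1 %% d.+1)%N => q r; nia.
Qed.

Lemma dominant_family k d n : k = 0%N \/ k = d -> (d < n)%N -> exists s : seq {poly int},
  [/\ uniq s, forall A, A \in s -> Atilde R k d n%:R A & (n ^ d <= (2 * d.+1) ^ d * size s)%N].
Proof.
move=> hk dn; have [m [m0 dmn nm]] := dominant_step dn.
have le : (n ^ d <= (2 * d.+1) ^ d * m ^ d)%N by rewrite -expnMn leq_exp2rW.
case: hk => ->.
  exists [seq B * 'X + n%:Z%:P | B <- box d m 1]; split.
  - rewrite map_inj_uniq ?box_uniq // => B B' /addIr.
    by apply: mulIf; rewrite polyX_eq0.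
  - by move=> A /mapP [B BB ->]; apply: set_mem; apply: (dominant_const R dmn).
  - by rewrite size_map size_box.
exists [seq n%:Z *: 'X^d + B | B <- box d m 1]; split.
- by rewrite map_inj_uniq ?box_uniq // => B B' /addrI.
- by move=> A /mapP [B BB ->]; apply: set_mem; apply: (dominant_lead R dmn).
- by rewrite size_map size_box.
Qed.

Lemma linear_power (a : int) (j : nat) :
  perm_eq (czeros R (('X - a%:P) ^+ j)) (nseq j a%:~R).
Proof.
have m : ('X - a%:P) ^+ j \is monic by apply/monic_exp/monicXsubC.
apply: czeros_perm; first exact: monic_neq0.
rewrite (monicP m) scale1r rmorphXn /= rmorphB /= map_polyX map_polyC /=.
by rewrite big_nseq iter_mulr_1.
Qed.

Lemma mahler_linear_power (a : int) (j : nat) : `|a| <= 1 -> mahler R (('X - a%:P) ^+ j) = 1.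
Proof.
move=> a1; have hC := cabs_absolute_value R.
have m : ('X - a%:P) ^+ j \is monic by apply/monic_exp/monicXsubC.
rewrite /mahler (monicP m) normr1 mul1r (perm_big _ (linear_power a j)) /=.
rewrite big_seq big1 // => z; rewrite mem_nseq => /andP[_ /eqP ->].
by apply/max_idPl; rewrite (nrm_int hC) -[leRHS]/(1%:~R) ler_int.
Qed.

Lemma nzeros_linear_power (a : int) (j : nat) :
  nzeros_in_disk R (('X - a%:P) ^+ j) = (j * (a == 0))%N.
Proof.
rewrite /nzeros_in_disk (seq.permP (linear_power a j)) count_nseq mulnC.
rewrite (nrm_int (cabs_absolute_value R)) -[1]/(1%:~R) ltr_int; congr (_ * _)%N.
by congr nat_of_bool; apply/idP/eqP; lia.
Qed.

Lemma size_linear_power (a : int) (j : nat) : size (('X - a%:P) ^+ j) = j.+1.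
Proof. by rewrite size_exp_XsubC. Qed.

(** The new zeros lie inside the disk for a = 0 and on the circle for a = 1 or a = -1. In both cases
    the measure is unchanged. *)
Lemma Atilde_mul_linear k d (M : R) A (a : int) (j : nat) : `|a| <= 1 -> Atilde R k d M A ->
  Atilde R (k + j * (a == 0)) (d + j) M (A * ('X - a%:P) ^+ j).
Proof.
move=> a1 hA; have [sA mA kA] := (Atilde_in _ _ _ _).1 hA.
have A0 : A != 0 by rewrite -size_poly_gt0 sA.
have m : ('X - a%:P) ^+ j \is monic by apply/monic_exp/monicXsubC.
have AB0 : A * ('X - a%:P) ^+ j != 0 by apply: mulf_neq0 => //; apply: monic_neq0.
apply/Atilde_in; split.
- by rewrite size_Mmonic // sA size_linear_power addnS.
- by rewrite mahler_mul // mA mahler_linear_power // mulr1.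
- by rewrite nzeros_mul // kA nzeros_linear_power.
Qed.

Lemma card_Atilde_ge_mul k d j n (a : int) : `|a| <= 1 -> k = 0%N \/ k = d -> (d < n)%N ->
  Btilde R (k + j * (a == 0)) (d + j) n%:R /\
  (n ^ d <= (2 * d.+1) ^ d * card_set _ (Atilde R (k + j * (a == 0)) (d + j) n%:R))%N.
Proof.
move=> a1 hk dn; have [s [us hs le]] := dominant_family hk dn.
have m : ('X - a%:P) ^+ j \is monic by apply/monic_exp/monicXsubC.
have hA A : A \in s -> Atilde R (k + j * (a == 0)) (d + j) n%:R (A * ('X - a%:P) ^+ j).
  by move=> /hs; apply: Atilde_mul_linear.
have s0 : (0 < size s)%N.
  rewrite lt0n; apply: contraTneq le => ->; rewrite muln0 -ltnNge expn_gt0.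
  by rewrite (leq_ltn_trans _ dn).
split.
  apply/Btilde_value; exists (s`_0 * ('X - a%:P) ^+ j); apply: hA; exact: mem_nth.
apply: leq_trans le _; rewrite leq_mul2l -(size_map (fun A => A * ('X - a%:P) ^+ j)).
rewrite card_set_ge ?orbT //; first exact: Atilde_finite.
  rewrite map_inj_uniq // => A B; exact/mulIf/monic_neq0.
by move=> A /mapP [B Bs ->]; apply: hA.
Qed.

Lemma card_Atilde_dominant k d n : k = 0%N \/ k = d -> (d < n)%N ->
  Btilde R k d n%:R /\ (n ^ d <= (2 * d.+1) ^ d * card_set _ (Atilde R k d n%:R))%N.
Proof.
move=> hk dn; have := @card_Atilde_ge_mul k d 0 n 0 _ hk dn.
by rewrite mul0n !addn0; apply; rewrite normr0.
Qed.

Lemma card_Atilde_integer k d n : (0 < k < d)%N -> (d < n)%N ->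
  Btilde R k d n%:R /\
  (n ^ maxn k (d - k) <= (2 * d.+1) ^ d * card_set _ (Atilde R k d n%:R))%N.
Proof.
move=> /andP[k0 kd] dn.
have b e : (e <= d)%N -> ((2 * e.+1) ^ e <= (2 * d.+1) ^ d)%N.
  move=> ed; apply: leq_trans (leq_exp2rW e _) (_ : (2 * d.+1) ^ e <= _)%N.
    by rewrite leq_mul2l ltnS ed.
  by rewrite leq_pexp2l.
have [kn dkn] : (k < n)%N /\ (d - k < n)%N by lia.
have [h1 h1'] := @card_Atilde_ge_mul k k (d - k) n 1 isT (or_intror erefl) kn.
have [h2 h2'] := @card_Atilde_ge_mul 0 (d - k) k n 0 isT (or_introl erefl) dkn.
rewrite /= muln0 addn0 subnKC ?(ltnW kd) // in h1 h1'.
rewrite eqxx muln1 add0n subnK ?(ltnW kd) // in h2 h2'.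
split=> //; rewrite /maxn; case: ifP => _.
  by apply: leq_trans h2' _; rewrite leq_mul2r b ?orbT ?leq_subr.
by apply: leq_trans h1' _; rewrite leq_mul2r b ?orbT ?(ltnW kd).
Qed.

Section Extreme.

Variables (k d : nat).
Hypothesis hk : k = 0%N \/ k = d.

Lemma extreme_value : exists2 j, (j <= d)%N & forall (M : R) A, Atilde R k d M A ->
  M = `|A`_j|%:~R.
Proof.
case: hk => ->.
  exists 0%N => // M A /Atilde_in [sA <- kA]; apply: mahler_outside => z zA.
  rewrite leNgt; apply/negP => z1; move: kA; apply/eqP; rewrite -lt0n -has_count.
  by apply/hasP; exists z.
exists d => // M A /Atilde_in [sA <- kA]; have A0 : A != 0 by rewrite -size_poly_gt0 sA.
rewrite /mahler /lead_coef sA /= big_seq big1 ?mulr1 // => z zA.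
have /allP h : all (fun z => @cabs R z < 1) (czeros R A).
  by rewrite all_count -/(nzeros_in_disk R A) kA -eqSS size_czeros // sA.
exact/max_idPl/ltW/h.
Qed.

Lemma extreme_nat (M : R) : Btilde R k d M -> exists2 n, (0 < n)%N & M = n%:R.
Proof.
move=> bM; have [A hA] := (Btilde_value _ _ _).1 bM; have [M1 _] := bM.
have [j _ /(_ M A hA) DM] := extreme_value; exists (absz A`_j); last by rewrite DM natr_absz.
by rewrite lt0n; apply: contraTneq M1 => e; rewrite DM -natr_absz e -ltNge ltr01.
Qed.

(** M fixes one coefficient up to sign, so only d coefficients are free. *)
Lemma card_Atilde_extreme_le : exists K : nat, forall (M : R) (X : nat), (0 < X)%N -> M <= X%:R ->
  (card_set _ (Atilde R k d M) <= K * X ^ d)%N.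
Proof.
exists (2 * (2 * 2 ^ d).+1 ^ d)%N => M X X0 MX; have [j jd hj] := extreme_value.
have [s [us <- hs]] := card_set_seq (@Atilde_finite R k d M).
(* This deletes the coefficient at index j and closes the gap. *)
pose tr (A : {poly int}) : {poly int} := \poly_(i < d) A`_(bump j i).
suff half b : (size [seq A : {poly int} <- s | (0 <= A`_j)%R == b] <= (2 * (2 ^ d * X)).+1 ^ d)%N.
  apply: leq_trans (_ : 2 * (2 * (2 ^ d * X)).+1 ^ d <= _)%N; last first.
    by rewrite -mulnA -expnMn leq_mul2l; apply: leq_exp2rW; nia.
  rewrite -(count_predC (fun A : {poly int} => (0 <= A`_j)%R == true) s) mul2n -addnn.
  apply: leq_add; first by rewrite -size_filter; apply: half.
  apply: leq_trans (half false); rewrite size_filter.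
  by apply: sub_count => A /=; case: (0 <= _)%R.
rewrite -(size_map tr); apply: size_bounded_polys.
  rewrite map_inj_in_uniq ?filter_uniq // => A B; rewrite !mem_filter.
  move=> /andP[/eqP bA /hs hA] /andP[/eqP bB /hs hB] e.
  have [sA mA _] := (Atilde_in _ _ _ _).1 hA; have [sB mB _] := (Atilde_in _ _ _ _).1 hB.
  have ej : A`_j = B`_j.
    have /eqP := hj M A hA; rewrite {1}(hj M B hB) eqr_int => /eqP.
    by move: bA bB; case: b => bA bB; lia.
  apply/polyP => i; have [->//|ij] := eqVneq i j.
  have [lt|ge] := ltnP i d.+1; last by rewrite !nth_default ?sA ?sB.
  have lt' : (unbump j i < d)%N by rewrite /unbump; case: (ltnP j i) => ?; lia.
  have := congr1 (fun p : {poly int} => p`_(unbump j i)) e.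
  by rewrite !coef_poly lt' unbumpKcond (negbTE ij).
move=> _ /mapP [A As ->]; split; first exact: size_poly.
move=> i; rewrite coef_poly; case: ifP => _; last by rewrite normr0.
move: As; rewrite mem_filter => /andP[_ /hs /Atilde_in [sA mA _]].
rewrite -(ler_int R); apply: le_trans (coef_mahler R A _) _.
by rewrite sA mA /= -[leRHS]/((2 ^ d * X)%:R) natrM natrX ler_wpM2l.
Qed.

Lemma card_BtildeM_extreme_le (M : R) (X : nat) : M <= X%:R ->
  (card_set _ (BtildeM R k d M) <= X)%N.
Proof.
move=> MX; have [K [_ HK]] := card_BtildeM_le R d; have [fB _] := HK k X M MX.
have [s [us <- hs]] := card_set_seq fB.
rewrite -[leqRHS](size_iota 0) -(size_map (fun i => i.+1%:R : R)).
apply: uniq_leq_size => // v /hs /BtildeM_in [/extreme_nat [n n0 ->] nM].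
have nX : (n <= X)%N by rewrite -(ler_nat R) (le_trans nM).
by apply/mapP; exists n.-1; rewrite ?prednK // mem_iota /= add0n prednK.
Qed.

Lemma card_BtildeM_extreme_ge (n : nat) : (n - d <= card_set _ (BtildeM R k d n%:R))%N.
Proof.
have [K [_ HK]] := card_BtildeM_le R d; have [fB _] := HK k n n%:R (lexx _).
rewrite -[leqLHS](size_iota d.+1) -(size_map (fun i => i%:R : R)).
apply: card_set_ge => //; first by rewrite map_inj_uniq ?iota_uniq // => i i' /eqP;
  rewrite eqr_nat => /eqP.
move=> v /mapP [i hi ->]; move: hi; rewrite mem_iota => /andP[di lt]; apply/BtildeM_in; split.
  exact: (card_Atilde_dominant hk di).1.
by rewrite ler_nat; lia.
Qed.

End Extreme.

End DominantCounts.

(** * Limits *)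

Section LogarithmicRatios.

Variable R : realType.

(** From here on the constant K changes the ratio of logarithms, after division by r, by at most e.
    The summand 1 keeps [ln M] positive. *)
Definition threshold (r : nat) (K e : R) : R := expR (1 + `|ln K| / (r%:R * e)).

Lemma threshold_ln (r : nat) (K e M : R) : (0 < r)%N -> 0 < e -> threshold r K e <= M ->
  [/\ 0 < M, 0 < ln M & `|ln K| <= r%:R * e * ln M].
Proof.
move=> r0 e0 TM; have M0 : 0 < M by apply: lt_le_trans TM; apply: expR_gt0.
have re0 : 0 < r%:R * e by rewrite mulr_gt0 // ltr0n.
have h : 1 + `|ln K| / (r%:R * e) <= ln M.
  by rewrite -(expRK (1 + _)) ler_ln ?posrE ?expR_gt0.
have q0 : 0 <= `|ln K| / (r%:R * e) by rewrite divr_ge0 // ltW.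
split=> //; first lra.
by rewrite mulrC -ler_pdivrMr //; lra.
Qed.

Lemma ratio_le (a r g : nat) (K e M : R) : (0 < r)%N -> 0 < K -> 0 < e -> threshold r K e <= M ->
  g%:R ^+ r <= K * M ^+ a -> ln g%:R / ln M <= a%:R / r%:R + e.
Proof.
move=> r0 K0 e0 /(threshold_ln r0 e0) [M0 t0 hK] le.
have rR : 0 < r%:R :> R by rewrite ltr0n.
(* For g = 0 the ratio is 0, because [ln] vanishes at 0. *)
case: (posnP g) => [->|g0].
  by rewrite ln0 // mul0r addr_ge0 ?divr_ge0 // ltW.
have gR : 0 < g%:R :> R by rewrite ltr0n.
have : ln (g%:R ^+ r) <= ln (K * M ^+ a).
  by rewrite ler_ln ?posrE ?mulr_gt0 ?exprn_gt0.
rewrite lnM ?posrE ?exprn_gt0 // !lnXn // -[_ *+ r]mulr_natl -[_ *+ a]mulr_natl => h.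
rewrite ler_pdivrMr // -(ler_pM2l rR); apply: le_trans h _.
have := ler_norm (ln K); rewrite !mulrDl mulrDr mulrA [_ * (_ / _)]mulrCA mulfV ?gt_eqF // mulr1.
lra.
Qed.

Lemma ratio_ge (a r g : nat) (K e M : R) : (0 < r)%N -> 0 < K -> 0 < e -> threshold r K e <= M ->
  M ^+ a <= K * g%:R ^+ r -> a%:R / r%:R - e <= ln g%:R / ln M.
Proof.
move=> r0 K0 e0 /(threshold_ln r0 e0) [M0 t0 hK] le.
have rR : 0 < r%:R :> R by rewrite ltr0n.
have gR : 0 < g%:R :> R.
  rewrite ltr0n lt0n; apply: contraTneq le => ->.
  by rewrite expr0n gtn_eqF // mulr0 -ltNge exprn_gt0.
have : ln (M ^+ a) <= ln (K * g%:R ^+ r).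
  by rewrite ler_ln ?posrE ?mulr_gt0 ?exprn_gt0.
rewrite lnM ?posrE ?exprn_gt0 // !lnXn // -[_ *+ r]mulr_natl -[_ *+ a]mulr_natl => h.
rewrite ler_pdivlMr // -(ler_pM2l rR).
have := ler_norm (ln K); rewrite !mulrDl mulrDr mulrA [_ * (_ / _)]mulrCA mulfV ?gt_eqF // mulr1.
rewrite mulNr mulrN mulrA; lra.
Qed.

Lemma ln_nat_ge0 (g : nat) : 0 <= ln g%:R :> R.
Proof. by case: g => [|g]; [rewrite ln0 | rewrite ln_ge0 // ler1n]. Qed.

Lemma small_inverse (e : R) : 0 < e -> exists r : nat, (0 < r)%N /\ 1 / r%:R <= e.
Proof.
move=> e0; exists (Num.truncn (1 / e)).+1; split=> //.
by rewrite ler_pdivrMr // mulrC -ler_pdivrMr //; apply/ltW/truncnS_gt.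
Qed.

Lemma nat_double (M : R) : 1 <= M ->
  [/\ (0 < (Num.truncn M).+1)%N, M <= (Num.truncn M).+1%:R & (Num.truncn M).+1%:R <= 2 * M].
Proof.
move=> M1; split=> //; first exact/ltW/truncnS_gt.
by have /andP[h _] := truncn_itv (le_trans ler01 M1); rewrite -natr1; lra.
Qed.

Lemma lim_alongP (S : set R) (f : R -> R) (l : R) :
  (forall M0, exists2 x, S x & M0 <= x) ->
  (forall e, 0 < e -> exists M0, forall x, S x -> M0 <= x -> l - e <= f x <= l + e) ->
  lim_along R S f l.
Proof.
move=> unb h; split=> //; apply/cvgrPdist_le => e e0; have [M0 HM] := h e e0.
exists M0; split; first exact: num_real.
by move=> x /ltW Mx Sx; have := HM x Sx Mx; rewrite ler_norml => /andP[h1 h2]; apply/andP;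
  split; lra.
Qed.

Lemma lim_pinftyP (f : R -> R) (l : R) :
  (forall e, 0 < e -> exists M0, forall x, M0 <= x -> l - e <= f x <= l + e) ->
  lim_pinfty R f l.
Proof.
move=> h; apply/cvgrPdist_le => e e0; have [M0 HM] := h e e0.
exists M0; split; first exact: num_real.
by move=> x /ltW Mx; have := HM x Mx; rewrite ler_norml => /andP[h1 h2]; apply/andP; split; lra.
Qed.

Lemma liminf_alongP (S : set R) (f : R -> R) (l : R) :
  (forall e, 0 < e -> exists M0, forall x, S x -> M0 <= x -> l - e <= f x) ->
  (forall e M0, 0 < e -> exists x, [/\ S x, M0 <= x & f x <= l + e]) ->
  liminf_along R S f = l%:E.
Proof.
move=> lo up; apply/eqP; rewrite eq_le; apply/andP; split.
  apply: ge_ereal_sup => _ [M0 _ <-]; apply/lee_addgt0Pr => e e0.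
  have [x [Sx Mx fx]] := up e M0 e0; apply: le_trans (_ : (f x)%:E <= _)%E.
    by apply: ereal_inf_lbound; exists x.
  by rewrite -EFinD lee_fin.
apply/lee_addgt0Pr => e e0; have [M0 H] := lo e e0.
have -> : l%:E = ((l - e)%:E + e%:E)%E by rewrite -EFinD subrK.
apply: leeD => //; apply: le_trans (ereal_sup_ubound _); last by exists M0.
by apply: le_ereal_inf_tmp => _ [x [Sx Mx] <-]; rewrite lee_fin; apply: H.
Qed.

Lemma limsup_alongP (S : set R) (f : R -> R) (l : R) :
  (forall e, 0 < e -> exists M0, forall x, S x -> M0 <= x -> f x <= l + e) ->
  (forall e M0, 0 < e -> exists x, [/\ S x, M0 <= x & l - e <= f x]) ->
  limsup_along R S f = l%:E.
Proof.
move=> up lo; apply/eqP; rewrite eq_le; apply/andP; split.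
  apply/lee_addgt0Pr => e e0; have [M0 H] := up e e0.
  apply: le_trans (ereal_inf_lbound _) _; first by exists M0.
  by apply: ge_ereal_sup => _ [x [Sx Mx] <-]; rewrite -EFinD lee_fin; apply: H.
apply: le_ereal_inf_tmp => _ [M0 _ <-]; apply/lee_addgt0Pr => e e0.
have [x [Sx Mx fx]] := lo e M0 e0; apply: le_trans (_ : (f x)%:E + e%:E <= _)%E.
  by rewrite -EFinD lee_fin -lerBlDr.
by apply: leeD => //; apply: ereal_sup_ubound; exists x.
Qed.

End LogarithmicRatios.

Section Limits.

Variables (R : realType) (k d : nat).

(** The successor makes the constant positive, as its logarithm is taken later. *)
Lemma natX_le (g r K X a : nat) : (g ^ r <= K * X ^ a)%N -> g%:R ^+ r <= K.+1%:R * X%:R ^+ a :> R.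
Proof.
move=> h; apply: le_trans (_ : (K * X ^ a)%:R <= _); first by rewrite -natrX ler_nat.
by rewrite natrM natrX ler_wpM2r ?exprn_ge0 // ler_nat.
Qed.

Lemma doubleX_le (M : R) (X K a : nat) : 1 <= M -> X%:R <= 2 * M ->
  K.+1%:R * X%:R ^+ a <= K.+1%:R * 2 ^+ a * M ^+ a.
Proof.
move=> M1 XM; rewrite -mulrA ler_wpM2l // -exprMn lerXn2r ?nnegrE //.
by rewrite mulr_ge0 // (le_trans ler01).
Qed.

Lemma le_max_thresholds (x y z : R) : exists M0, forall M, M0 <= M ->
  [/\ x <= M, y <= M & z <= M].
Proof.
by exists (Num.max x (Num.max y z)) => M; rewrite !ge_max => /andP[-> /andP[-> ->]].
Qed.

Section ExtremeLimits.

Hypothesis hk : k = 0%N \/ k = d.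

Lemma ratioA_extreme : lim_along R (Btilde R k d) (ratioA R k d) d%:R.
Proof.
apply: lim_alongP => [M0|e e0].
  exists (maxn (Num.truncn M0).+1 d.+1)%:R.
    by apply: (card_Atilde_dominant R hk _).1; rewrite leq_max ltnSn orbT.
  by apply/ltW/(lt_le_trans (truncnS_gt M0)); rewrite ler_nat leq_maxl.
have [K HK] := card_Atilde_extreme_le R hk.
set K1 : R := K.+1%:R * 2 ^+ d; set K2 : R := ((2 * d.+1) ^ d)%:R.
have K10 : 0 < K1 by rewrite mulr_gt0 ?exprn_gt0.
have K20 : 0 < K2 by rewrite ltr0n expn_gt0.
have [M0 HM] := le_max_thresholds d.+1%:R (threshold 1 K1 e) (threshold 1 K2 e).
exists M0 => M bM /HM [dM t1 t2]; have [M1 _] := bM.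
rewrite -[d%:R](divr1 d%:R); apply/andP; split.
  apply: (ratio_ge (r := 1) _ K20 e0 t2) => //.
  have [n n0 Dn] := extreme_nat hk bM; rewrite Dn expr1 -natrM -natrX ler_nat.
  apply: (card_Atilde_dominant R hk _).2.
  by rewrite -(ler_nat R) -Dn.
apply: (ratio_le (r := 1) _ K10 e0 t1) => //.
have [X0 MX XM] := nat_double M1; apply: le_trans (doubleX_le K d M1 XM).
by apply: natX_le; rewrite expn1; apply: HK.
Qed.

Lemma ratioB_extreme : lim_pinfty R (ratioB R k d) 1.
Proof.
apply: lim_pinftyP => e e0.
have [M0 HM] := le_max_thresholds (2 * d.+1)%:R (threshold 1 2 e) (threshold 1 4 e).
exists M0 => M /HM [dM t1 t2].
have M1 : 1 <= M by apply: le_trans dM; rewrite ler1n.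
have [X0 MX XM] := nat_double M1; have e1 : 1 = 1%:R / 1%:R :> R by rewrite divr1.
rewrite [X in X - e]e1 [X in X + e]e1 /ratioB.
apply/andP; split.
  apply: (@ratio_ge R 1 1 _ 4 e M) => //; rewrite !expr1.
  have /andP[nM _] := truncn_itv (le_trans ler01 M1).
  apply: le_trans MX _; rewrite -[4]/(4%:R) -natrM ler_nat.
  apply: leq_trans (_ : 4 * (Num.truncn M - d) <= _)%N.
    by move: dM; rewrite -truncn_ge_nat ?(le_trans ler01) //; lia.
  rewrite leq_mul2l /=; apply: leq_trans (card_BtildeM_extreme_ge R hk _) _.
  exact: card_BtildeM_mono.
apply: (@ratio_le R 1 1 _ 2 e M) => //; rewrite !expr1; apply: le_trans XM.
by rewrite ler_nat; apply: card_BtildeM_extreme_le.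
Qed.

End ExtremeLimits.

Section GenericLimits.

Hypothesis kd : (0 < k < d)%N.

Lemma liminf_ratioA : liminf_along R (Btilde R k d) (ratioA R k d) = 0%:E.
Proof.
apply: liminf_alongP => [e e0|e M0 e0].
  (* The lower bound is immediate because logarithms of natural numbers are nonnegative here. *)
  exists 1 => M _ M1; rewrite sub0r; apply: le_trans (_ : 0 <= _); first by rewrite oppr_le0 ltW.
  by rewrite divr_ge0 ?ln_nat_ge0 ?ln_ge0.
have e2 : 0 < e / 2 by rewrite divr_gt0.
have [r [r0 re]] := small_inverse e2; have [K HK] := small_card_Atilde R kd r0.
pose n := (Num.truncn (Num.max M0 (threshold r K.+1%:R (e / 2)))).+1.
have [M [bM nM le]] := HK n (ltn0Sn _).
have nM0 : Num.max M0 (threshold r K.+1%:R (e / 2)) <= M.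
  by apply: le_trans nM; apply/ltW/truncnS_gt.
move: nM0; rewrite ge_max => /andP[MM0 tM]; exists M; split=> //.
apply: le_trans (ratio_le (a := 1) r0 _ e2 tM _) _ => //; last by rewrite add0r; lra.
rewrite expr1; apply: le_trans (_ : K.+1%:R * n%:R <= _); last by rewrite ler_wpM2l.
by rewrite -[n%:R]expr1; apply: natX_le; rewrite expn1.
Qed.

Lemma limsup_ratioA : limsup_along R (Btilde R k d) (ratioA R k d) = (maxn k (d - k))%:R%:E.
Proof.
set E := maxn k (d - k); apply: limsup_alongP => [e e0|e M0 e0].
  have e2 : 0 < e / 2 by rewrite divr_gt0.
  have [r [r0 re]] := small_inverse e2; have [K [_ HK]] := card_Atilde_le R kd r0.
  set K1 : R := K.+1%:R * 2 ^+ (E * r).+1.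
  have K10 : 0 < K1 by rewrite mulr_gt0 ?exprn_gt0.
  exists (threshold r K1 (e / 2)) => M [M1 _] tM.
  have [X0 MX XM] := nat_double M1.
  apply: le_trans (ratio_le (a := (E * r).+1) r0 K10 e2 tM _) _.
    by apply: le_trans (doubleX_le K _ M1 XM); apply: natX_le; apply: HK.
  have rR : r%:R != 0 :> R by rewrite pnatr_eq0 -lt0n.
  have -> : (E * r).+1%:R / r%:R = E%:R + 1 / r%:R :> R.
    by rewrite -natr1 natrM mulrDl mulfK.
  lra.
set K2 : R := ((2 * d.+1) ^ d)%:R.
have K20 : 0 < K2 by rewrite ltr0n expn_gt0.
pose n := (maxn d (Num.truncn (Num.max M0 (threshold 1 K2 e)))).+1.
have [||bn le] := @card_Atilde_integer R k d n => //; first by rewrite ltnS leq_maxl.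
have nM0 : Num.max M0 (threshold 1 K2 e) <= n%:R.
  by apply/ltW/(lt_le_trans (truncnS_gt _)); rewrite ler_nat ltnS leq_maxr.
move: nM0; rewrite ge_max => /andP[nM0 tM]; exists n%:R; split=> //.
rewrite -[E%:R]divr1; apply: (ratio_ge (r := 1) _ K20 e0 tM) => //.
by rewrite expr1 -natrM -natrX ler_nat.
Qed.

Lemma ratioB_generic : lim_pinfty R (ratioB R k d) d.+1%:R.
Proof.
apply: lim_pinftyP => e e0; have e2 : 0 < e / 2 by rewrite divr_gt0.
have [r [r0 re]] := small_inverse e2; have [C [D [C0 D0 H]]] := card_BtildeM_ge R kd r0.
have [K [_ HK]] := card_BtildeM_le R d.
set K1 : R := K.+1%:R * 2 ^+ d.+1; set a := (d.+1 * r).-1.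
set K2 : R := (2 * D)%:R ^+ a * C%:R.
have K10 : 0 < K1 by rewrite mulr_gt0 ?exprn_gt0.
have K20 : 0 < K2 by rewrite mulr_gt0 ?exprn_gt0 ?ltr0n // muln_gt0.
have [M0 HM] := le_max_thresholds D%:R (threshold 1 K1 e) (threshold r K2 (e / 2)).
exists M0 => M /HM [DM t1 t2].
have M1 : 1 <= M by apply: le_trans DM; rewrite ler1n.
have [X0 MX XM] := nat_double M1.
have rR : r%:R != 0 :> R by rewrite pnatr_eq0 -lt0n.
apply/andP; split; last first.
  rewrite -[d.+1%:R]divr1; apply: (ratio_le (r := 1) _ K10 e0 t1) => //.
  apply: le_trans (doubleX_le K _ M1 XM); apply: natX_le; rewrite expn1.
  exact: (HK k _ _ MX).2.
apply: le_trans (ratio_ge (a := a) r0 K20 e2 t2 _).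
  have : a.+1%:R / r%:R = d.+1%:R :> R by rewrite /a prednK ?muln_gt0 // natrM mulfK.
  rewrite -natr1 mulrDl => h; lra.
have DR : 0 < D%:R :> R by rewrite ltr0n.
have MD1 : 1 <= M / D%:R by rewrite ler_pdivlMr // mul1r.
(* The measures constructed at level n reach up to D n, and D n <= M <= 2 D n. *)
set n := Num.truncn (M / D%:R).
have n0 : (0 < n)%N by rewrite truncn_gt0.
have /andP[nM Mn] := truncn_itv (le_trans ler01 MD1).
have M2 : M <= (2 * D)%:R * n%:R.
  move: Mn; rewrite ltr_pdivrMr // => /ltW /le_trans; apply.
  rewrite -!natrM ler_nat -/n mulnC -mulnA mulnCA leq_mul2l; apply/orP; right.
  by move: n0; clear; lia.
apply: le_trans (_ : ((2 * D)%:R * n%:R) ^+ a <= _).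
  by rewrite lerXn2r ?nnegrE ?mulr_ge0 // (le_trans ler01).
rewrite exprMn /K2 -mulrA ler_wpM2l ?exprn_ge0 //.
rewrite -!natrX -natrM ler_nat; apply: leq_trans (H n n0) _.
rewrite leq_mul2l leq_exp2rW ?orbT //; apply: card_BtildeM_mono.
by rewrite natrM mulrC -ler_pdivlMr.
Qed.

End GenericLimits.

End Limits.

Theorem theorem8p1 (R : realType) (d k : nat) :
  ((k = 0%N \/ k = d) ->
     lim_along R (Btilde R k d) (ratioA R k d) d%:R /\
     lim_pinfty R (ratioB R k d) 1) /\
  ((0 < k < d)%N ->
     liminf_along R (Btilde R k d) (ratioA R k d) = (0%:R)%:E /\
     limsup_along R (Btilde R k d) (ratioA R k d) = ((maxn k (d - k))%:R)%:E /\
     lim_pinfty R (ratioB R k d) (d.+1)%:R).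
Proof.
split=> [hk|kd]; first by split; [exact: ratioA_extreme | exact: ratioB_extreme].
split; first exact: liminf_ratioA.
by split; [exact: limsup_ratioA | exact: ratioB_generic].
Qed.
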